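(* Let $\mathfrak g$ be a real finite-dimensional semisimple Lie algebra with corresponding $1$-connected Lie group $G$, and let $\mathcal O\subset\mathfrak g^{*}$ be an orbit of the coadjoint representation of $G$. Let $P(\mathcal O)$ be the Poisson algebra of polynomial functions on $\mathcal O$. Then $P(\mathcal O)$ is simple as a Poisson algebra if and only if the orbit $\mathcal O$ is semisimple.
   Context: The symmetric algebra $S(\mathfrak g)$ is identified with the algebra of polynomial functions on $\mathfrak g^{*}$. It is a Poisson algebra: its bracket $\{\,,\}$ is determined by $\{\xi,\eta\}=[\xi,\eta]$ for $\xi,\eta\in\mathfrak g$ and extended to all of $S(\mathfrak g)$ by the Leibniz rule. For a coadjoint orbit $\mathcal O$, $I(\mathcal O)\subset S(\mathfrak g)$ denotes the ideal of polynomials vanishing on $\mathcal O$; it is a Poisson ideal. $P(\mathcal O)$ is the algebra of restrictions to $\mathcal O$ of polynomials on $\mathfrak g^*$, identified with $S(\mathfrak g)/I(\mathcal O)$, with the induced Poisson bracket. A Poisson ideal of a Poisson algebra is an associative ideal which is also a Lie ideal. A Poisson algebra $P$ is simple if the only Poisson ideals of $P$ are $P$ and $\{0\}$. A coadjoint orbit $\mathcal O$ is semisimple (standard notion) if its points correspond, under the identification $\mathfrak g^*\cong\mathfrak g$ given by the Killing form, to semisimple elements of $\mathfrak g$, i.e. elements $x$ for which $\mathrm{ad}_x$ is diagonalizable over $\mathbb C$. *)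

(* Defs.v *)
From HB Require Import structures.
From mathcomp Require Import all_boot all_order all_algebra.
From mathcomp Require Import generic_quotient ring_quotient complex.
From mathcomp Require Import all_classical all_reals all_analysis.
From mathcomp Require Import ring.
(* The notations of mpoly are incompatible with those of analysis. *)
From mathcomp Require mpoly.
Import (canonicals, coercions) mpoly.

Set Implicit Arguments.
Unset Strict Implicit.
Unset Printing Implicit Defensive.

Import Order.TTheory GRing.Theory Num.Theory.
Import numFieldNormedType.Exports.

Local Open Scope classical_set_scope.
Local Open Scope ring_scope.

Record lieAlgebra (R : fieldType) := LieAlgebra {
  lie_space :> vectType R;
  lie : lie_space -> lie_space -> lie_space;
  lie_linearl : forall (a : R) x y z,
    lie (a *: x + y) z = a *: lie x z + lie y z;
  lie_linearr : forall (a : R) x y z,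
    lie z (a *: x + y) = a *: lie z x + lie z y;
  liexx : forall x, lie x x = 0;
  lie_jacobi : forall x y z,
    lie x (lie y z) + lie y (lie z x) + lie z (lie x y) = 0
}.

Section LieAlgebras.
Variables (R : fieldType) (g : lieAlgebra R).

Definition lie_ad (x : g) : 'End(g) := linfun (lie x).

Definition lie_ideal (I : {vspace g}) : Prop :=
  forall x y : g, y \in I -> lie x y \in I.

(* By bilinearity, the span of all [lie x y] with [x] in [U] and [y] in [V]. *)
Definition lie_comm (U V : {vspace g}) : {vspace g} :=
  <<[seq lie x y | x <- vbasis U, y <- vbasis V]>>%VS.

Definition lie_solvable (I : {vspace g}) : Prop :=
  exists k, iter k (fun U => lie_comm U U) I = 0%VS.

Definition lie_semisimple : Prop :=
  forall I : {vspace g}, lie_ideal I -> lie_solvable I -> I = 0%VS.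

Definition lie_dual := 'Hom(g, R^o).

Local Notation e := (vbasis {:g}).

Definition ad_mx (x : g) : 'M[R]_(\dim {:g}) := passmx.mxof e e (lie_ad x).

Definition killing (x y : g) : R := \tr (ad_mx x *m ad_mx y).

(* The symmetric algebra of [g], as polynomials in the basis [e]: the variable *)
(* ['X_i] stands for [e`_i], see [sym_of].                                     *)
Definition lie_sym := mpoly.mpoly (\dim {:g}) R.

Definition sym_of (x : g) : lie_sym :=
  \sum_i coord e i x *: mpoly.mpolyX R (mpoly.mnm1 i).

Definition sym_eval (p : lie_sym) (phi : lie_dual) : R :=
  mpoly.meval (fun i => phi e`_i) p.

(* The Leibniz extension of the Lie bracket of [g], in coordinates: see        *)
(* [sym_bracket_of], [sym_bracketMr] and [sym_bracketN] below.                 *)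
Definition sym_bracket (p q : lie_sym) : lie_sym :=
  \sum_i \sum_j mpoly.mderiv i p * mpoly.mderiv j q * sym_of (lie e`_i e`_j).

Lemma sym_eval_of (x : g) (phi : lie_dual) : sym_eval (sym_of x) phi = phi x.
Proof.
rewrite /sym_eval /sym_of raddf_sum /= [in RHS](coord_vbasis (memvf x)).
rewrite linear_sum; apply: eq_bigr => i _ /=.
by rewrite mpoly.mevalZ mpoly.mevalXU linearZ.
Qed.

Lemma sym_bracketMr (p q r : lie_sym) :
  sym_bracket p (q * r) = sym_bracket p q * r + q * sym_bracket p r.
Proof.
rewrite /sym_bracket mulr_suml mulr_sumr -big_split; apply: eq_bigr => i _ /=.
rewrite mulr_suml mulr_sumr -big_split; apply: eq_bigr => j _ /=.
rewrite mpoly.mderivM; ring.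
Qed.

Lemma sym_bracketN (p q : lie_sym) : sym_bracket p q = - sym_bracket q p.
Proof.
have lieC (x y : g) : lie x y = - lie y x.
  have Dl (u v w : g) : lie (u + v) w = lie u w + lie v w.
    by rewrite -[u]scale1r lie_linearl !scale1r.
  have Dr (u v w : g) : lie w (u + v) = lie w u + lie w v.
    by rewrite -[u]scale1r lie_linearr !scale1r.
  have := liexx (x + y); rewrite Dl !Dr !liexx add0r addr0.
  by move/eqP; rewrite addr_eq0 => /eqP.
rewrite /sym_bracket exchange_big -sumrN; apply: eq_bigr => i _ /=.
rewrite -sumrN; apply: eq_bigr => j _ /=.
have sN (x : g) : sym_of (- x) = - sym_of x.
  by rewrite /sym_of -sumrN; apply: eq_bigr => k _; rewrite raddfN scaleNr.
by rewrite lieC sN mulrN [X in X * _]mulrC.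
Qed.

Lemma sym_bracket_of (x y : g) :
  sym_bracket (sym_of x) (sym_of y) = sym_of (lie x y).
Proof.
have dof (i : 'I_(\dim {:g})) (z : g) :
    mpoly.mderiv i (sym_of z) = mpoly.mpolyC _ (coord e i z).
  rewrite /sym_of raddf_sum (bigD1 i)//= big1 ?addr0 => [|j /negPf ji];
    rewrite mpoly.mderivZ mpoly.mderivX mpoly.mnm1E ?ji ?eqxx;
    last by rewrite scale0r scaler0.
  rewrite scale1r -mpoly.alg_mpolyC; congr (_ *: _).
  rewrite -mpoly.mpolyX0; congr mpoly.mpolyX.
  by apply/mpoly.mnmP => k; rewrite mpoly.mnmBE mpoly.mnm0E subnn.
have lie_suml (I : finType) (c : I -> R) (v : I -> g) z :
    lie (\sum_i c i *: v i) z = \sum_i c i *: lie (v i) z.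
  have lie0 : lie 0 z = 0.
    by have := lie_linearl (-1) 0 0 z; rewrite !scaleN1r oppr0 addr0 addNr.
  by elim/big_rec2: _ => // i u1 u2 _ <-; rewrite lie_linearl.
have lie_sumr (I : finType) (c : I -> R) (v : I -> g) z :
    lie z (\sum_i c i *: v i) = \sum_i c i *: lie z (v i).
  have lie0 : lie z 0 = 0.
    by have := lie_linearr (-1) 0 0 z; rewrite !scaleN1r oppr0 addr0 addNr.
  by elim/big_rec2: _ => // i u1 u2 _ <-; rewrite lie_linearr.
have sP (I : finType) (c : I -> R) (v : I -> g) :
    sym_of (\sum_i c i *: v i) = \sum_i c i *: sym_of (v i).
  rewrite /sym_of; under [RHS]eq_bigr => i _ do rewrite scaler_sumr.
  rewrite exchange_big; apply: eq_bigr => k _ /=.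
  rewrite linear_sum scaler_suml; apply: eq_bigr => i _.
  by rewrite scalerA; congr (_ *: _) => /=; rewrite linearZ.
rewrite [in RHS](coord_vbasis (memvf x)) [in RHS](coord_vbasis (memvf y)).
rewrite lie_suml sP; apply: eq_bigr => i _.
rewrite lie_sumr sP scaler_sumr; apply: eq_bigr => j _.
by rewrite !dof -mulrA !mpoly.mul_mpolyC.
Qed.

End LieAlgebras.

HB.instance Definition _ (R : fieldType) (g : lieAlgebra R) :=
  GRing.ComNzRing.on (lie_sym g).

Section PoissonIdeals.
Variables (A : comNzRingType) (br : A -> A -> A).

(* Stability under scalars is part of being an ideal of a unital algebra. *)
Definition poisson_ideal (J : set A) : Prop :=
  [/\ J 0,
      forall x y, J x -> J y -> J (x + y),
      forall a x, J x -> J (a * x)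
    & forall a x, J x -> J (br a x)].

Definition poisson_simple : Prop :=
  forall J, poisson_ideal J -> J = [set: A] \/ J = [set 0].

End PoissonIdeals.

Section Smooth.
Variables (R : realType) (V W : normedModType R).

(* For [U] open, [f] is k times continuously differentiable on [U]; the values *)
(* of [f] outside [U] are irrelevant.                                          *)
Fixpoint Ck_on (k : nat) (U : set V) (f : V -> W) : Prop :=
  if k is k'.+1 then
    (forall x, U x -> differentiable f x) /\
    (forall v : V, Ck_on k' U (fun x => 'D_v f x))
  else forall x, U x -> {for x, continuous f}.

Definition smooth_on (U : set V) (f : V -> W) : Prop :=
  forall k, Ck_on k U f.

End Smooth.

HB.mixin Record isTopologicalGroup G of Group G & Topological G := {
  mulg_continuous : continuous (fun x : G * G => (x.1 * x.2)%g);
  invg_continuous : continuous (fun x : G => (x^-1)%g)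
}.

#[short(type="topologicalGroupType")]
HB.structure Definition TopologicalGroup :=
  { G of Group G & Topological G & isTopologicalGroup G }.

Record chart (R : realType) (n : nat) (M : topologicalType) := Chart {
  chart_dom : set M;
  chart_to : M -> 'rV[R]_n;
  chart_from : 'rV[R]_n -> M;
  chart_dom_open : open chart_dom;
  chart_img_open : open (chart_to @` chart_dom);
  chart_toK : forall x, chart_dom x -> chart_from (chart_to x) = x;
  chart_to_continuous :
    forall x, chart_dom x -> {for x, continuous chart_to};
  chart_from_continuous :
    forall u, (chart_to @` chart_dom) u -> {for u, continuous chart_from}
}.

Definition chart_img R n M (c : chart R n M) : set 'rV[R]_n :=
  chart_to c @` chart_dom c.

(* The atlas is given by the choice of a chart around each point. *)
Record lieGroup (R : realType) (n : nat) := LieGroup {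
  lie_carrier :> topologicalGroupType;
  lie_hausdorff : hausdorff_space lie_carrier;
  lie_second_countable : @second_countable lie_carrier;
  chart_at : lie_carrier -> chart R n lie_carrier;
  chart_at_dom : forall a, chart_dom (chart_at a) a;
  chart_at_smooth : forall a b,
    smooth_on
      [set u | chart_img (chart_at a) u /\
               chart_dom (chart_at b) (chart_from (chart_at a) u)]
      (chart_to (chart_at b) \o chart_from (chart_at a));
  mulg_smooth : forall a b c,
    let m (u : 'rV[R]_n * 'rV[R]_n) :=
      (chart_from (chart_at a) u.1 * chart_from (chart_at b) u.2)%g in
    smooth_on
      [set u | [/\ chart_img (chart_at a) u.1, chart_img (chart_at b) u.2
                 & chart_dom (chart_at c) (m u)]]
      (chart_to (chart_at c) \o m);
  invg_smooth : forall a b,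
    let i (u : 'rV[R]_n) := ((chart_from (chart_at a) u)^-1)%g in
    smooth_on
      [set u | chart_img (chart_at a) u /\ chart_dom (chart_at b) (i u)]
      (chart_to (chart_at b) \o i)
}.

Section LieGroups.
Variables (R : realType) (n : nat) (G : lieGroup R n).

(* The tangent space at the unit is ['rV[R]_n], through the chart [chart1]. *)
Definition chart1 : chart R n G := chart_at (1%g : G).
Definition unit_coord : 'rV[R]_n := chart_to chart1 (1%g : G).

(* The differential at the unit of the conjugation by [a]. *)
Definition group_Ad (a : G) : 'End('rV[R]_n) :=
  linfun ('d (fun u => chart_to chart1 (a * chart_from chart1 u * a^-1)%g)
            unit_coord).

(* The bracket of tangent vectors at the unit is the differential of [Ad]. *)
Definition group_bracket (v w : 'rV[R]_n) : 'rV[R]_n :=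
  'D_v (fun u => group_Ad (chart_from chart1 u) w) unit_coord.

Definition loop_contractible (c : R -> G) : Prop :=
  exists H : R * R -> G,
    [/\ {within `[0, 1]%classic `*` `[0, 1]%classic, continuous H},
        (forall t, t \in `[0, 1] -> H (0, t) = c t),
        (forall t, t \in `[0, 1] -> H (1, t) = c 0)
      & (forall s, s \in `[0, 1] -> H (s, 0) = c 0 /\ H (s, 1) = c 0)].

Definition one_connected : Prop :=
  connected [set: G] /\
  forall c : R -> G,
    {within `[0, 1], continuous c} -> c 0 = c 1 -> loop_contractible c.

End LieGroups.

(* An identification of [g] with the Lie algebra of [G]. *)
Record lieGroupAlgebra (R : realType) (g : lieAlgebra R) (n : nat)
    (G : lieGroup R n) := LieGroupAlgebra {
  lie_tangent : 'Hom(g, 'rV[R]_n);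
  lie_tangent_inj : lker lie_tangent = 0%VS;
  lie_tangent_surj : limg lie_tangent = fullv;
  lie_tangent_bracket : forall x y : g,
    lie_tangent (lie x y) = group_bracket G (lie_tangent x) (lie_tangent y)
}.

Section Coadjoint.
Variables (R : realType) (g : lieAlgebra R) (n : nat) (G : lieGroup R n).
Variable theta : lieGroupAlgebra g G.

Definition Ad (a : G) : 'End(g) :=
  ((lie_tangent theta)^-1 \o group_Ad a \o lie_tangent theta)%VF.

Definition coAd (a : G) (phi : lie_dual g) : lie_dual g :=
  (phi \o Ad (a^-1)%g)%VF.

Record coadjointOrbit := CoadjointOrbit {
  orbit_set :> set (lie_dual g);
  orbitP : exists phi, orbit_set = range (coAd^~ phi)
}.

Variable O : coadjointOrbit.

Definition vanishing : pred (lie_sym g) :=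
  fun p => `[< forall phi, orbit_set O phi -> sym_eval p phi = 0 >].

Lemma vanishing_ideal : idealr_closed vanishing.
Proof.
split=> [||a p q].
- by apply/asboolP => phi _; rewrite /sym_eval mpoly.meval0.
- apply/negP => /asboolP; case: (orbitP O) => phi -> /(_ (coAd 1%g phi)).
  rewrite /sym_eval mpoly.meval1 => /(_ (ex_intro2 _ _ 1%g I erefl)).
  exact/eqP/oner_neq0.
- move=> /asboolP p0 /asboolP q0; apply/asboolP => phi Ophi.
  by rewrite /sym_eval mpoly.mevalD mpoly.mevalM [mpoly.meval _ p]p0//
             [mpoly.meval _ q]q0// mulr0 addr0.
Qed.

HB.instance Definition _ :=
  isIdealr.Build (lie_sym g) vanishing vanishing_ideal.

Definition orbit_ideal : idealr (lie_sym g) := vanishing.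

(* The algebra of polynomial functions on [O]. *)
Definition orbit_alg := {ideal_quot orbit_ideal}.

HB.instance Definition _ := GRing.ComNzRing.on orbit_alg.

(* The bracket induced on the quotient; it does not depend on the choice of    *)
(* the representatives because [orbit_ideal] is a Poisson ideal.               *)
Definition orbit_bracket (u v : orbit_alg) : orbit_alg :=
  (\pi_orbit_alg (sym_bracket (repr u) (repr v)))%qT.

End Coadjoint.

Section SemisimpleOrbits.
Variables (R : realType) (g : lieAlgebra R).

Definition ad_semisimple (x : g) : Prop :=
  diagonalizable (map_mx (real_complex R) (ad_mx x)).

Definition semisimple_orbit (O : set (lie_dual g)) : Prop :=
  forall phi, O phi ->
    exists x : g, (forall y, phi y = killing x y) /\ ad_semisimple x.

End SemisimpleOrbits.

(* Main.v *)
(* By the Killing form, which is nondegenerate, points of the dual are elements of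
   the algebra. If [m] is a separable polynomial, the entries of [m(ad x)], as
   polynomial functions of [x], span a space stable under the Hamiltonian vector
   fields of linear functions.

   Suppose that P(O) is simple, and let [x] in [O] have the Jordan decomposition
   [x = s + n], with [m(ad x)] nilpotent and [m(ad s) = 0]. The ideal generated by
   I(O) and by these entries is Poisson. It vanishes at [s]: there is [h] with
   [[h, s] = 0] and [[h, n] = n], so that polynomials vanishing on [O] vanish on
   the points [s + exp(t) n], hence at [s]. So this ideal is proper, the entries
   vanish on [O], and [x] is semisimple.

   Conversely, let [O] be semisimple, so that the entries of [m(ad x)] vanish on [O]
   for some [m], and let [J] be a Poisson ideal that contains I(O). By uniqueness
   for linear differential equations and connectedness of [G], [J] vanishes either
   on the whole of [O], and then [J = I(O)], or nowhere on [O]. In the second case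
   consider two generic points [x] and [y]. Since [m(ad x)] vanishes on [O], there
   is a combination of Hamiltonian vector fields in [y] that acts on functions
   modulo I(O) as the Euler operator of the diagonal [x = y], to first order. This
   places the functions [f(y)] with [f] in [J], modulo [J] in [x] and I(O) in [y], in
   all the powers of the ideal of the diagonal. By Krull's theorem, some [u(x, y)]
   equal to 1 on the diagonal multiplies them into that ideal. At the points [y] of
   [O], where [J] does not vanish, this gives [u(x, y)] in [J], whence
   [1 = u(x, x)] is in [J]. *)

From HB Require Import structures.
Require Import Defs.
From mathcomp Require Import all_boot all_order all_algebra.
From mathcomp Require Import generic_quotient ring_quotient separable complex ring lra zify.
From mathcomp Require Import all_classical all_reals all_analysis.
(* The notations of mpoly are incompatible with those of analysis. *)
From mathcomp Require mpoly.
Import -(notations) mpoly.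

Set Implicit Arguments.
Unset Strict Implicit.
Unset Printing Implicit Defensive.

Import Order.TTheory GRing.Theory Num.Theory.
Import numFieldNormedType.Exports passmx.

Local Open Scope classical_set_scope.
Local Open Scope ring_scope.

(** Over the reals an ideal without zeros may be proper, so the absence of zeros of [J] on the orbit
    does not by itself put 1 in [J]: the brackets must be used again, and the pair of generic points
    is the device for this. Semisimplicity enters through the polynomial condition m(ad x) = 0,
    because its first-order deformations at x lie in [g, x], the tangent directions of the orbit. So
    y - x is [y, h] up to second order, with h linear in y - x, and the Hamiltonian fields with
    coefficients h make up the Euler operator: on the k-th power of the diagonal ideal it is
    multiplication by k modulo the next power. On functions f(y) with f in [J] it also raises the
    order by one, since h vanishes on the diagonal; comparing the two and dividing by k gains one
    order.

    The Killing form is shown to be nondegenerate by Engel's theorem and Cartan's trace argument.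
    The derivations that this requires come from additive functions of complex eigenvalues; complex
    conjugation takes the place of the usual rational linear forms. *)

Lemma eq_flatmx (T : pzSemiRingType) n (X Y : 'M[T]_(0, n)) : X = Y.
Proof. by rewrite [X]flatmx0 [Y]flatmx0. Qed.

(** * Polynomials of matrices *)

Section PolyMx.
Variables (A : comNzRingType) (n : nat).
Implicit Types (p q : {poly A}) (X Y : 'M[A]_n).

(* Unlike [horner_mx], this is defined in all dimensions. *)
Definition hmx p X : 'M[A]_n := \sum_(i < size p) p`_i *: X ^+ i.
End PolyMx.

Section PolyMxTheory.
Variables (A : comNzRingType).
Implicit Types (p q : {poly A}).

Lemma hmxE n p (X : 'M[A]_n.+1) : hmx p X = horner_mx X p.
Proof.
rewrite -[in RHS](coefK p) poly_def rmorph_sum /=; apply: eq_bigr => i _.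
by rewrite horner_mxZ rmorphXn /= horner_mx_X.
Qed.

Lemma hmxD n p q (X : 'M[A]_n) : hmx (p + q) X = hmx p X + hmx q X.
Proof. by case: n X => [|n] X; rewrite ?hmxE ?rmorphD//; exact: eq_flatmx. Qed.

Lemma hmxN n p (X : 'M[A]_n) : hmx (- p) X = - hmx p X.
Proof. by case: n X => [|n] X; rewrite ?hmxE ?rmorphN//; exact: eq_flatmx. Qed.

Lemma hmxM n p q (X : 'M[A]_n) : hmx (p * q) X = hmx p X *m hmx q X.
Proof. by case: n X => [|n] X; rewrite ?hmxE ?rmorphM//; exact: eq_flatmx. Qed.

Lemma hmxXn n p k (X : 'M[A]_n) : hmx (p ^+ k) X = hmx p X ^+ k.
Proof. by case: n X => [|n] X; rewrite ?hmxE ?rmorphXn//; exact: eq_flatmx. Qed.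

Lemma hmxC n c (X : 'M[A]_n) : hmx c%:P X = c%:M.
Proof. by case: n X => [|n] X; rewrite ?hmxE ?horner_mx_C//; exact: eq_flatmx. Qed.

Lemma hmxX n (X : 'M[A]_n) : hmx 'X X = X.
Proof. by case: n X => [|n] X; rewrite ?hmxE ?horner_mx_X//; exact: eq_flatmx. Qed.

Lemma hmx0 n (X : 'M[A]_n) : hmx 0 X = 0.
Proof. by rewrite /hmx size_poly0 big_ord0. Qed.

Lemma hmx_comp n p q (X : 'M[A]_n) : hmx (p \Po q) X = hmx p (hmx q X).
Proof.
elim/poly_ind: p => [|p c IHp]; first by rewrite comp_poly0 !hmx0.
by rewrite comp_polyD comp_polyM comp_polyX comp_polyC !(hmxD, hmxM) IHp hmxX !hmxC.
Qed.

Lemma hmx_comm n p (X Y : 'M[A]_n) :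
  X *m Y = Y *m X -> hmx p X *m Y = Y *m hmx p X.
Proof.
move=> XY; elim/poly_ind: p => [|p c IHp]; first by rewrite hmx0 mul0mx mulmx0.
by rewrite !(hmxD, hmxM) hmxX hmxC mulmxDl mulmxDr -mulmxA XY mulmxA IHp -mulmxA scalar_mxC.
Qed.

Lemma hmx_inter m n p (X : 'M[A]_n) (Y : 'M[A]_m) (Q : 'M[A]_(m, n)) :
  Q *m X = Y *m Q -> Q *m hmx p X = hmx p Y *m Q.
Proof.
move=> QX; elim/poly_ind: p => [|p c IHp]; first by rewrite !hmx0 mul0mx mulmx0.
rewrite !(hmxD, hmxM) !hmxX !hmxC mulmxDl mulmxDr mulmxA IHp -mulmxA QX mulmxA.
by rewrite scalar_mxC.
Qed.

Lemma hmx_diag n p (d : 'rV[A]_n) :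
  hmx p (diag_mx d) = diag_mx (map_mx (horner p) d).
Proof.
by case: n d => [|n] d; rewrite ?hmxE ?horner_mx_diag//; exact: eq_flatmx.
Qed.

Lemma hmx_char_poly n (X : 'M[A]_n) : hmx (char_poly X) X = 0.
Proof.
by case: n X => [|n] X; rewrite ?hmxE ?Cayley_Hamilton//; exact: eq_flatmx.
Qed.

Lemma comp_poly_taylor2 (p q e : {poly A}) :
  exists w, p \Po (q + e) = p \Po q + (p^`() \Po q) * e + e ^+ 2 * w.
Proof.
elim/poly_ind: p => [|p c [w IHp]].
  by exists 0; rewrite derivC !comp_poly0; ring.
exists ((p^`() \Po q) + w * (q + e)).
rewrite derivMXaddC !comp_polyD !comp_polyM !comp_polyX !comp_polyC IHp.
by ring.
Qed.

Lemma mxexp_comm n (X Y : 'M[A]_n) k :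
  X *m Y = Y *m X -> X ^+ k *m Y = Y *m X ^+ k.
Proof. by move=> XY; apply: commr_sym; apply: commrX; apply: esym. Qed.

Lemma mul_nilp_comm n (X Y : 'M[A]_n) k :
  X *m Y = Y *m X -> X ^+ k = 0 -> (X *m Y) ^+ k = 0.
Proof. by move=> XY Xk; rewrite mulmxE exprMn_comm// Xk mul0r. Qed.

End PolyMxTheory.

Lemma map_hmx (A B : comNzRingType) (f : {rmorphism A -> B}) n (p : {poly A}) (X : 'M[A]_n) :
  map_mx f (hmx p X) = hmx (map_poly f p) (map_mx f X).
Proof.
by case: n X => [|n] X; rewrite ?hmxE ?[in RHS]hmxE ?map_horner_mx//; exact: eq_flatmx.
Qed.

(** * Separable polynomials and the Jordan-Chevalley decomposition *)

Section Separable.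
Variable F : numFieldType.
Implicit Types (p q m : {poly F}).

Lemma separable_of_nilpotent n (X : 'M[F]_n) :
  exists m k, separable_poly m /\ hmx m X ^+ k = 0.
Proof.
pose P d := exists p k, [/\ p != 0, hmx p X ^+ k = 0 & size p = d].
have [d Pd min_d] : exists2 d, P d & forall d', P d' -> (d <= d')%N.
  have exP : exists d, `[< P d >].
    exists (size (char_poly X)); apply/asboolP; exists (char_poly X), 1; split=> //.
      exact/monic_neq0/char_poly_monic.
    by rewrite expr1 hmx_char_poly.
  exists (ex_minn exP); case: ex_minnP => d /asboolP// _ min_d d' Pd'.
  by apply: min_d; apply/asboolP.
case: Pd => p [k [p0 pX sp]]; exists p, k; split=> //.
have sqf u : u * u %| p -> (size u <= 1)%N.
  move=> /dvdpP[v pE]; have /norP[v0 uu0] : ~~ ((v == 0) || (u * u == 0)).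
    by rewrite -mulf_eq0 -pE.
  have u0 : u != 0 by move: uu0; rewrite mulf_eq0 orbb.
  have : P (size (v * u)).
    exists (v * u), (k + k)%N; split=> //; first by rewrite mulf_neq0.
    have -> : hmx (v * u) X ^+ (k + k) = hmx v X ^+ k * hmx p X ^+ k.
      rewrite -!hmxXn -mulmxE -hmxM; congr hmx.
      by rewrite pE !exprMn !exprD; ring.
    by rewrite pX mulr0.
  move/min_d; rewrite -sp pE mulrA !size_mul ?mulf_neq0//.
  have su : (0 < size u)%N by rewrite size_poly_gt0.
  have sv : (0 < size v)%N by rewrite size_poly_gt0.
  by move: (size u) (size v) su sv => a b; lia.
apply/separable_polyP; split=> [u v uv|u _ su].
  rewrite /coprimep; apply/eqP/anti_leq; rewrite sqf /=; last first.
    by apply: dvdp_trans uv; apply: dvdp_mul; rewrite (dvdp_gcdl, dvdp_gcdr).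
  rewrite lt0n size_poly_eq0 gcdp_eq0; apply/negP => /andP[/eqP u0 _].
  by move: uv; rewrite u0 mul0r dvd0p (negPf p0).
(* In characteristic 0 the leading term of a nonconstant [u] survives derivation. *)
apply/eqP => /(congr1 (fun q : {poly F} => q`_((size u).-2))).
rewrite coef_deriv coef0; apply/eqP; rewrite mulrn_eq0 /= prednK; last by case: (size u) su => [|[]].
by rewrite -lead_coefE lead_coef_eq0 -size_poly_eq0; case: (size u) su.
Qed.

(** The cofactor of ['X] in [m] is prime to ['X], and [r] is the Bezout coefficient of ['X]. On a
    matrix killed by [m], the polynomial [1 - r * 'X] is the projection onto the kernel along the
    image; this is how [r] is used. *)
Lemma separable_idempotent m :
  separable_poly m -> root m 0 -> exists r, m %| 'X - 'X ^+ 2 * r.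
Proof.
move=> sm /factor_theorem[q mE].
have /separable_polyP[/(_ q 'X) + _] := sm; rewrite {1}mE subr0 => /(_ (dvdpp _)).
rewrite coprimep_sym => /Bezout_eq1_coprimepP[[u v] /= uv].
exists u; apply/dvdpP; exists v; rewrite mE subr0.
by rewrite -[X in X - _]mulr1 -uv; ring.
Qed.

Lemma hensel_separable m k : separable_poly m ->
  exists p t s, m \Po p = m ^+ (2 ^ k) * t /\ 'X - p = m * s.
Proof.
rewrite unlock => /Bezout_eq1_coprimepP[[u v] /= uv].
elim: k => [|k [p [t [s [mp ps]]]]].
  by exists 'X, 1, 0; rewrite comp_polyXr; split; ring.
have [w] := comp_poly_taylor2 m p (- (m \Po p) * (v \Po p)).
exists (p + - (m \Po p) * (v \Po p)).
exists (t ^+ 2 * ((u \Po p) + (v \Po p) ^+ 2 * w)).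
exists (s + m ^+ (2 ^ k).-1 * t * (v \Po p)); split; last first.
  rewrite opprD addrA ps mp mulrDr; congr (_ + _).
  by rewrite -[in LHS](prednK (expn_gt0 2 k)) exprS; ring.
rewrite p0 expnS mulnC exprM mulrA -exprMn -mp.
have -> : (m^`() \Po p) * (- (m \Po p) * (v \Po p)) =
          - (m \Po p) * (((v * m^`()) \Po p)) by rewrite comp_polyM; ring.
have -> : v * m^`() = 1 - u * m by rewrite -uv; ring.
rewrite comp_polyB comp_polyM comp_polyC; ring.
Qed.

Lemma hmx_eigen n p (X : 'M[F]_n) (v : 'rV_n) a :
  v *m X = a *: v -> v *m hmx p X = p.[a] *: v.
Proof.
move=> vX; elim/poly_ind: p => [|p c IHp].
  by rewrite hmx0 mulmx0 horner0 scale0r.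
rewrite hmxD hmxM hmxX hmxC mulmxDr mulmxA IHp -scalemxAl vX scalerA.
by rewrite mul_mx_scalar -scalerDl hornerMXaddC.
Qed.

Lemma eigen_exp n (X : 'M[F]_n) (v : 'rV_n) a k :
  v *m X = a *: v -> v *m X ^+ k = a ^+ k *: v.
Proof.
move=> vX; elim: k => [|k IHk]; first by rewrite !expr0 mulmx1 scale1r.
by rewrite !exprSr -mulmxE mulmxA IHk -scalemxAl vX scalerA.
Qed.

Lemma eigen_nilp n (X : 'M[F]_n) (v : 'rV_n) a k :
  v != 0 -> v *m X = a *: v -> X ^+ k = 0 -> a = 0.
Proof.
move=> v0 /(eigen_exp k) /[swap] ->; rewrite mulmx0 => /esym/eqP.
by rewrite scaler_eq0 (negPf v0) orbF expf_eq0 => /andP[_ /eqP].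
Qed.

(** The semisimple part is a Newton approximation evaluated at [X]; [k] iterations are enough
    because [k < 2 ^ k]. The vector [v] forces [root m 0]: the nilpotent [m(X)] acts on it by the
    scalar [m(0)]. *)
Lemma jordan_chevalley n (X : 'M[F]_n) : (exists2 v : 'rV_n, v != 0 & v *m X = 0) ->
  exists m p, [/\ separable_poly m, root m 0,
    exists k, hmx m X ^+ k = 0, hmx m (hmx p X) = 0
    & exists k, (X - hmx p X) ^+ k = 0].
Proof.
move=> [v v0 vX]; have [m [k [sm mX]]] := separable_of_nilpotent X.
have r0 : root m 0.
  apply/eqP/(@eigen_nilp _ (hmx m X) v _ k) => //.
  by apply: hmx_eigen; rewrite vX scale0r.
have [p [t [s [mp ps]]]] := hensel_separable k sm; exists m, p; split=> //.
- by exists k.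
- rewrite -hmx_comp mp hmxM hmxXn -(subnK (ltnW (ltn_expl k (ltnSn 1)))).
  by rewrite exprD mX mulr0 mul0mx.
- exists k; rewrite -[X in X - _]hmxX -hmxN -hmxD ps mulrC -hmxXn exprMn hmxM.
  by rewrite (hmxXn m) mX mulmx0.
Qed.

Lemma diagonalizable_separable (C : closedFieldType) n (X : 'M[C]_n) (m : {poly C}) :
  separable_poly m -> hmx m X = 0 -> diagonalizable X.
Proof.
case: n X => [|n] X sm mX; first by rewrite [X]flatmx0; exact: diagonalizable0.
apply/diagonalizableP; have [r mE] := closed_field_poly_normal m.
have m0 : lead_coef m != 0 by rewrite lead_coef_eq0 separable_poly_neq0.
exists r.
  rewrite -separable_prod_XsubC; move: sm; rewrite mE.
  by rewrite !unlock derivZ coprimepZl// coprimepZr.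
by rewrite -(dvdpZr _ _ m0) -mE dvd_mxminpoly -hmxE mX.
Qed.

Lemma diagonalizable_nilp (K : fieldType) n (X : 'M[K]_n) (m : {poly K}) k :
  diagonalizable X -> hmx m X ^+ k = 0 -> hmx m X = 0.
Proof.
move=> [Q Qu /similar_diagPex[d /(similarP Qu) QX]] mX.
have QmX : Q *m hmx m X = hmx m (diag_mx d) *m Q by exact: hmx_inter.
have : hmx m (diag_mx d) ^+ k = 0.
  have : Q *m hmx m X ^+ k = hmx m (diag_mx d) ^+ k *m Q.
    elim: k {mX} => [|k IHk]; first by rewrite !expr0 mulmx1 mul1mx.
    by rewrite !exprSr -mulmxE mulmxA IHk -!mulmxA QmX.
  by rewrite mX mulmx0 => /esym/(congr1 (mulmx^~ (invmx Q))); rewrite mulmxK// mul0mx.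
rewrite hmx_diag; move eE : (map_mx _ _) => e ek.
suff e0 : e = 0 by move: QmX; rewrite hmx_diag eE e0 linear0 mul0mx -[X in _ = X](mulmx0 _ Q) => /(can_inj (mulKmx Qu)).
apply/rowP => i; rewrite [RHS]mxE; apply/eqP.
have : delta_mx 0 i *m diag_mx e ^+ k = e 0 i ^+ k *: delta_mx (0 : 'I_1) i.
  elim: k {mX ek} => [|k IHk]; first by rewrite !expr0 mulmx1 scale1r.
  rewrite !exprSr -mulmxE mulmxA IHk -scalemxAl -scalerA; congr (_ *: _).
  by apply/rowP => j; rewrite -rowE row_diag_mx.
rewrite ek mulmx0 => /esym/rowP/(_ i); rewrite !mxE !eqxx mulr1 => /eqP.
by rewrite expf_eq0 => /andP[].
Qed.

End Separable.

HB.instance Definition _ (F : fieldType) (g : lieAlgebra F) (x : g) :=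
  GRing.isLinear.Build F g g *:%R (@lie F g x) (fun a u v => lie_linearr a u v x).

(** * Engel's theorem *)

Section LieBasics.
Variables (F : fieldType) (g : lieAlgebra F).
Implicit Types (x y z : g) (U V W H L I : {vspace g}).

Lemma lieDl x y z : lie (x + y) z = lie x z + lie y z.
Proof. by have := lie_linearl 1 x y z; rewrite !scale1r. Qed.

Lemma lie0l z : lie 0 z = 0.
Proof. by apply: (addrI (lie 0 z)); rewrite -lieDl !addr0. Qed.

Lemma lieZl a x z : lie (a *: x) z = a *: lie x z.
Proof. by have := lie_linearl a x 0 z; rewrite lie0l !addr0. Qed.

Lemma lieC x y : lie x y = - lie y x.
Proof.
by have := liexx (x + y); rewrite lieDl !linearD /= !liexx add0r addr0 => /eqP; rewrite addr_eq0 => /eqP.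
Qed.

Lemma lie_suml (J : Type) (r : seq J) (P : pred J) (v : J -> g) z :
  lie (\sum_(i <- r | P i) v i) z = \sum_(i <- r | P i) lie (v i) z.
Proof. by rewrite (big_morph (fun x => lie x z) (fun x y => lieDl x y z) (lie0l z)). Qed.

Lemma lie_adE x y : lie_ad x y = lie x y.
Proof. by rewrite lfunE. Qed.

Lemma lie_der x y z : lie x (lie y z) = lie (lie x y) z + lie y (lie x z).
Proof.
have /eqP := lie_jacobi x y z; rewrite -addrA addr_eq0 => /eqP ->.
by rewrite (lieC z x) linearN /= (lieC z (lie x y)) -opprD opprK addrC.
Qed.

Definition lie_stable H W : Prop :=
  forall h w, h \in H -> w \in W -> lie h w \in W.

Definition ad_nilpotent x : Prop := exists k, forall y, iter k (lie x) y = 0.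

Let engel_prop H : Prop := forall W' W, (W' <= W)%VS -> ~~ (W <= W')%VS ->
  lie_stable H W' -> lie_stable H W ->
  exists v, [/\ v \in W, v \notin W' & forall h, h \in H -> lie h v \in W'].

(** Induction on subalgebras [H] of [L]. All pairs [W' < W] of stable subspaces are considered
    because the pair [H < L] itself provides a [y] outside [H] with [[H, y]] in [H], hence the
    larger subalgebra [H + <[y]>]. For the latter, the vectors of [W] that [H] sends into [W'] are
    stable under the nilpotent [y], and the last iterate outside [W'] is the vector sought. *)
Lemma engel L : lie_stable L L -> (forall x, x \in L -> ad_nilpotent x) ->
  engel_prop L.
Proof.
move=> LL nilL.
suff [H [HL HH EH sLH]] : exists H, [/\ (H <= L)%VS, lie_stable H H, engel_prop H & (\dim L <= \dim H)%N].
  by have /eqP -> : L == H by rewrite eq_sym eqEdim HL.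
have [d dL] : exists d, d = \dim L by exists (\dim L).
have -> : \dim L = minn d (\dim L) by rewrite -dL minnn.
elim: d {dL} => [|d [H [HL HH EH dH]]].
  exists 0%VS; split=> [|h w||]; rewrite ?sub0v ?min0n//.
  - by rewrite !memv0 => /eqP-> /eqP->; rewrite linear0.
  - move=> W' W _ /subvPn[v vW vW'] _ _; exists v; split=> // h.
    by rewrite memv0 => /eqP->; rewrite lie0l mem0v.
have [LH|LH] := boolP (L <= H)%VS.
  by exists H; split=> //; rewrite geq_min dimvS ?orbT.
have HsL : lie_stable H L by move=> h w /(subvP HL); exact: LL.
have [y [yL yH Hy]] := EH _ _ HL LH HH HsL.
have Hy1 h : h \in (H + <[y]>)%VS -> exists2 h', h' \in H & exists a, h = h' + a *: y.
  by case/memv_addP => h' h'H [w /vlineP[a ->] ->]; exists h' => //; exists a.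
exists (H + <[y]>)%VS; split.
- by rewrite subv_add HL -memvE.
- move=> h w /Hy1[h' h'H [a ->]] /Hy1[w' w'H [b ->]]; apply/(subvP (addvSl _ _)).
  have -> : lie (h' + a *: y) (w' + b *: y) = lie h' w' + b *: lie h' y + a *: lie y w'.
    by rewrite lieDl !lieZl !linearD /= !linearZ /= liexx !scaler0 addr0.
  have yw : lie y w' \in H by rewrite lieC memvN Hy.
  by apply: memvD; [apply: memvD; [exact: HH|apply: memvZ; exact: Hy]|exact: memvZ].
- move=> W' W W'W WW' sW' sW.
  have sub : (H <= H + <[y]>)%VS by exact: addvSl.
  have yHy : y \in (H + <[y]>)%VS by apply: (subvP (addvSr _ _)); exact: memv_line.
  have [v [vW vW' vH]] := EH W' W W'W WW' (fun h w hH => sW' h w (subvP sub h hH)) (fun h w hH => sW h w (subvP sub h hH)).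
  have iterP k : iter k (lie y) v \in W /\ forall h, h \in H -> lie h (iter k (lie y) v) \in W'.
    elim: k => [//|k [kW kH]]; split=> [|h hH] /=; first exact: sW.
    by rewrite lie_der; apply: memvD; [apply: kH; exact: Hy|apply: sW' => //; exact: kH].
  have [k0 yk0] := nilL y yL.
  have exk : exists k, iter k (lie y) v \in W' by exists k0; rewrite yk0 mem0v.
  case: (ex_minnP exk) => [[|k] kW' mink]; first by rewrite (negPf vW') in kW'.
  have [ikW ikH] := iterP k; exists (iter k (lie y) v); split=> //.
    by apply/negP => /mink; rewrite ltnn.
  move=> h /Hy1[h' h'H [a ->]]; rewrite lieDl lieZl; apply: memvD; [exact: ikH|exact: memvZ].
- have : (\dim H < \dim (H + <[y]>))%N.
    rewrite ltnNge; apply/negP => le; have /eqP eqH : (H == H + <[y]>)%VS.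
      by rewrite eqEdim addvSl.
    by move: yH; rewrite eqH (subvP (addvSr _ _)) ?memv_line.
  by move: dH; rewrite !geq_min => /orP[dH /(leq_ltn_trans dH) ->//|dH /ltnW/(leq_trans dH) ->]; rewrite orbT.
Qed.

(** A proper stable subspace [W] of largest dimension works: Engel's theorem for [W < L] gives [v]
    with [[L, v]] in [W]; then [W + <[v]>] is stable, hence equal to [L]. This is used to contradict
    [[L, L] = L]. *)
Lemma engel_derived L : lie_stable L L -> (forall x, x \in L -> ad_nilpotent x) ->
  L != 0%VS -> exists W, [/\ (W <= L)%VS, W != L & forall x y, x \in L -> y \in L -> lie x y \in W].
Proof.
move=> LL nilL L0.
pose P d := exists W, [/\ (W <= L)%VS, W != L, lie_stable L W & \dim W = d].
have [d [W [WL WnL sW dW]] max_d] : exists2 d, P d & forall d', P d' -> (d' <= d)%N.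
  have exP : exists d, `[< P d >].
    exists 0%N; apply/asboolP; exists 0%VS; rewrite sub0v eq_sym dimv0; split=> // h w _.
    by rewrite memv0 => /eqP->; rewrite linear0 mem0v.
  have bP d : `[< P d >] -> (d <= \dim L)%N.
    by move=> /asboolP[W [/dimvS WL _ _ <-]].
  exists (ex_maxn exP bP); case: ex_maxnP => d /asboolP// _ max_d d' Pd'.
  by apply: max_d; apply/asboolP.
exists W; split=> //.
have nLW : ~~ (L <= W)%VS by apply: contra WnL => LW; rewrite eqEsubv WL.
have [v [vL vW Lv]] := engel LL nilL WL nLW sW LL.
have subWv : (W <= W + <[v]>)%VS by exact: addvSl.
have inWv h : h \in (W + <[v]>)%VS -> exists2 w, w \in W & exists a, h = w + a *: v.
  by case/memv_addP => w wW [u /vlineP[a ->] ->]; exists w => //; exists a.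
have eqL : (W + <[v]>)%VS = L.
  apply/eqP/negPn/negP => neqL; have : P (\dim (W + <[v]>)).
    exists (W + <[v]>)%VS; split=> //; first by rewrite subv_add WL -memvE.
    move=> h w hL /inWv[w' w'W [a ->]]; apply: (subvP subWv).
    by rewrite linearD linearZ /=; apply: memvD; [exact: sW|apply: memvZ; exact: Lv].
  move=> /max_d; rewrite -dW leqNgt => /negP; apply; rewrite ltnNge.
  apply/negP => le; move/negP: vW; apply; have /eqP -> : (W == W + <[v]>)%VS by rewrite eqEdim subWv.
  by apply: (subvP (addvSr _ _)); exact: memv_line.
move=> x y xL; rewrite -{1}eqL => /inWv[w wW [a ->]].
by rewrite linearD linearZ /=; apply: memvD; [exact: sW|apply: memvZ; exact: Lv].
Qed.

Lemma lie_comm_sub U V W :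
  (forall x y, x \in U -> y \in V -> lie x y \in W) -> (lie_comm U V <= W)%VS.
Proof.
move=> UVW; apply/span_subvP => _ /allpairsP[[x y] /= [xU yV ->]].
by apply: UVW; apply: vbasis_mem.
Qed.

Lemma mem_lie_comm U V x y : x \in U -> y \in V -> lie x y \in lie_comm U V.
Proof.
move=> xU yV; rewrite (coord_vbasis xU) (coord_vbasis yV).
rewrite lie_suml memv_suml// => i _; rewrite lieZl memvZ// linear_sum memv_suml// => j _.
rewrite linearZ memvZ//; apply: memv_span; apply/allpairsP.
by exists ((vbasis U)`_i, (vbasis V)`_j); split=> //=; apply: mem_nth; rewrite size_tuple.
Qed.

Lemma lie_comm_mem U V x : x \in lie_comm U V -> forall W : {vspace g},
  (forall x y, x \in U -> y \in V -> lie x y \in W) -> x \in W.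
Proof. by move=> xUV W /lie_comm_sub/subvP/(_ x xUV). Qed.

Lemma lie_ideal_comm I : lie_ideal I -> lie_ideal (lie_comm I I).
Proof.
move=> II x y /lie_comm_mem yI; rewrite -lie_adE memv_preim; apply: yI => a b aI bI.
rewrite -memv_preim lie_adE lie_der; apply: memvD; apply: mem_lie_comm => //; exact: II.
Qed.

(* If the derived series of [I] does not reach [0], it stabilizes on a perfect ideal. *)
Lemma solvable_or_perfect I : lie_ideal I ->
  lie_solvable I \/ exists L, [/\ lie_ideal L, L != 0%VS, (L <= I)%VS & lie_comm L L = L].
Proof.
move=> II; have [solI|nsolI] := pselect (lie_solvable I); [by left|right].
pose D k := iter k (fun U => lie_comm U U) I.
have idD k : lie_ideal (D k) by elim: k => [//|k IHk]; exact: lie_ideal_comm.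
have decD k : (D k.+1 <= D k)%VS by apply: lie_comm_sub => x y _; exact: idD.
have subD k : (D k <= I)%VS by elim: k => [//|k /(subv_trans (decD k))].
have [stab|nstab] := pselect (exists k, D k.+1 = D k).
  case: stab => k Dk; exists (D k); split=> //; apply/eqP => D0; apply: nsolI; by exists k.
suff dimD k : (k + \dim (D k) <= \dim I)%N.
  by have := dimD (\dim I).+1; rewrite addSn ltnNge leq_addr.
elim: k => [//|k]; apply: leq_trans; rewrite addSnnS leq_add2l ltnNge.
apply/negP => le; apply: nstab; exists k; apply/eqP; by rewrite eqEdim decD.
Qed.

End LieBasics.

(** * The adjoint representation and the Killing form *)

Section Coordinates.
Variables (F : fieldType) (g : lieAlgebra F).
Implicit Types (x y z : g).
Local Notation e := (vbasis {:g}).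
Local Notation N := (\dim {:g}).

Lemma ad_mxD x y : ad_mx (x + y) = ad_mx x + ad_mx y.
Proof.
rewrite /ad_mx -linearD /=; congr mxof; apply/lfunP => z.
by rewrite add_lfunE !lie_adE lieDl.
Qed.

Lemma ad_mxZ a x : ad_mx (a *: x) = a *: ad_mx x.
Proof.
rewrite /ad_mx -linearZ /=; congr mxof; apply/lfunP => z.
by rewrite scale_lfunE !lie_adE lieZl.
Qed.

Lemma ad_mxE x y : rVof e (lie x y) = rVof e y *m ad_mx x.
Proof. by rewrite /ad_mx -rVof_app ?vbasisP// lie_adE. Qed.

Lemma ad_mx_sum (J : Type) (r : seq J) (P : pred J) (v : J -> g) :
  ad_mx (\sum_(i <- r | P i) v i) = \sum_(i <- r | P i) ad_mx (v i).
Proof.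
apply: (big_morph (@ad_mx F g) ad_mxD).
by rewrite -(scale0r 0) ad_mxZ scale0r.
Qed.

(** Matrices act on row vectors from the right, which reverses products of operators; hence the
    sign. *)
Lemma ad_mx_lie x y : ad_mx (lie x y) = ad_mx y *m ad_mx x - ad_mx x *m ad_mx y.
Proof.
apply/row_matrixP => i; rewrite [LHS]rowE [RHS]rowE -(rVofE (vbasisP _)).
rewrite mulmxBr !mulmxA -!ad_mxE -linearB /=; congr rVof.
by rewrite lie_der addrK.
Qed.

Definition killing_mx : 'M[F]_N := \matrix_(i, j) killing e`_i e`_j.

Lemma killingC x y : killing x y = killing y x.
Proof. by rewrite /killing mxtrace_mulC. Qed.

Lemma killingDl x y z : killing (x + y) z = killing x z + killing y z.
Proof. by rewrite /killing ad_mxD mulmxDl mxtraceD. Qed.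

Lemma killingZl a x z : killing (a *: x) z = a * killing x z.
Proof. by rewrite /killing ad_mxZ -scalemxAl mxtraceZ. Qed.

Lemma killing_suml (J : Type) (r : seq J) (P : pred J) (v : J -> g) z :
  killing (\sum_(i <- r | P i) v i) z = \sum_(i <- r | P i) killing (v i) z.
Proof. by rewrite /killing ad_mx_sum mulmx_suml raddf_sum. Qed.

Lemma killingE x y : killing x y = (rVof e x *m killing_mx *m (rVof e y)^T) 0 0.
Proof.
rewrite [in LHS](coord_vbasis (memvf x)) killing_suml.
rewrite -mulmxA !mxE; apply: eq_bigr => i _; rewrite killingZl !mxE; congr (_ * _).
rewrite [in LHS](coord_vbasis (memvf y)) killingC killing_suml.
by apply: eq_bigr => j _; rewrite killingZl killingC !mxE mulrC.
Qed.

Lemma killing_invar x y z : killing (lie x y) z = killing x (lie y z).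
Proof.
rewrite /killing !ad_mx_lie mulmxBl mulmxBr !raddfB /=; congr (_ - _).
  by rewrite -mulmxA mxtrace_mulC mulmxA.
by rewrite mulmxA.
Qed.

Lemma killing_mx_ad x : ad_mx x *m killing_mx = - (killing_mx *m (ad_mx x)^T).
Proof.
have entry (M : 'M[F]_N) i j : M i j = ((delta_mx 0 i : 'rV_N) *m M *m (delta_mx 0 j : 'rV_N)^T) 0 0.
  by rewrite trmx_delta -colE -rowE !mxE.
apply/matrixP => i j; rewrite entry [RHS]mxE [in RHS]entry.
rewrite -!(rVofE (vbasisP _)) mulmxA -ad_mxE -killingE.
rewrite -!mulmxA -trmx_mul -ad_mxE mulmxA -killingE.
by rewrite lieC -scaleN1r killingZl mulN1r killing_invar.
Qed.

Section ScalarExtension.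
Variables (A : comNzRingType) (f : {rmorphism F -> A}).
Implicit Types (u v w : 'rV[A]_N).

(* The adjoint representation of [A (x) g], in coordinates. *)
Definition adA v : 'M[A]_N := \sum_i v 0 i *: map_mx f (ad_mx e`_i).

Lemma adA_is_linear : linear adA.
Proof.
move=> a u v; rewrite /adA scaler_sumr -big_split; apply: eq_bigr => i _ /=.
by rewrite !mxE scalerDl scalerA.
Qed.
HB.instance Definition _ := GRing.isLinear.Build A _ _ *:%R adA adA_is_linear.

Lemma adA_map x : adA (map_mx f (rVof e x)) = map_mx f (ad_mx x).
Proof.
rewrite [in RHS](coord_vbasis (memvf x)) ad_mx_sum raddf_sum /=.
by apply: eq_bigr => i _; rewrite ad_mxZ map_mxZ /= !mxE.
Qed.

Lemma delta_map k : delta_mx 0 k = map_mx f (rVof e e`_k) :> 'rV_N.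
Proof. by rewrite rVofE ?vbasisP//; apply/rowP => l; rewrite !mxE rmorph_nat. Qed.

Lemma adA_delta i : adA (delta_mx 0 i) = map_mx f (ad_mx e`_i).
Proof. by rewrite delta_map adA_map. Qed.

Lemma row_bilinear_ext (V : lmodType A) (b : 'rV[A]_N -> 'rV[A]_N -> V) :
  (forall u, linear (b u)) -> (forall u, linear (b^~ u)) ->
  (forall i j, b (delta_mx 0 i) (delta_mx 0 j) = 0) -> forall u v, b u v = 0.
Proof.
move=> blin brin b0 u v.
have b0r w : b w 0 = 0 by have := blin w (-1) 0 0; rewrite !scaleN1r oppr0 addr0 addNr.
have b0l w : b 0 w = 0 by have := brin w (-1) 0 0; rewrite !scaleN1r oppr0 addr0 addNr.
rewrite [u]row_sum_delta [v]row_sum_delta.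
elim/big_ind: _ => [|u1 u2 IH1 IH2|i _]; first exact: b0l.
  by have := brin (\sum_j v 0 j *: delta_mx 0 j) 1 u1 u2; rewrite !scale1r IH1 IH2 addr0.
elim/big_ind: _ => [|u1 u2 IH1 IH2|j _]; first exact: b0r.
  by have := blin (u 0 i *: delta_mx 0 i) 1 u1 u2; rewrite !scale1r IH1 IH2 addr0.
have := brin (v 0 j *: delta_mx 0 j) (u 0 i) (delta_mx 0 i) 0.
rewrite b0l !addr0 => ->.
have := blin (delta_mx 0 i) (v 0 j) (delta_mx 0 j) 0.
by rewrite b0r !addr0 => ->; rewrite b0 !scaler0.
Qed.

Lemma adA_comm u v : adA (u *m adA v) = adA u *m adA v - adA v *m adA u.
Proof.
apply/eqP; rewrite -subr_eq0; apply/eqP.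
apply: (row_bilinear_ext (b := fun u v => adA (u *m adA v) - (adA u *m adA v - adA v *m adA u))) => {u v}
  [u a v w|u a v w|i j].
- by rewrite !linearP /= mulmxDl -scalemxAl !linearP /=; apply/matrixP => i j; rewrite !mxE; ring.
- by rewrite mulmxDl -scalemxAl !linearP /= mulmxDl -scalemxAl; apply/matrixP => i j; rewrite !mxE; ring.
- rewrite !delta_map !adA_map -map_mxM -ad_mxE adA_map ad_mx_lie.
  by rewrite -!map_mxM -map_mxB subrr.
Qed.

(** [u *m adA v] is the bracket of [v] and [u], so this is the Leibniz rule. *)
Definition derivation_mx (D : 'M[A]_N) : Prop :=
  forall u v, u *m adA v *m D = u *m D *m adA v + u *m adA (v *m D).

Lemma derivation_mx_adA w : derivation_mx (adA w).
Proof.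
move=> u v; by rewrite adA_comm mulmxBr !mulmxA addrC subrK.
Qed.

Lemma derivation_mxP D : derivation_mx D ->
  forall v, adA v *m D = D *m adA v + adA (v *m D).
Proof.
move=> dD v; apply/row_matrixP => i.
by rewrite !rowE mulmxDr !mulmxA dD.
Qed.
End ScalarExtension.

Lemma adA_eq (A : comNzRingType) (f f' : {rmorphism F -> A}) (v : 'rV[A]_N) :
  f =1 f' -> adA f v = adA f' v :> 'M[A]_N.
Proof.
move=> ff'; apply: eq_bigr => i _; congr (_ *: _).
by apply/matrixP => k l; rewrite !mxE ff'.
Qed.

Lemma adA_idfun x : adA idfun (rVof e x) = ad_mx x.
Proof. by have := adA_map idfun x; rewrite !(map_mx_id (f := idfun)). Qed.

Lemma map_adA (A B : comNzRingType) (f : {rmorphism F -> A}) (h : {rmorphism A -> B}) v :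
  map_mx h (adA f v) = adA (h \o f) (map_mx h v).
Proof.
rewrite /adA raddf_sum /=; apply: eq_bigr => i _.
by rewrite map_mxZ !mxE -map_mx_comp.
Qed.

Lemma derivation_eigenP (A : fieldType) (f : {rmorphism F -> A}) (Q D : 'M[A]_N) :
  Q \in unitmx ->
  (forall i j, let u := row i Q in let v := row j Q in
     u *m adA f v *m D = u *m D *m adA f v + u *m adA f (v *m D)) ->
  derivation_mx f D.
Proof.
move=> Qu QD u v; apply/eqP; rewrite -subr_eq0; apply/eqP.
rewrite -[u](mulmxKV Qu) -[v](mulmxKV Qu).
move: (u *m invmx Q) (v *m invmx Q) => {}u {}v.
apply: (row_bilinear_ext (b := fun u v => u *m Q *m adA f (v *m Q) *m D -
  (u *m Q *m D *m adA f (v *m Q) + u *m Q *m adA f (v *m Q *m D)))) => {u v}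
  [u a v w|u a v w|i j].
- rewrite !mulmxDl -!scalemxAl !linearP /= !mulmxDl -!scalemxAl.
  by apply/matrixP => i j; rewrite !mxE; ring.
- rewrite !mulmxDl -!scalemxAl.
  by apply/matrixP => i j; rewrite !mxE; ring.
- by rewrite -!rowE QD subrr.
Qed.

End Coordinates.

(** * Derivations defined by functions of eigenvalues *)

Section SemisimplePart.
Variables (F : fieldType) (g : lieAlgebra F) (A : fieldType) (f : {rmorphism F -> A}).
Local Notation N := (\dim {:g}).
Local Notation ad := (@adA F g A f).

(** On the bracket, [X - (a + b)] acts as the sum of [X - a] on [u] and of [X - b] on [v], and each
    application lowers one of the exponents [k] and [l]. *)
Lemma leibniz_nilp (X : 'M[A]_N) a b n k l (u v : 'rV[A]_N) :
  derivation_mx f X -> (k + l = n)%N ->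
  u *m (X - a%:M) ^+ k = 0 -> v *m (X - b%:M) ^+ l = 0 ->
  u *m ad v *m (X - (a + b)%:M) ^+ n = 0.
Proof.
move=> dX; elim: n k l u v => [|n IHn] [|k] [|l] u v //=.
- by rewrite expr0 mulmx1 => _ ->; rewrite !mul0mx.
- by rewrite expr0 mulmx1 => _ ->; rewrite !mul0mx.
- by rewrite expr0 mulmx1 => _ _ ->; rewrite linear0 mulmx0 mul0mx.
rewrite addSn => -[kl] u0 v0.
have -> : u *m ad v *m (X - (a + b)%:M) ^+ n.+1 =
   (u *m (X - a%:M)) *m ad v *m (X - (a + b)%:M) ^+ n +
   u *m ad (v *m (X - b%:M)) *m (X - (a + b)%:M) ^+ n.
  rewrite exprS -mulmxE mulmxA -mulmxDl; congr (_ *m _).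
  rewrite !mulmxBr dX !mul_mx_scalar mulmxBl -scalemxAl.
  have -> : ad (v *m X - b *: v) = ad (v *m X) - b *: ad v by rewrite linearB linearZ.
  by rewrite mulmxBr -scalemxAr scalerDl opprD addrACA.
rewrite (IHn k l.+1)//; last by rewrite -mulmxA mulmxE -exprS.
rewrite (IHn k.+1 l) ?addr0 ?addSnnS//.
by rewrite -mulmxA mulmxE -exprS.
Qed.

Lemma nilp_shift (X S : 'M[A]_N) a k (u : 'rV[A]_N) :
  X *m S = S *m X -> u *m S = a *: u -> (X - S) ^+ k = 0 -> u *m (X - a%:M) ^+ k = 0.
Proof.
move=> XS uS N0; suff -> : u *m (X - a%:M) ^+ k = u *m (X - S) ^+ k by rewrite N0 mulmx0.
elim: k {N0} => [//|k IHk]; rewrite exprSr exprS -!mulmxE mulmxA IHk.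
rewrite -mulmxA mxexp_comm; first rewrite !mulmxA; first congr (_ *m _).
  by rewrite !mulmxBr uS mul_mx_scalar.
rewrite !mulmxBl !mulmxBr XS -![_%:M *m _]scalar_mxC.
by rewrite !opprB addrACA [RHS]addrACA; congr (_ + _); rewrite addrC.
Qed.

(** [S - a] is the difference of [X - a], nilpotent on [w], and of the nilpotent [X - S]. These
    commute, so [S - a] is nilpotent on [w]; being diagonalizable, it kills [w]. The conclusion says
    this coordinate by coordinate in the eigenbasis. *)
Lemma eigen_of_nilp (X S Q : 'M[A]_N) (d : 'rV[A]_N) a k l (w : 'rV[A]_N) :
  Q \in unitmx -> Q *m S = diag_mx d *m Q -> X *m S = S *m X ->
  (X - S) ^+ k = 0 -> w *m (X - a%:M) ^+ l = 0 -> forall i, (w *m invmx Q) 0 i * (d 0 i - a) = 0.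
Proof.
move=> Qu QS XS N0 wX i.
have wS : w *m (S - a%:M) ^+ (l + k) = 0.
  have -> : S - a%:M = (X - a%:M) - (X - S) by apply/matrixP => r s; rewrite !mxE; ring.
  rewrite exprDn_comm; last first.
    apply: commrN; rewrite /GRing.comm -!mulmxE !mulmxBl !mulmxBr XS -![_%:M *m _]scalar_mxC.
    by apply/matrixP => r s; move: (X *m X) (S *m X) (X *m _) (S *m _) => ? ? ? ?; rewrite !mxE; ring.
  rewrite mulmx_sumr big1// => j _; rewrite raddfMn /=.
  have [kj|jk] := leqP k j.
    by rewrite exprNn -(subnK kj) [(X - S) ^+ _]exprD N0 !mulr0 mulmx0 mul0rn.
  have -> : (l + k - j = l + (k - j))%N by rewrite addnBA// ltnW.
  by rewrite exprD -mulrA -mulmxE mulmxA wX mul0mx mul0rn.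
have QiS : S *m invmx Q = invmx Q *m diag_mx d.
  by rewrite -[S in LHS](mulKmx Qu) QS -mulmxA mulmxK.
have : w *m (S - a%:M) ^+ (l + k) *m invmx Q = 0 by rewrite wS mul0mx.
have exp m : (S - a%:M) ^+ m *m invmx Q = invmx Q *m (diag_mx d - a%:M) ^+ m.
  elim: m => [|m IHm]; first by rewrite !expr0 mulmx1 mul1mx.
  rewrite !exprS -!mulmxE -mulmxA IHm !mulmxA; congr (_ *m _).
  by rewrite mulmxBl mulmxBr QiS scalar_mxC.
rewrite -mulmxA exp mulmxA => /rowP/(_ i); rewrite [RHS]mxE.
have -> : diag_mx d - a%:M = diag_mx (d - const_mx a) by rewrite linearB /= diag_const_mx.
have -> m (z : 'rV[A]_N) : (z *m diag_mx (d - const_mx a) ^+ m) 0 i = z 0 i * (d 0 i - a) ^+ m.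
  elim: m => [|m IHm]; first by rewrite !expr0 mulmx1 mulr1.
  rewrite !exprSr -mulmxE mulmxA mul_mx_diag mxE IHm !mxE mulrA//.
move=> /eqP; rewrite mulf_eq0 expf_eq0 => /orP[/eqP->|/andP[_ /eqP->]].
  by rewrite mul0r.
by rewrite mulr0.
Qed.

Lemma eigen_scale (Q : 'M[A]_N) (d : 'rV[A]_N) a (w : 'rV[A]_N) : Q \in unitmx ->
  (forall i, (w *m invmx Q) 0 i * (d 0 i - a) = 0) ->
  forall h : A -> A, w *m (invmx Q *m diag_mx (map_mx h d) *m Q) = h a *: w.
Proof.
move=> Qu wd h; rewrite !mulmxA -[in RHS](mulmxKV Qu w) scalemxAl; congr (_ *m _).
apply/rowP => i; rewrite mul_mx_diag !mxE; have := wd i.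
move/eqP; rewrite mulf_eq0 subr_eq0 => /orP[/eqP w0|/eqP->]; last by rewrite mulrC.
by move: w0; rewrite !mxE => ->; rewrite mul0r mulr0.
Qed.

(** A matrix that commutes with [S] preserves its eigenspaces, hence commutes with any function of
    its eigenvalues. *)
Lemma comm_additive_eigen (X S Q : 'M[A]_N) (d : 'rV[A]_N) (h : A -> A) :
  Q \in unitmx -> Q *m S = diag_mx d *m Q -> X *m S = S *m X ->
  X *m (invmx Q *m diag_mx (map_mx h d) *m Q) = invmx Q *m diag_mx (map_mx h d) *m Q *m X.
Proof.
move=> Qu QS XS.
have [Y QX] : exists Y, Q *m X = Y *m Q by exists (Q *m X *m invmx Q); rewrite mulmxKV.
have Yd : Y *m diag_mx d = diag_mx d *m Y.
  apply: (can_inj (mulmxK Qu)).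
  by rewrite -mulmxA -QS mulmxA -QX -mulmxA XS -[RHS]mulmxA -QX !mulmxA QS.
have Yh : Y *m diag_mx (map_mx h d) = diag_mx (map_mx h d) *m Y.
  apply/matrixP => i j; move/matrixP/(_ i j): Yd.
  rewrite !mul_mx_diag !mul_diag_mx !mxE [RHS]mulrC => /eqP.
  rewrite -subr_eq0 -mulrBr mulf_eq0 subr_eq0.
  by move=> /orP[/eqP->|/eqP->]; rewrite ?mul0r ?mulr0// mulrC.
rewrite -[in LHS](mulKmx Qu X) QX -!mulmxA QX; congr (_ *m _).
by rewrite (mulKVmx Qu) !mulmxA Yh.
Qed.

(* An additive function of the eigenvalues of the semisimple part of a
   derivation defines a derivation: it is additive along the grading of the
   algebra by generalized eigenspaces. *)
Lemma derivation_additive_eigen (X S Q : 'M[A]_N) (d : 'rV[A]_N) k (h : {additive A -> A}) :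
  derivation_mx f X -> Q \in unitmx -> Q *m S = diag_mx d *m Q -> X *m S = S *m X ->
  (X - S) ^+ k = 0 -> derivation_mx f (invmx Q *m diag_mx (map_mx h d) *m Q).
Proof.
move=> dX Qu QS XS N0; apply: (derivation_eigenP Qu) => i j /=.
set u := row i Q; set v := row j Q.
have eig i0 : row i0 Q *m S = d 0 i0 *: row i0 Q.
  by rewrite -row_mul QS row_mul row_diag_mx -scalemxAl -rowE.
have eigh i0 : row i0 Q *m (invmx Q *m diag_mx (map_mx h d) *m Q) = h (d 0 i0) *: row i0 Q.
  by rewrite !mulmxA rowE mulmxK// -rowE row_diag_mx -scalemxAl -rowE mxE.
rewrite !eigh -/u -/v linearZ -scalemxAl -scalemxAr -scalerDl -raddfD /=.
apply: (eigen_scale Qu); apply: (eigen_of_nilp Qu QS XS N0 (l := (k + k)%N)).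
by apply: (leibniz_nilp dX erefl); apply: (nilp_shift XS (eig _) N0).
Qed.

End SemisimplePart.

Section ComplexTrace.
Variables (R : rcfType).
Local Notation C := R[i].

Lemma mxtrace_nilp (n : nat) (X : 'M[C]_n) k : X ^+ k = 0 -> \tr X = 0.
Proof.
case: n X => [|n] X Xk; first by rewrite [X]flatmx0 linear0.
have [r rE] := closed_field_poly_normal (char_poly X).
have r0 : all (pred1 0) r.
  apply/allP => a ar /=; have : root (char_poly X) a.
    by rewrite rE rootZ ?root_prod_XsubC// lead_coef_eq0 monic_neq0 ?char_poly_monic.
  rewrite -eigenvalue_root_char => /eigenvalueP[v vX v0].
  by apply/eqP; exact: eigen_nilp v0 vX Xk.
have cX : char_poly X = 'X ^+ (size r).
  rewrite rE (monicP (char_poly_monic X)) scale1r (all_pred1P _ _ r0).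
  by rewrite big_nseq size_nseq subr0; elim: (size r) => //= m ->; rewrite exprS.
have := char_poly_trace X (ltn0Sn n); rewrite cX coefXn /=.
have := size_char_poly X; rewrite cX size_polyXn => -[->].
by rewrite (ltn_eqF (ltnSn n))//= => /esym/eqP; rewrite oppr_eq0 => /eqP.
Qed.
End ComplexTrace.

(** * Cartan's criterion and the Jordan decomposition *)

Section Cartan.
Variables (R : rcfType) (g : lieAlgebra R).
Local Notation C := R[i].
Local Notation c := (real_complex R).
Local Notation N := (\dim {:g}).
Local Notation e := (vbasis {:g}).
Implicit Types (x y z : g).

Lemma ReD (a b : C) : complex.Re (a + b) = complex.Re a + complex.Re b.
Proof. by case: a b => [? ?] [? ?]. Qed.

Lemma ReM_real (a : R) (b : C) : complex.Re (c a * b) = a * complex.Re b.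
Proof. by case: b => [? ?] /=; rewrite mul0r subr0. Qed.

Lemma Re_sum (J : Type) (r : seq J) (P : pred J) (v : J -> C) :
  complex.Re (\sum_(i <- r | P i) v i) = \sum_(i <- r | P i) complex.Re (v i).
Proof. exact: (big_morph _ ReD). Qed.

Lemma map_Re_mull m n p (M : 'M[R]_(m, n)) (D : 'M[C]_(n, p)) :
  map_mx (@complex.Re R) (map_mx c M *m D) = M *m map_mx (@complex.Re R) D.
Proof.
apply/matrixP => i j; rewrite !mxE Re_sum; apply: eq_bigr => k _.
by rewrite !mxE ReM_real.
Qed.

Lemma map_Re_mulr m n p (M : 'M[R]_(n, p)) (D : 'M[C]_(m, n)) :
  map_mx (@complex.Re R) (D *m map_mx c M) = map_mx (@complex.Re R) D *m M.
Proof.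
apply/matrixP => i j; rewrite !mxE Re_sum; apply: eq_bigr => k _.
by rewrite !mxE mulrC ReM_real mulrC.
Qed.

Lemma map_Re_adA (w : 'rV[C]_N) :
  map_mx (@complex.Re R) (adA c w) = adA idfun (map_mx (@complex.Re R) w) :> 'M[R]_N.
Proof.
apply/matrixP => i j; rewrite mxE /adA !summxE Re_sum; apply: eq_bigr => k _.
by rewrite !mxE mulrC ReM_real mulrC.
Qed.

Lemma adA_real (v : 'rV[R]_N) : adA c (map_mx c v) = map_mx c (adA idfun v).
Proof.
rewrite /adA raddf_sum /=; apply: eq_bigr => i _.
by rewrite map_mxZ mxE (map_mx_id (f := idfun)).
Qed.

(** Taking real parts commutes with products by real matrices. This brings derivations built from
    eigenvalues in [R[i]] back to the real algebra. *)
Lemma derivation_mx_Re (D : 'M[C]_N) :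
  derivation_mx c D -> derivation_mx idfun (map_mx (@complex.Re R) D).
Proof.
move=> dD u v.
have map_ReD m n (M M' : 'M[C]_(m, n)) : map_mx (@complex.Re R) (M + M') =
    map_mx (@complex.Re R) M + map_mx (@complex.Re R) M'.
  by apply/matrixP => i j; rewrite !mxE ReD.
have := congr1 (map_mx (@complex.Re R)) (dD (map_mx c u) (map_mx c v)).
rewrite map_ReD adA_real -map_mxM map_Re_mull map_Re_mulr map_Re_mull => ->.
by rewrite map_Re_mull map_Re_adA map_Re_mull.
Qed.

Lemma ad_jordan x : exists m p, [/\ separable_poly m, root m 0,
    hmx m (hmx p (ad_mx x)) = 0, exists k, hmx m (ad_mx x) ^+ k = 0
    & exists k, (ad_mx x - hmx p (ad_mx x)) ^+ k = 0].
Proof.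
have [->|x0] := eqVneq x 0.
  exists 'X, 0; rewrite hmx0 !hmxX subr0.
  have -> : ad_mx (0 : g) = 0 by rewrite -(scale0r 0) ad_mxZ scale0r.
  split=> //; first by rewrite unlock derivX coprimep1.
  - by rewrite /root hornerX.
  - by exists 1%N; rewrite expr1.
  - by exists 1%N; rewrite expr1.
have [|m [p [? ? ? ? ?]]] := @jordan_chevalley R _ (ad_mx x).
  exists (rVof e x); first by rewrite rVof_eq0 ?vbasisP.
  by rewrite -ad_mxE liexx linear0.
by exists m, p.
Qed.

Lemma complex_diagonalization (S : 'M[R]_N) m : separable_poly m -> hmx m S = 0 ->
  exists Q d, Q \in unitmx /\ Q *m map_mx c S = diag_mx d *m Q.
Proof.
move=> sm mS; have : diagonalizable (map_mx c S).
  apply: (@diagonalizable_separable _ _ _ (map_poly c m)).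
    by rewrite separable_map.
  by rewrite -map_hmx mS map_mx0.
by move=> [Q Qu /similar_diagPex[d /(similarP Qu) QS]]; exists Q, d.
Qed.

(** Over [R[i]], [S] is the derivation attached to the identity function of the eigenvalues, and it
    is its own real part. *)
Lemma semisimple_part_derivation x m p k : separable_poly m ->
  hmx m (hmx p (ad_mx x)) = 0 -> (ad_mx x - hmx p (ad_mx x)) ^+ k = 0 ->
  derivation_mx idfun (hmx p (ad_mx x)).
Proof.
set X := ad_mx x; set S := hmx p X => sm mS N0.
have [Q [d [Qu QS]]] := complex_diagonalization sm mS.
have -> : S = map_mx (@complex.Re R) (map_mx c S) by apply/matrixP => i j; rewrite !mxE.
apply: derivation_mx_Re.
have dX : derivation_mx c (map_mx c X) by rewrite -adA_map; exact: derivation_mx_adA.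
have XS : map_mx c X *m map_mx c S = map_mx c S *m map_mx c X.
  by rewrite -!map_mxM hmx_comm.
have NS : (map_mx c X - map_mx c S) ^+ k = 0.
  by rewrite -map_mxB -rmorphXn /= N0 map_mx0.
have := derivation_additive_eigen idfun dX Qu QS XS NS.
have -> : map_mx idfun d = d by apply/rowP => i; rewrite mxE.
by rewrite -mulmxA -QS mulKmx.
Qed.

(** Cartan's argument, with complex conjugation as the additive function of the eigenvalues [d_i] of
    the semisimple part [S]. The real part of the trace of [X *m D] is then the sum of the
    [|d_i|^2], and it vanishes because the real part of [D] is a derivation of [g]. So [S = 0] and
    [X] is nilpotent. *)
Lemma tr_derivation_nilpotent x :
  (forall D, derivation_mx idfun D -> \tr (ad_mx x *m D) = 0) -> ad_nilpotent x.
Proof.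
set X := ad_mx x => trX; have [m [p [sm _ mS _ [k N0]]]] := ad_jordan x.
set S := hmx p X in mS N0.
have [Q [d [Qu QS]]] := complex_diagonalization sm mS.
have dX : derivation_mx c (map_mx c X) by rewrite -adA_map; exact: derivation_mx_adA.
have XS : map_mx c X *m map_mx c S = map_mx c S *m map_mx c X.
  by rewrite -!map_mxM hmx_comm.
have NS : (map_mx c X - map_mx c S) ^+ k = 0.
  by rewrite -map_mxB -rmorphXn /= N0 map_mx0.
have dD := derivation_additive_eigen (@conjc R) dX Qu QS XS NS.
set D := invmx Q *m _ *m Q in dD.
have trM n (M : 'M[C]_n) : complex.Re (\tr M) = \tr (map_mx (@complex.Re R) M).
  by rewrite /mxtrace Re_sum; apply: eq_bigr => i _; rewrite mxE.
have := trX _ (derivation_mx_Re dD); rewrite -map_Re_mull -trM.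
have -> : map_mx c X = (map_mx c X - map_mx c S) + map_mx c S by rewrite subrK.
rewrite mulmxDl mxtraceD.
have SE : map_mx c S = invmx Q *m diag_mx d *m Q by rewrite -mulmxA -QS mulKmx.
have XD : map_mx c X *m D = D *m map_mx c X by exact: comm_additive_eigen Qu QS XS.
have SD : map_mx c S *m D = D *m map_mx c S by exact: comm_additive_eigen Qu QS erefl.
(* The nilpotent part commutes with [D], so it contributes nothing to the trace. *)
rewrite (@mxtrace_nilp _ _ ((map_mx c X - map_mx c S) *m D) k); last first.
  by apply: mul_nilp_comm NS; rewrite mulmxBl mulmxBr XD SD.
rewrite add0r SE /D !mulmxA mulmxK// -(mulmxA (invmx Q)) mulmx_diag mxtrace_mulC mulKVmx//.
rewrite mxtrace_diag => Re0.
have sum0 : \sum_i d 0 i * (d 0 i)^*%C = 0.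
  have ge0 : 0 <= \sum_i d 0 i * (d 0 i)^*%C by apply: sumr_ge0 => i _; exact: mulcJ_ge0.
  have := ger0_Im ge0; move: Re0; under eq_bigr do rewrite !mxE.
  by case: (\sum_i _) => ? ? /= -> ->.
have d0 : d = 0.
  apply/rowP => i; rewrite mxE.
  have /(_ i isT)/eqP : forall i, true -> d 0 i * (d 0 i)^*%C = 0.
    by apply: psumr_eq0P sum0 => j _; exact: mulcJ_ge0.
  by rewrite mulf_eq0 conjc_eq0 orbb => /eqP.
have S0 : S = 0.
  by apply: (map_mx_inj (f := c)); rewrite SE d0 linear0 mulmx0 mul0mx map_mx0.
exists k => y; apply/eqP; rewrite -(rVof_eq0 (vbasisP _)); apply/eqP.
have -> : rVof e (iter k (lie x) y) = rVof e y *m X ^+ k.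
  elim: {N0 NS} k => [|k IHk]; first by rewrite expr0 mulmx1.
  by rewrite iterS ad_mxE IHk exprSr -mulmxE mulmxA.
by move: N0; rewrite S0 subr0 => ->; rewrite mulmx0.
Qed.

(** Since [ad (D b)] is the commutator of [D] and [ad b], the trace of [ad [a, b]] times [D] is, up
    to sign, the Killing product of [a] and [D b]. *)
Lemma killing_perp_nilpotent x a b : (forall z, killing a z = 0) ->
  x = lie a b -> forall D, derivation_mx idfun D -> \tr (ad_mx x *m D) = 0.
Proof.
move=> a0 -> D dD; rewrite ad_mx_lie mulmxBl raddfB /=.
rewrite -mulmxA mxtrace_mulC -!mulmxA -raddfB /= -mulmxBr.
have := derivation_mxP dD (rVof e b).
have adid y : adA idfun (rVof e y) = ad_mx y by exact: adA_idfun.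
have -> : rVof e b *m D = rVof e (vecof e (rVof e b *m D)) by rewrite vecofK ?vbasisP.
rewrite !adid => ->; rewrite opprD addrA subrr add0r mulmxN raddfN /=.
by rewrite -/(killing a _) a0 oppr0.
Qed.

Definition killing_row x : 'rV[R]_N := rVof e x *m killing_mx g.

Lemma killing_row_is_linear : linear killing_row.
Proof. by move=> a x y; rewrite /killing_row linearP mulmxDl -scalemxAl. Qed.
HB.instance Definition _ :=
  GRing.isLinear.Build R g 'rV[R]_N *:%R killing_row killing_row_is_linear.

Lemma killing_rowP x : killing_row x = 0 <-> forall z, killing x z = 0.
Proof.
split=> [x0 z|x0]; first by rewrite killingE -/(killing_row x) x0 mul0mx mxE.
apply/rowP => j; rewrite [RHS]mxE -(x0 e`_j) killingE (rVofE (vbasisP _)).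
by rewrite trmx_delta -colE [RHS]mxE.
Qed.

Definition tr_ad (D : 'M[R]_N) x : R^o := \tr (ad_mx x *m D).

Lemma tr_ad_is_linear D : linear (tr_ad D).
Proof. by move=> a x y; rewrite /tr_ad ad_mxD ad_mxZ mulmxDl raddfD -scalemxAl /= mxtraceZ. Qed.
HB.instance Definition _ D := GRing.isLinear.Build R g R^o *:%R (tr_ad D) (tr_ad_is_linear D).

(** If the radical of the Killing form is not solvable, it contains a nonzero ideal [L = [L, L]].
    The trace condition of Cartan's argument holds for brackets and is linear, so it holds on [L],
    whose elements are therefore ad-nilpotent; by Engel's theorem [L] is not perfect. *)
Lemma killing_nondegenerate : lie_semisimple g -> killing_mx g \in unitmx.
Proof.
move=> ssg; pose I := lker (linfun killing_row).
have memI x : x \in I <-> forall z, killing x z = 0.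
  by rewrite memv_ker lfunE -killing_rowP; split=> /eqP.
have II : lie_ideal I.
  by move=> x y /memI y0; apply/memI => z; rewrite lieC -scaleN1r killingZl killing_invar y0 mulr0.
suff I0 : I = 0%VS.
  rewrite -row_free_unit -kermx_eq0; apply/rowV0P => v /sub_kermxP v0.
  have : vecof e v \in I by rewrite memv_ker lfunE /= /killing_row vecofK ?vbasisP// v0.
  by rewrite I0 memv0 vecof_eq0 ?vbasisP// => /eqP.
apply: ssg => //; have [//|[L [LI L0 LsI LL]]] := solvable_or_perfect II.
have stL : lie_stable L L by move=> x y _; exact: LI.
have nilL x : x \in L -> ad_nilpotent x.
  move=> xL; apply: tr_derivation_nilpotent => D dD; rewrite -LL in xL.
  suff : x \in lker (linfun (tr_ad D)) by rewrite memv_ker lfunE => /eqP.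
  apply: (lie_comm_mem xL) => a b aL bL; rewrite memv_ker lfunE /=; apply/eqP.
  by apply: (killing_perp_nilpotent _ erefl dD); exact/memI/(subvP LsI).
have [W [WL WneL LW]] := engel_derived stL nilL L0.
by move: WneL; rewrite eqEsubv WL -LL lie_comm_sub.
Qed.

End Cartan.

(** * The Jordan decomposition inside the Lie algebra *)

Section JordanPoint.
Variables (R : rcfType) (g : lieAlgebra R).
Local Notation C := R[i].
Local Notation c := (real_complex R).
Local Notation N := (\dim {:g}).
Local Notation e := (vbasis {:g}).
Implicit Types (x y z : g).
Hypothesis ndg : killing_mx g \in unitmx.

Lemma killing_eq0 x : (forall z, killing x z = 0) -> x = 0.
Proof.
move=> /killing_rowP x0; apply/eqP; rewrite -(rVof_eq0 (vbasisP _)).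
by rewrite -[rVof e x](mulmxK ndg) -/(killing_row x) x0 mul0mx.
Qed.

Lemma ad_mx_eq0 x : ad_mx x = 0 -> x = 0.
Proof. by move=> x0; apply: killing_eq0 => z; rewrite /killing x0 mul0mx linear0. Qed.

(** The Killing form represents the linear form tr(D ad y) of [y] by some [z]. Then [D' = D - ad z]
    is trace-orthogonal to every [ad y]. As [ad (D' a)] is a commutator of [D'] and [ad a], the
    element [D' a] lies in the radical of the Killing form. *)
Lemma derivation_inner (D : 'M[R]_N) : derivation_mx idfun D -> exists z, D = ad_mx z.
Proof.
move=> dD; pose t := \row_(j < N) \tr (D *m ad_mx e`_j).
pose z := vecof e (t *m invmx (killing_mx g)); exists z.
have zP y : killing z y = \tr (D *m ad_mx y).
  rewrite [in RHS](coord_vbasis (memvf y)) ad_mx_sum mulmx_sumr raddf_sum /=.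
  rewrite killingE vecofK ?vbasisP// mulmxKV// mxE; apply: eq_bigr => i _.
  by rewrite ad_mxZ -scalemxAr mxtraceZ !mxE mulrC.
pose D' := D - ad_mx z.
have dD' : derivation_mx idfun D'.
  have := derivation_mx_adA idfun (rVof e z); rewrite adA_idfun => dz u v.
  by rewrite !mulmxBr mulmxBl linearB /= mulmxBr dD dz opprD addrACA.
have D'0 y : \tr (D' *m ad_mx y) = 0 by rewrite mulmxBl raddfB /= -zP subrr.
suff D'E : D' = 0 by apply/eqP; rewrite -subr_eq0 -/D' D'E.
have aD' a : rVof e a *m D' = 0.
  have [w wE] : exists w, rVof e w = rVof e a *m D'.
    by exists (vecof e (rVof e a *m D')); rewrite vecofK ?vbasisP.
  rewrite -wE; suff -> : w = 0 by rewrite linear0.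
  apply: killing_eq0 => b; rewrite /killing.
  have E := derivation_mxP dD' (rVof e a); rewrite -wE !adA_idfun in E.
  have -> : ad_mx w = ad_mx a *m D' - D' *m ad_mx a by rewrite E addrC addKr.
  rewrite mulmxBl raddfB /= -mulmxA mxtrace_mulC -!mulmxA -raddfB /= -mulmxBr.
  by rewrite -ad_mx_lie lieC -scaleN1r ad_mxZ -scalemxAr mxtraceZ D'0 mulr0.
apply/row_matrixP => i; rewrite !rowE -(rVofE (vbasisP _)) aD'.
by rewrite mulmx0.
Qed.

Lemma mxtrace_nilp_real n (X : 'M[R]_n) k : X ^+ k = 0 -> \tr X = 0.
Proof.
move=> Xk; apply: (@complexI R); rewrite rmorph0 -trace_map_mx.
by apply: (@mxtrace_nilp _ _ _ k); rewrite -rmorphXn /= Xk map_mx0.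
Qed.

Lemma vec_ex (w : 'rV[R]_N) : exists x, rVof e x = w.
Proof. by exists (vecof e w); rewrite vecofK ?vbasisP. Qed.

(* [exp (t (ad h))] maps [x] to [s + exp t (x - s)]. *)
Lemma jordan_point x : exists m s h, [/\ separable_poly m, exists k, hmx m (ad_mx x) ^+ k = 0,
   hmx m (ad_mx s) = 0, lie h s = 0 & lie h x = x - s].
Proof.
have [m [p [sm m0 mS mX [k N0]]]] := ad_jordan x.
have [s sE] := derivation_inner (semisimple_part_derivation sm mS N0).
set X := ad_mx x in mS mX N0 sE; rewrite sE in mS N0.
have XS : X *m ad_mx s = ad_mx s *m X by rewrite -sE hmx_comm.
have sx : lie s x = 0 by apply: ad_mx_eq0; rewrite ad_mx_lie XS subrr.
have adn : ad_mx (x - s) = X - ad_mx s by rewrite ad_mxD -scaleN1r ad_mxZ scaleN1r.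
have sn : lie s (x - s) = 0 by rewrite linearB /= sx liexx subrr.
(* [x - s] is in the image of [ad x] because it is Killing-orthogonal to the kernel: if [[x, y] =
   0], the nilpotent [ad (x - s)] commutes with [ad y], and their product has trace zero. The
   columns of the cokernel matrix, read through the Killing form, are such [y]. *)
have [h' h'E] : exists h', rVof e (x - s) = rVof e h' *m X.
  suff /submxP[w wE] : (rVof e (x - s) <= X)%MS.
    by have [h' h'E] := vec_ex w; exists h'; rewrite h'E.
  rewrite submxE; have := mulmx_coker X; move: (cokermx X) => K0 XK0.
  apply/eqP/matrixP => i j; rewrite [RHS]mxE (ord1 i) {i}.
  have [y yE] := vec_ex (col j (invmx (killing_mx g) *m K0))^T.
  have yX : X *m killing_mx g *m (rVof e y)^T = 0.
    by rewrite yE trmxK colE !mulmxA mulmxK// XK0 mul0mx.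
  have xy : lie x y = 0.
    apply/eqP; rewrite -(rVof_eq0 (vbasisP _)) ad_mxE -trmx_eq0 trmx_mul; apply/eqP.
    apply: (can_inj (mulKmx ndg)); rewrite mulmx0 mulmxA; apply/eqP.
    by rewrite -oppr_eq0 -mulNmx -killing_mx_ad yX.
  have XY : X *m ad_mx y = ad_mx y *m X.
    apply/esym/eqP; rewrite -subr_eq0 -ad_mx_lie xy.
    by rewrite -(scale0r 0) ad_mxZ scale0r.
  have -> : (rVof e (x - s) *m K0) 0 j = killing (x - s) y.
    rewrite killingE yE trmxK colE !mulmxA mulmxK// -colE !mxE.
    by apply: eq_bigr => ? _; rewrite !mxE.
  rewrite /killing; apply: (@mxtrace_nilp_real _ _ k); apply: mul_nilp_comm; last by rewrite adn.
  rewrite adn mulmxBl mulmxBr XY; congr (_ - _).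
  by rewrite -sE hmx_comm.
(* [h'] need not commute with [s], so it is replaced with its image under the projection [P] onto
   the kernel of [ad s], which commutes with [ad x] and fixes [x - s]. The sign in [h] comes from
   the order of the bracket. *)
have [r mr] := separable_idempotent sm m0.
have {mr}: hmx ('X - 'X ^+ 2 * r) (ad_mx s) = 0.
  by case/dvdpP: mr => q ->; rewrite hmxM mS mulmx0.
set S := ad_mx s in mS XS *; pose P := hmx (1 - 'X * r) S.
have -> : 'X - 'X ^+ 2 * r = (1 - 'X * r) * 'X by ring.
rewrite hmxM hmxX -/P => PS.
have XP : X *m P = P *m X by rewrite /P -hmx_comm.
have nP : rVof e (x - s) *m P = rVof e (x - s).
  have nS : rVof e (x - s) *m S = 0 by rewrite -ad_mxE sn linear0.
  by rewrite /P hmxD hmxN hmxM hmxX hmxC mulmxDr mulmx1 mulmxN mulmxA nS mul0mx oppr0 addr0.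
have [h hE] := vec_ex (- (rVof e h' *m P)).
exists m, s, h; split=> //.
- by apply: (can_inj (rVofK (vbasisP _))); rewrite lieC linearN /= ad_mxE hE mulNmx -mulmxA PS mulmx0 opprK linear0.
- apply: (can_inj (rVofK (vbasisP _))).
  by rewrite lieC linearN /= ad_mxE hE mulNmx opprK -mulmxA -XP mulmxA -h'E nP.
Qed.

End JordanPoint.

(** * Noetherian rings and Krull's intersection theorem *)

Section Ideals.
Variable A : comNzRingType.
Implicit Types (a b c : A) (G : set A) (s : seq A).

Inductive ideal_gen G : A -> Prop :=
| ideal_gen0 : ideal_gen G 0
| ideal_genS c a b : G a -> ideal_gen G b -> ideal_gen G (c * a + b).

Lemma ideal_gen_mem G a : G a -> ideal_gen G a.
Proof. by move=> Ga; rewrite -[a]addr0 -[a]mul1r; apply: ideal_genS => //; exact: ideal_gen0. Qed.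

Lemma ideal_genD G a b : ideal_gen G a -> ideal_gen G b -> ideal_gen G (a + b).
Proof.
move=> Ga; elim: Ga b => [|c x y Gx _ IH] b Gb; first by rewrite add0r.
by rewrite -addrA; apply: ideal_genS => //; exact: IH.
Qed.

Lemma ideal_genM G c a : ideal_gen G a -> ideal_gen G (c * a).
Proof.
elim=> [|d x y Gx _ IH]; first by rewrite mulr0; exact: ideal_gen0.
by rewrite mulrDr mulrA; exact: ideal_genS.
Qed.

Lemma ideal_genN G a : ideal_gen G a -> ideal_gen G (- a).
Proof. by rewrite -mulN1r; exact: ideal_genM. Qed.

Lemma ideal_genB G a b : ideal_gen G a -> ideal_gen G b -> ideal_gen G (a - b).
Proof. by move=> Ga Gb; apply: ideal_genD => //; exact: ideal_genN. Qed.

Lemma ideal_gen_sum G (J : Type) (r : seq J) (P : pred J) (v : J -> A) :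
  (forall i, P i -> ideal_gen G (v i)) -> ideal_gen G (\sum_(i <- r | P i) v i).
Proof. by move=> Gv; elim/big_ind: _ => //; [exact: ideal_gen0|exact: ideal_genD]. Qed.

Definition ideal_span s : A -> Prop := ideal_gen [set a | a \in s].

Lemma ideal_spanP s a : ideal_span s a -> exists c : nat -> A, a = \sum_(i < size s) c i * s`_i.
Proof.
elim=> [|d x y /= xs _ [c ->]].
  by exists (fun=> 0); rewrite big1// => i _; rewrite mul0r.
have xi : (index x s < size s)%N by rewrite index_mem.
exists (fun i => c i + (i == index x s)%:R * d).
under [RHS]eq_bigr => i _ do rewrite mulrDl.
rewrite big_split /= addrC; congr (_ + _).
rewrite (bigD1 (Ordinal xi))//= eqxx mul1r nth_index// big1 ?addr0// => i ni.
have -> : ((i : nat) == index x s) = false by apply/negP => /eqP E; move/eqP: ni; apply; exact/val_inj.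
by rewrite !mul0r.
Qed.

Lemma mkseq_mem (f : nat -> A) k a : a \in mkseq f k -> exists2 i, (i < k)%N & a = f i.
Proof. by move=> /mapP[j]; rewrite mem_iota => jk ->; exists j. Qed.

Lemma mem_mkseq (f : nat -> A) k i : (i < k)%N -> f i \in mkseq f k.
Proof. by move=> ik; apply: map_f; rewrite mem_iota. Qed.

(** A sequential form of the ascending chain condition: no sequence enlarges the ideal of its first
    terms at every step. *)
Definition noetherian := forall f : nat -> A, exists k, ideal_span (mkseq f k) (f k).

Lemma noetherian_sum (f : nat -> A) : noetherian ->
  exists k (d : nat -> A), f k = \sum_(i < k) d i * f i.
Proof.
move=> /(_ f)[k /ideal_spanP[c]]; rewrite size_mkseq => fk; exists k, c; rewrite fk.
by apply: eq_bigr => i _; rewrite nth_mkseq.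
Qed.

Lemma noetherian_fg : noetherian -> forall I : set A,
  exists2 s, (forall a, a \in s -> I a) & forall a, I a -> ideal_span s a.
Proof.
move=> noeA I; apply: contrapT => nfg.
have next (s : seq A) : exists a, (forall a, a \in s -> I a) -> I a /\ ~ ideal_span s a.
  have [sI|nsI] := pselect (forall a, a \in s -> I a); last by exists 0.
  apply: contrapT => na; apply: nfg; exists s => // a Ia; apply: contrapT => nsa.
  by apply: na; exists a.
have [nx nxP] := choice next.
pose S := fix S k := if k is k'.+1 then rcons (S k') (nx (S k')) else [::].
have [k] := noeA (fun k => nx (S k)).
have SE : forall k, mkseq (fun k => nx (S k)) k = S k.
  elim=> [//|m IHm].
  by rewrite -addn1 /mkseq iotaD map_cat /= add0n cats1 addn1 /= -IHm.
rewrite SE; have SI : forall k a, a \in S k -> I a.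
  elim=> [//|m IHm] a /=; rewrite mem_rcons inE => /orP[/eqP ->|/IHm//].
  by case: (nxP (S m) IHm).
by case: (nxP (S k) (SI k)).
Qed.
End Ideals.

Lemma noetherian_field (F : fieldType) : noetherian F.
Proof.
move=> f; have [f0|f0] := eqVneq (f 0) 0.
  by exists 0%N; rewrite f0; exact: ideal_gen0.
exists 1%N; rewrite -[f 1%N](mulfVK f0); apply: ideal_genM; apply: ideal_gen_mem.
by rewrite /= inE.
Qed.

Lemma noetherian_surj (A B : comNzRingType) (h : {rmorphism A -> B}) :
  (forall b, exists a, h a = b) -> noetherian A -> noetherian B.
Proof.
move=> /choice[l lK] noeA f; have [k lfk] := noeA (l \o f); exists k.
rewrite -(lK (f k)); change (l (f k)) with ((l \o f) k); elim: lfk => [|c a b /=].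
  by rewrite rmorph0; exact: ideal_gen0.
move=> /mkseq_mem[i ik ->] _ IH; rewrite rmorphD rmorphM /= lK; apply: ideal_genS => //=.
exact: mem_mkseq.
Qed.

Lemma noetherian_sum_morph (A B : comNzRingType) (h : {rmorphism A -> B}) (f : nat -> A) :
  noetherian A -> exists k (d : nat -> A), h (f k) = \sum_(i < k) h (d i) * h (f i).
Proof.
move=> /(noetherian_sum f)[k [d fk]]; exists k, d.
by rewrite fk rmorph_sum; apply: eq_bigr => i _; rewrite rmorphM.
Qed.

(** Hilbert's basis theorem. In the ideal [I] of all terms of a bad sequence, [h k] has least size
    among the elements outside the ideal of the preceding [h i]. Once the leading coefficient of
    [h k] is a combination of the preceding ones, subtracting shifted multiples of the [h i] gives a
    smaller element outside this ideal. *)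
Lemma noetherian_poly (A : comNzRingType) : noetherian A -> noetherian {poly A}.
Proof.
move=> noeA f; apply: contrapT => /forallNP nf.
pose I p := exists k, ideal_span (mkseq f k) p.
have subI k l p : (k <= l)%N -> ideal_span (mkseq f k) p -> ideal_span (mkseq f l) p.
  move=> kl; elim=> [|c a b /= /mkseq_mem[i ik ->] _]; first exact: ideal_gen0.
  by apply: ideal_genS => /=; apply: mem_mkseq; exact: leq_trans kl.
have ID p q : I p -> I q -> I (p + q).
  move=> [k Ip] [l Iq]; exists (maxn k l); apply: ideal_genD.
    by apply: subI Ip; rewrite leq_maxl.
  by apply: subI Iq; rewrite leq_maxr.
have IM c p : I p -> I (c * p) by move=> [k Ip]; exists k; exact: ideal_genM.
have sI_bound (s : seq {poly A}) : (forall p, p \in s -> I p) -> exists k, forall p, p \in s -> ideal_span (mkseq f k) p.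
  elim: s => [|q s IHs] sI; first by exists 0%N.
  have [k ks] := IHs (fun p ps => sI p (mem_behead (s := q :: s) ps)).
  have [l lq] := sI q (mem_head _ _); exists (maxn k l) => p; rewrite inE => /orP[/eqP->|/ks].
    by apply: subI lq; rewrite leq_maxr.
  by apply: subI; rewrite leq_maxl.
have next (s : seq {poly A}) : exists p : {poly A}, (forall q, q \in s -> I q) ->
    [/\ I p, ~ ideal_span s p & forall q, I q -> ~ ideal_span s q -> (size p <= size q)%N].
  have [sI|nsI] := pselect (forall q, q \in s -> I q); last by exists 0.
  have [k ks] := sI_bound s sI.
  have exd : exists d, `[< exists p, [/\ I p, ~ ideal_span s p & size p = d] >].
    exists (size (f k)); apply/asboolP; exists (f k); split=> //.
      by exists k.+1; apply: ideal_gen_mem => /=; exact: mem_mkseq.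
    move=> sfk; apply: (nf k); elim: sfk => [|c a b /= /ks sa _ IH]; first exact: ideal_gen0.
    by apply: ideal_genD => //; exact: ideal_genM.
  case: (ex_minnP exd) => d /asboolP[p [Ip np sp]] min_d; exists p => _; split=> // q Iq nq.
  by rewrite sp; apply: min_d; apply/asboolP; exists q.
have [nx nxP] := choice next.
pose S := fix S k := if k is k'.+1 then rcons (S k') (nx (S k')) else [::].
pose h k := nx (S k).
have SE k : S k = mkseq h k.
  elim: k => [//|m IHm].
  by rewrite -addn1 /mkseq iotaD map_cat /= add0n cats1 addn1 /=; congr rcons; exact: IHm.
have SI : forall k a, a \in S k -> I a.
  elim=> [//|m IHm] a /=; rewrite mem_rcons inE => /orP[/eqP ->|/IHm//].
  by case: (nxP (S m) IHm).
have hP k : [/\ I (h k), ~ ideal_span (mkseq h k) (h k)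
    & forall q, I q -> ~ ideal_span (mkseq h k) q -> (size (h k) <= size q)%N].
  by rewrite -SE; exact: nxP (SI k).
have [k [d lk]] := noetherian_sum (fun k => lead_coef (h k)) noeA.
have [Ik nk mink] := hP k.
have size_h i : (i < k)%N -> (size (h i) <= size (h k))%N.
  move=> ik; have [_ _] := hP i; apply=> // sk; apply: nk; elim: sk => [|c a b /= ai _ IH].
    exact: ideal_gen0.
  apply: ideal_genS => //=; move: ai => /mkseq_mem[j ji ->]; apply: mem_mkseq.
  exact: ltn_trans ik.
pose r := \sum_(i < k) (d i *: 'X^(size (h k) - size (h i))) * h i.
have rS : ideal_span (mkseq h k) r.
  by apply: ideal_gen_sum => i _; apply: ideal_genM; apply: ideal_gen_mem; exact: mem_mkseq.
have hk0 : h k != 0 by apply/eqP => hk0; apply: nk; rewrite hk0; exact: ideal_gen0.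
have : (size (h k) <= size (h k - r)%R)%N.
  apply: mink.
    apply: (ID) => //; rewrite -mulN1r; apply: (IM); rewrite /r.
    elim/big_ind: _ => [|//|i _]; first by exists 0%N; exact: ideal_gen0.
    by apply: (IM); case: (hP i).
  by move=> hr; apply: nk; rewrite -[h k](subrK r); exact: ideal_genD.
apply/negP; rewrite -ltnNge.
have szk : (0 < size (h k))%N by rewrite size_poly_gt0.
rewrite -(prednK szk) ltnS; apply/leq_sizeP => j.
have shift_coef (i : 'I_k) m : ((d i *: 'X^(size (h k) - size (h i))) * h i)`_m =
    d i * (if (m < size (h k) - size (h i))%N then 0 else (h i)`_(m - (size (h k) - size (h i)))).
  by rewrite -scalerAl coefZ coefXnM.
rewrite leq_eqVlt coefB /r coef_sum => /orP[/eqP<-|ltj].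
  rewrite -lead_coefE lk -sumrB big1// => i _; rewrite shift_coef.
  have := size_h i (ltn_ord i); move=> hik.
  have [hi0|hi0] := eqVneq (h i) 0.
    by rewrite hi0 lead_coef0 coef0 if_same mulr0 subrr.
  have szi : (0 < size (h i))%N by rewrite size_poly_gt0.
  have -> : ((size (h k)).-1 < size (h k) - size (h i))%N = false.
    by move: (size (h k)) (size (h i)) szk szi hik => a b; lia.
  have -> : ((size (h k)).-1 - (size (h k) - size (h i)) = (size (h i)).-1)%N.
    by move: (size (h k)) (size (h i)) szk szi hik => a b; lia.
  by rewrite -lead_coefE subrr.
rewrite nth_default; last by move: (size (h k)) szk ltj => a; lia.
rewrite big1 ?subrr// => i _; rewrite shift_coef; have := size_h i (ltn_ord i).
case: ifP => [_ _|_ hik]; first by rewrite mulr0.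
rewrite nth_default ?mulr0//.
by move: (size (h k)) (size (h i)) szk ltj hik => a b; lia.
Qed.

Lemma mpoly_alg_ind (A : comNzRingType) n (P : mpoly n A -> Prop) :
  (forall c, P (mpolyC n c)) -> (forall i, P (mpolyX A (mnm1 i))) ->
  (forall p q, P p -> P q -> P (p + q)) -> (forall p q, P p -> P q -> P (p * q)) ->
  forall p, P p.
Proof.
move=> PC PX PD PM; elim/mpolyind => [|c m p _ _ IH]; first by rewrite -mpolyC0; exact: PC.
apply: (PD) => //; rewrite -mul_mpolyC; apply: (PM) => //; rewrite mpolyXE_id.
elim/big_ind: _ => [|//|i _]; first by rewrite -mpolyC1; exact: PC.
elim: (m i) => [|k IHk]; first by rewrite expr0 -mpolyC1; exact: PC.
by rewrite exprS; exact: PM.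
Qed.

(** Adjoining the variables one at a time only takes a surjection from [{poly mpoly n A}] onto
    [mpoly n.+1 A]. *)
Lemma noetherian_mpoly (A : comNzRingType) n : noetherian A -> noetherian (mpoly n A).
Proof.
move=> noeA; elim: n => [|n IHn].
  apply: (noetherian_surj (h := @mpolyC 0 A)) noeA => p.
  elim/mpoly_alg_ind: p => [c|[]//|_ _ [a <-] [b <-]|_ _ [a <-] [b <-]].
  - by exists c.
  - by exists (a + b); rewrite rmorphD.
  - by exists (a * b); rewrite rmorphM.
pose h : {rmorphism {poly mpoly n A} -> mpoly n.+1 A} :=
  horner_eval (mpolyX A (mnm1 ord_max)) \o map_poly (@mwiden n A).
apply: (noetherian_surj (h := h)) (noetherian_poly IHn) => p.
elim/mpoly_alg_ind: p => [c|i|_ _ [a <-] [b <-]|_ _ [a <-] [b <-]].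
- exists (mpolyC n c)%:P; rewrite /= map_polyC /= /horner_eval hornerC.
  by rewrite mwidenC.
- have [j ->|->] := unliftP ord_max i; last by exists 'X; rewrite /= map_polyX /horner_eval hornerX.
  exists (mpolyX A (mnm1 j))%:P; rewrite /= map_polyC /= /horner_eval hornerC mwidenX mnmwiden1.
  congr mpolyX; congr mnm1; apply/val_inj; rewrite /= /bump leqNgt ltn_ord.
  by [].
- by exists (a + b); rewrite rmorphD.
- by exists (a * b); rewrite rmorphM.
Qed.

Section Krull.
Variables (C : comNzRingType) (n : nat) (delta : 'I_n -> C).

(** The [k]-th power of the ideal generated by the [delta i]. *)
Fixpoint powM k (p : C) : Prop :=
  if k is k'.+1 then exists2 q : 'I_n -> C, (forall i, powM k' (q i)) & p = \sum_i delta i * q i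
  else True.

Arguments powM : simpl never.

Lemma powM0 k : powM k 0.
Proof.
elim: k => [//|k IHk]; exists (fun=> 0) => //.
by rewrite big1// => i _; rewrite mulr0.
Qed.

Lemma powMD k p q : powM k p -> powM k q -> powM k (p + q).
Proof.
elim: k p q => [//|k IHk] _ _ [a aM ->] [b bM ->]; exists (fun i => a i + b i).
  by move=> i; apply: IHk; [exact: aM|exact: bM].
by rewrite -big_split; apply: eq_bigr => i _; rewrite mulrDr.
Qed.

Lemma powM_mul k l p q : powM k p -> powM l q -> powM (k + l) (p * q).
Proof.
elim: k p => [|k IHk] p.
  rewrite add0n => _; elim: l q => [//|l IHl] _ [b bM ->]; exists (fun i => p * b i).
    by move=> i; apply: IHl; exact: bM.
  by rewrite mulr_sumr; apply: eq_bigr => i _; rewrite mulrCA.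
move=> [a aM ->] qM; exists (fun i => a i * q); first by move=> i; apply: IHk; [exact: aM|exact: qM].
by rewrite mulr_suml; apply: eq_bigr => i _; rewrite mulrA.
Qed.

Lemma powMM k c p : powM k p -> powM k (c * p).
Proof. by move=> pM; apply: (@powM_mul 0 k). Qed.

Lemma powM_sum k (J : Type) (r : seq J) (P : pred J) (v : J -> C) :
  (forall i, P i -> powM k (v i)) -> powM k (\sum_(i <- r | P i) v i).
Proof. by move=> Mv; elim/big_ind: _ => //; [exact: powM0|exact: powMD]. Qed.

Lemma powM_delta i : powM 1 (delta i).
Proof.
exists (fun j => (j == i)%:R) => //; rewrite (bigD1 i)//= eqxx mulr1 big1 ?addr0// => j /negPf->.
by rewrite mulr0.
Qed.

Lemma powMW k l p : (l <= k)%N -> powM k p -> powM l p.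
Proof.
elim: l k p => [//|l IHl] [//|k] p lk [q qM ->]; exists q => // i.
exact: IHl (qM i).
Qed.

(** The image is the Rees algebra of the ideal of the [delta i]: the degree in ['X] records the
    power of the ideal. *)
Let rees : {rmorphism mpoly n C -> {poly C}} := mmap (@polyC C) (fun i => delta i *: 'X).

Let rees_lift k p : powM k p -> exists P, rees P = p *: 'X^k.
Proof.
elim: k p => [|k IHk] p.
  by exists (mpolyC n p); rewrite /= mmapC expr0 alg_polyC.
move=> [q qM ->]; have /choice[P PE] := fun i => IHk _ (qM i).
exists (\sum_i mpolyX C (mnm1 i) * P i); rewrite raddf_sum /= scaler_suml.
apply: eq_bigr => i _; rewrite rmorphM /= PE mmapX mmap1U.
by rewrite -scalerAl -scalerAr scalerA -exprS.
Qed.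

Let rees_coef P j : (0 < j)%N -> powM 1 (rees P)`_j.
Proof.
elim/mpoly_alg_ind: P j => [c|i|p q IHp IHq|p q IHp IHq] j j0.
- by rewrite /= mmapC coefC (gtn_eqF j0); exact: powM0.
- by rewrite /= mmapX mmap1U coefZ mulrC; apply: powMM; exact: powM_delta.
- by rewrite rmorphD coefD; apply: powMD; [exact: IHp|exact: IHq].
- rewrite rmorphM coefM; apply: powM_sum => -[[|i] ij] _ /=.
    by rewrite subn0; apply: powMM; exact: IHq.
  by rewrite mulrC; apply: powMM; exact: IHp.
Qed.

(* After H. Perdry: the Noetherian property is applied to lifts of [f] to the
   Rees algebra, a quotient of a polynomial ring. *)
Lemma krull_intersection (G : set C) f : noetherian C ->
  (forall k, exists2 p, powM k p & ideal_gen G (f - p)) ->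
  exists2 u, powM 1 u & ideal_gen G ((1 - u) * f).
Proof.
move=> noeC fM; have /choice[p pP] : forall k, exists p, powM k p /\ ideal_gen G (f - p).
  by move=> k; have [p] := fM k; exists p.
have pM k : powM k (p k) by case: (pP k).
have pG k : ideal_gen G (f - p k) by case: (pP k).
have /choice[P PE] := fun k => rees_lift (pM k).
have [k [d]] := noetherian_sum_morph rees P (@noetherian_mpoly _ n noeC).
move=> /(congr1 (fun Q : {poly C} => Q`_k)).
rewrite PE coefZ coefXn eqxx mulr1 coef_sum => pk.
(* The relation in degree [k] expresses [p k] through the [p i] with [i < k], with coefficients of
   degree [k - i > 0], hence in the ideal. As every [p i] is congruent to [f] modulo [G], it reads
   [f = u * f] modulo [G]. *)
pose u := \sum_(i < k) (rees (d i))`_(k - i).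
exists u; first by apply: powM_sum => i _; apply: rees_coef; rewrite subn_gt0.
have -> : (1 - u) * f = (f - p k) - \sum_(i < k) (rees (d i))`_(k - i) * (f - p i).
  have -> : p k = \sum_(i < k) (rees (d i))`_(k - i) * p i.
    rewrite pk; apply: eq_bigr => i _; rewrite PE -scalerAr coefZ coefMXn.
    by rewrite ltnNge ltnW//= mulrC.
  under [X in _ = _ - X]eq_bigr => i _ do rewrite mulrBr.
  by rewrite sumrB -mulr_suml -/u; ring.
apply: ideal_genB => //; apply: ideal_gen_sum => i _; exact: ideal_genM.
Qed.
End Krull.

(** * Hamiltonian vector fields *)

Section Newton.
Variables (R : rcfType) (g : lieAlgebra R).
Local Notation N := (\dim {:g}).
Local Notation e := (vbasis {:g}).
Hypothesis ndg : killing_mx g \in unitmx.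
Variables (A : comNzRingType) (f : {rmorphism R -> A}).
Local Notation ad := (@adA R g A f).
Local Notation kmx := (map_mx f (killing_mx g)).

Lemma adA_eq0 (v : 'rV[A]_N) : ad v = 0 -> v = 0.
Proof.
move=> v0; suff vK : v *m kmx = 0.
  rewrite -[v]mulmx1 -(map_mx1 f) -(mulmxV ndg) map_mxM mulmxA vK.
  by rewrite mul0mx.
apply/rowP => j; rewrite [RHS]mxE.
have : \tr (ad v *m map_mx f (ad_mx e`_j)) = 0 by rewrite v0 mul0mx linear0.
rewrite /adA mulmx_suml raddf_sum /= => <-; rewrite !mxE; apply: eq_bigr => i _.
by rewrite -scalemxAl mxtraceZ -map_mxM trace_map_mx !mxE.
Qed.

Variables (m r q : {poly R}) (z d : 'rV[A]_N).
Hypothesis sm : separable_poly m.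
Hypothesis mr : 'X - 'X ^+ 2 * r = m * q.
Hypothesis mz : hmx (map_poly f m) (ad z) = 0.
Hypothesis mzd : hmx (map_poly f m) (ad (z - d)) = 0.
Hypothesis dd : forall i j, d 0 i * d 0 j = 0.

Let small (a : A) : Prop := ideal_gen [set a | exists i, a = d 0 i] a.

Let small_mul a b : small a -> small b -> a * b = 0.
Proof.
elim=> [|c x y [i ->] _ IH] sb; first by rewrite mul0r.
rewrite mulrDl IH// addr0 -mulrA; elim: sb => [|c' x' y' [j ->] _ IH'].
  by rewrite !mulr0.
by rewrite mulrDr mulrDr IH' addr0 [c' * _]mulrC [d 0 i * _]mulrA dd mul0r mulr0.
Qed.

Let smallmx k l (M : 'M[A]_(k, l)) : Prop := forall i j, small (M i j).

Let smallmx_mull k l n (M : 'M[A]_(k, l)) (P : 'M[A]_(l, n)) : smallmx M -> smallmx (M *m P).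
Proof. by move=> sM i j; rewrite mxE; apply: ideal_gen_sum => k' _; rewrite mulrC; apply: ideal_genM; exact: sM. Qed.

Let smallmx_mulr k l n (M : 'M[A]_(k, l)) (P : 'M[A]_(l, n)) : smallmx P -> smallmx (M *m P).
Proof. by move=> sM i j; rewrite mxE; apply: ideal_gen_sum => k' _; apply: ideal_genM; exact: sM. Qed.

Let smallmx_mul0 k l n (M : 'M[A]_(k, l)) (P : 'M[A]_(l, n)) : smallmx M -> smallmx P -> M *m P = 0.
Proof. by move=> sM sP; apply/matrixP => i j; rewrite !mxE big1// => k' _; exact: small_mul. Qed.

Let smallmx_ad v : smallmx v -> smallmx (ad v).
Proof.
by move=> sv i j; rewrite summxE; apply: ideal_gen_sum => k _; rewrite mxE mulrC; apply: ideal_genM; exact: sv.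
Qed.

(* First-order Taylor expansion of a polynomial along a perturbation whose
   transversal part [D] commutes with [Y]; [small] perturbations square to zero. *)
Let hmx_taylor (p : {poly R}) (Y D W : 'M[A]_N) : smallmx D -> smallmx W -> D *m Y = Y *m D ->
  hmx (map_poly f p) (Y - (D + (W *m Y - Y *m W))) =
  hmx (map_poly f p) Y - hmx (map_poly f p^`()) Y *m D
  - (W *m hmx (map_poly f p) Y - hmx (map_poly f p) Y *m W).
Proof.
move=> sD sW DY; elim/poly_ind: p => [|p c IHp].
  by rewrite deriv0 !rmorph0 !hmx0 !mul0mx mulmx0 !subr0.
rewrite derivMXaddC !(rmorphD, rmorphM) /= map_polyX map_polyC !(hmxD, hmxM) hmxX !hmxC hmxX IHp.
move: (hmx (map_poly f p) Y) (hmx (map_poly f p^`()) Y) => P P'.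
have sV : smallmx (D + (W *m Y - Y *m W)).
  move=> i j; rewrite !mxE; apply: ideal_genD; first exact: sD.
  by apply: ideal_genB; [have := smallmx_mull Y sW i j|have := smallmx_mulr Y sW i j]; rewrite mxE.
have -> : (P - P' *m D - (W *m P - P *m W)) *m (Y - (D + (W *m Y - Y *m W))) =
  P *m Y - P *m (D + (W *m Y - Y *m W)) - P' *m D *m Y - (W *m P *m Y - P *m W *m Y).
  move: (D + _) sV => V sV; rewrite mulmxBr !mulmxBl.
  rewrite (smallmx_mul0 (smallmx_mulr P' sD) sV) (smallmx_mul0 (smallmx_mull P sW) sV).
  rewrite (smallmx_mul0 (smallmx_mulr P sW) sV) !subr0.
  by apply/matrixP => i j; rewrite !mxE; ring.
rewrite -!mulmxA DY !(mulmxDr, mulmxDl, mulmxBr, mulmxN, mulmxA) scalar_mxC.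
move: (P *m W *m Y) (P *m Y *m W) (W *m P *m Y) (P' *m Y *m D) ((f c)%:M *m W) => ? ? ? ? ?.
by move: (P *m Y) (P *m D) (f c)%:M => ? ? ?; apply/matrixP => i j; rewrite !mxE; ring.
Qed.

(** The conclusion puts [d] in the image of [ad z]. Split [d = d0 + w *m Y] with [d0] in the kernel
    of [Y = ad z]: then [ad d0] commutes with [Y], and [w] contributes a commutator with [m(Y) = 0].
    The Taylor expansion leaves [m'(Y) ad d0 = 0]; [m'(Y)] is invertible because [m] is separable,
    so [ad d0 = 0], and [d0 = 0] by nondegeneracy of the Killing form. *)
Lemma newton_projection : d *m hmx (map_poly f (1 - r * 'X)) (ad z) = 0.
Proof.
set Y := ad z; set P := hmx _ Y.
pose d0 := d *m P; pose w := d *m hmx (map_poly f r) Y.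
have sd : smallmx d by move=> i j; rewrite (ord1 i); apply: ideal_gen_mem; exists j.
have dE : d = d0 + w *m Y.
  have rY : hmx (map_poly f r) Y *m Y = hmx (map_poly f (r * 'X)) Y.
    by rewrite rmorphM /= map_polyX hmxM hmxX.
  rewrite /d0 /w -mulmxA rY -mulmxDr /P -hmxD -rmorphD subrK rmorph1 -[1]polyC1 hmxC.
  by rewrite mulmx1.
have d0Y : d0 *m Y = 0.
  rewrite /d0 -mulmxA -[X in P *m X]hmxX -hmxM.
  have -> : map_poly f (1 - r * 'X) * 'X = map_poly f (m * q).
    rewrite -mr !(rmorphB, rmorphM, rmorphXn) /= !map_polyX rmorph1.
    by ring.
  by rewrite rmorphM hmxM mz mul0mx mulmx0.
have DY : ad d0 *m Y = Y *m ad d0.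
  by apply/eqP; rewrite -subr_eq0 -adA_comm d0Y linear0.
have := hmx_taylor m (smallmx_ad (smallmx_mull P sd)) (smallmx_ad (smallmx_mull (hmx (map_poly f r) Y) sd)) DY.
rewrite -/w -adA_comm -linearD -dE -linearB mzd mz !mulmx0 !mul0mx !subr0 sub0r.
move=> /esym/eqP; rewrite oppr_eq0 => /eqP m'D.
apply: adA_eq0; rewrite -/d0 -[ad d0]mul1mx.
have [[u v] /= uv] : exists u, u.1 * m + u.2 * m^`() = 1.
  by move: sm; rewrite unlock => /Bezout_eq1_coprimepP.
have E1 : hmx (map_poly f 1) Y = 1%:M by rewrite rmorph1; exact: (hmxC 1 Y).
by rewrite -E1 -uv rmorphD !rmorphM hmxD !hmxM mz mulmx0 add0r -mulmxA m'D mulmx0.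
Qed.
End Newton.

Section VectorFields.
Variables (A : comNzRingType) (n : nat).
Implicit Types (w : 'rV[mpoly n A]_n) (p q : mpoly n A).

Definition vfield w p : mpoly n A := \sum_j w 0 j * mderiv j p.

Lemma vfield_is_additive w : additive (vfield w).
Proof.
move=> p q; rewrite /vfield -sumrB; apply: eq_bigr => j _.
by rewrite mderivB mulrBr.
Qed.
HB.instance Definition _ w :=
  GRing.isAdditive.Build (mpoly n A) (mpoly n A) (vfield w) (vfield_is_additive w).

Lemma vfield0 w : vfield w 0 = 0. Proof. exact: raddf0. Qed.
Lemma vfieldD w : {morph vfield w : p q / p + q}. Proof. exact: raddfD. Qed.
Lemma vfieldB w : {morph vfield w : p q / p - q}. Proof. exact: raddfB. Qed.
Lemma vfield_sum w (J : Type) (r : seq J) (P : pred J) (v : J -> mpoly n A) :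
  vfield w (\sum_(i <- r | P i) v i) = \sum_(i <- r | P i) vfield w (v i).
Proof. exact: raddf_sum. Qed.

Lemma vfieldM w p q : vfield w (p * q) = vfield w p * q + p * vfield w q.
Proof.
rewrite /vfield mulr_suml mulr_sumr -big_split; apply: eq_bigr => j _ /=.
by rewrite mderivM; ring.
Qed.

Lemma vfieldC w c : vfield w (mpolyC n c) = 0.
Proof. by rewrite /vfield big1// => j _; rewrite mderivC mulr0. Qed.

Lemma mderivXU i j : mderiv j (mpolyX A (mnm1 i)) = (i == j)%:R :> mpoly n A.
Proof.
rewrite mderivX mnm1E; case: eqVneq => [->|_]; last by rewrite scale0r.
rewrite scale1r -mpolyX0; congr mpolyX.
by apply/mnmP => k; rewrite mnmBE mnm0E subnn.
Qed.

Lemma vfieldX w i : vfield w (mpolyX A (mnm1 i)) = w 0 i.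
Proof.
rewrite /vfield (bigD1 i)//= mderivXU eqxx mulr1 big1 ?addr0// => j /negPf ji.
by rewrite mderivXU eq_sym ji mulr0.
Qed.

Lemma vfield_mx w k l m (M : 'M[mpoly n A]_(k, l)) (P : 'M[mpoly n A]_(l, m)) :
  map_mx (vfield w) (M *m P) = map_mx (vfield w) M *m P + M *m map_mx (vfield w) P.
Proof.
apply/matrixP => i j; rewrite !mxE raddf_sum -big_split; apply: eq_bigr => s _ /=.
by rewrite vfieldM !mxE.
Qed.

End VectorFields.

Section Coadjoint.
Variables (F : fieldType) (g : lieAlgebra F).
Local Notation N := (\dim {:g}).
Local Notation e := (vbasis {:g}).
Local Notation kmx := (killing_mx g).

Lemma killing_mx_adE x i j : (ad_mx x *m kmx) i j = (rVof e x *m kmx *m (rVof e (lie e`_i e`_j))^T) 0 0.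
Proof.
rewrite -killingE -killing_invar killingE ad_mxE rVofE ?vbasisP//.
by rewrite rVofE ?vbasisP// trmx_delta -colE [RHS]mxE -mulmxA -rowE [RHS]mxE.
Qed.

Variables (A : comNzRingType) (f : {rmorphism F -> A}).

Lemma adA_coad (z : 'rV[A]_N) i j :
  (adA f z *m map_mx f kmx) i j = (z *m map_mx f kmx *m (map_mx f (rVof e (lie e`_i e`_j)))^T) 0 0.
Proof.
rewrite /adA mulmx_suml summxE -[in RHS]mulmxA [RHS]mxE; apply: eq_bigr => k _.
rewrite -scalemxAl mxE; congr (_ * _).
rewrite -map_mxM map_trmx -map_mxM mxE [RHS]mxE; congr (f _).
rewrite killing_mx_adE rVofE ?vbasisP// -mulmxA -rowE [LHS]mxE.
by [].
Qed.

Hypothesis ndg : kmx \in unitmx.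

Definition killing_row_inv (y : 'rV[A]_N) : 'rV[A]_N := y *m map_mx f (invmx kmx).

Lemma killing_row_invK y : killing_row_inv y *m map_mx f kmx = y.
Proof. by rewrite /killing_row_inv -mulmxA -map_mxM mulVmx// map_mx1 mulmx1. Qed.

End Coadjoint.

Section SymmetricAlgebra.
Variables (F : fieldType) (g : lieAlgebra F).
Local Notation N := (\dim {:g}).
Local Notation e := (vbasis {:g}).
Local Notation kmx := (killing_mx g).
Local Notation S := (mpoly N F).
Local Notation X i := (mpolyX F (mnm1 i)).
Hypothesis ndg : kmx \in unitmx.

Definition ham_mx : 'M[S]_N := \matrix_(i, j) sym_of (lie e`_i e`_j).
(* The Hamiltonian vector field of the [l]-th coordinate. *)
Definition ham_field (l : 'I_N) : S -> S := vfield (row l ham_mx).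

Lemma sym_bracketE (a p : S) : sym_bracket a p = \sum_l mderiv l a * ham_field l p.
Proof.
apply: eq_bigr => l _; rewrite /ham_field /vfield mulr_sumr; apply: eq_bigr => j _.
by rewrite !mxE -mulrA; congr (_ * _); rewrite mulrC.
Qed.

Lemma ham_field_bracket l (p : S) : ham_field l p = sym_bracket (X l : S) p.
Proof.
rewrite sym_bracketE (bigD1 l)//= mderivXU eqxx mul1r big1 ?addr0// => k /negPf kl.
by rewrite mderivXU eq_sym kl mul0r.
Qed.

Definition gen_row : 'rV[S]_N := \row_i X i.

(* The generic element of the algebra, in coordinates: the identity of the
   dual, seen through the Killing form. *)
Definition gen_elt : 'rV[S]_N := killing_row_inv (@mpolyC N F) gen_row.

Local Notation Ag := (adA (@mpolyC N F) gen_elt).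

Lemma sym_of_row x : sym_of x = (gen_row *m (map_mx (@mpolyC N F) (rVof e x))^T) 0 0.
Proof.
rewrite /sym_of mxE; apply: eq_bigr => i _; rewrite !mxE mulrC.
by rewrite mul_mpolyC.
Qed.

(** The Killing form turns the coadjoint action into the adjoint one. Hamiltonian fields thereby
    move the generic element by brackets with it. *)
Lemma ham_mxE : ham_mx = Ag *m map_mx (@mpolyC N F) kmx.
Proof.
apply/matrixP => i j; rewrite adA_coad killing_row_invK// -sym_of_row.
by rewrite mxE.
Qed.

Lemma vfield_adA w (z : 'rV[S]_N) :
  map_mx (vfield w) (adA (@mpolyC N F) z) = adA (@mpolyC N F) (map_mx (vfield w) z).
Proof.
apply/matrixP => i j; rewrite mxE /adA !summxE raddf_sum /=; apply: eq_bigr => k _.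
by rewrite [in LHS]mxE [in RHS]mxE vfieldM !mxE vfieldC mulr0 addr0.
Qed.

Lemma ham_field_gen_elt l : map_mx (ham_field l) gen_elt = delta_mx 0 l *m Ag.
Proof.
rewrite /gen_elt /killing_row_inv vfield_mx.
have -> : map_mx (ham_field l) gen_row = row l ham_mx.
  by apply/rowP => i; rewrite !mxE /ham_field vfieldX !mxE.
have -> : map_mx (vfield (row l ham_mx)) (map_mx (@mpolyC N F) (invmx kmx)) = 0.
  by apply/matrixP => i j; rewrite !mxE vfieldC.
rewrite mulmx0 addr0 ham_mxE rowE -!mulmxA -map_mxM mulmxV// map_mx1 mulmx1.
by [].
Qed.

(** On [Ag] the Hamiltonian field is the commutator with [Al], and both operations obey the Leibniz
    rule for matrix products. *)
Lemma ham_field_hmx (l : 'I_N) (p : {poly F}) :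
  let Al := map_mx (@mpolyC N F) (ad_mx e`_l) in
  map_mx (ham_field l) (hmx (map_poly (@mpolyC N F) p) Ag) =
  Al *m hmx (map_poly (@mpolyC N F) p) Ag - hmx (map_poly (@mpolyC N F) p) Ag *m Al.
Proof.
move=> Al; have tA : map_mx (ham_field l) Ag = Al *m Ag - Ag *m Al.
  by rewrite vfield_adA ham_field_gen_elt adA_comm adA_delta.
elim/poly_ind: p => [|p c IHp].
  by rewrite rmorph0 hmx0 mulmx0 mul0mx subr0; apply/matrixP => i j; rewrite !mxE /ham_field raddf0.
rewrite rmorphD rmorphM /= map_polyX map_polyC hmxD hmxM hmxX hmxC.
have tc : map_mx (ham_field l) (mpolyC N c)%:M = 0 :> 'M[S]_N.
  by apply/matrixP => i j; rewrite !mxE /ham_field raddfMn /= vfieldC mul0rn.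
have -> : map_mx (ham_field l) (hmx (map_poly (@mpolyC N F) p) Ag *m Ag + (mpolyC N c)%:M) =
   map_mx (ham_field l) (hmx (map_poly (@mpolyC N F) p) Ag *m Ag).
  by rewrite raddfD /= tc addr0.
rewrite vfield_mx IHp tA; move: (hmx _ _) => P; move: {tA IHp tc}Ag => Y.
rewrite mulmxBl mulmxBr mulmxDr mulmxDl !mulmxA scalar_mxC.
move: (Al *m P *m Y) (P *m Al *m Y) (P *m Y *m Al) (_ *m Al) => ? ? ? ?.
by apply/matrixP => i j; rewrite !mxE; ring.
Qed.

Lemma sym_eval_hmx (p : {poly F}) (phi : lie_dual g) x i j : (forall y, phi y = killing x y) ->
  sym_eval (hmx (map_poly (@mpolyC N F) p) Ag i j) phi = hmx p (ad_mx x) i j.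
Proof.
move=> phix; pose ev : {rmorphism S -> F} := meval (fun i => phi e`_i).
have -> : sym_eval (hmx (map_poly (@mpolyC N F) p) Ag i j) phi =
   map_mx ev (hmx (map_poly (@mpolyC N F) p) Ag) i j by rewrite mxE.
rewrite map_hmx map_adA -map_poly_comp.
have evC : ev \o @mpolyC N F =1 idfun by move=> c; rewrite /= mevalC.
rewrite (eq_map_poly evC) map_poly_id//.
have -> : map_mx ev gen_elt = rVof e x.
  rewrite /gen_elt /killing_row_inv map_mxM -map_mx_comp.
  have -> : map_mx ev gen_row = rVof e x *m kmx.
    apply/rowP => k; rewrite mxE [gen_row _ _]mxE /= mevalXU phix killingE (rVofE (vbasisP _)).
    by rewrite trmx_delta -colE mxE.
  have -> : map_mx (ev \o @mpolyC N F) (invmx kmx) = invmx kmx.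
    by apply/matrixP => k l; rewrite mxE evC.
  by rewrite mulmxK.
by rewrite (adA_eq _ evC) adA_idfun.
Qed.

End SymmetricAlgebra.

(** * The formal neighbourhood of the diagonal *)

Section QuotientRing.
Variables (A : comNzRingType) (Q : set A).
Hypotheses (Q0 : Q 0) (QD : forall a b, Q a -> Q b -> Q (a + b))
  (QM : forall c a, Q a -> Q (c * a)) (Q1 : ~ Q 1).

Let qpred : pred A := fun a => `[< Q a >].

Let qpred_ideal : idealr_closed qpred.
Proof.
split; first exact/asboolP; first by apply/asboolP.
by move=> a u v /asboolP Qu /asboolP Qv; apply/asboolP; apply: QD => //; exact: QM.
Qed.

HB.instance Definition _ := isIdealr.Build A qpred qpred_ideal.
Let qideal : idealr A := qpred.

(** Congruences modulo [Q] become equations in a ring, to which [newton_projection] applies. A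
    [comNzRingType] is nontrivial, whence [~ Q 1]. *)
Lemma quotient_ring_exists :
  exists (B : comNzRingType) (h : {rmorphism A -> B}), forall a, h a = 0 <-> Q a.
Proof.
exists {ideal_quot qideal}, \pi_({ideal_quot qideal})%qT => a.
have -> : (\pi_({ideal_quot qideal})%qT a = 0) <-> (a \in qideal).
  rewrite -[X in X \in _]subr0 Quotient.idealrBE; split=> [E|/eqP].
    by rewrite eq_sym; apply/eqP; rewrite E /= rmorph0.
  by rewrite rmorph0.
by split=> [/asboolP|?]; last exact/asboolP.
Qed.
End QuotientRing.

Section FormalNeighbourhood.
Variables (R : rcfType) (g : lieAlgebra R).
Local Notation N := (\dim {:g}).
Local Notation e := (vbasis {:g}).
Local Notation kmx := (killing_mx g).
Hypothesis ndg : kmx \in unitmx.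
Local Notation S := (mpoly N R).
(* Polynomials in two generic points: the coefficients are polynomials in the
   first one, the variables are the coordinates of the second one. *)
Local Notation C := (mpoly N S).

Variables (I J : set S).
Hypotheses (Ith : forall l f, I f -> I (ham_field (g := g) l f))
  (J0 : J 0) (JD : forall a b, J a -> J b -> J (a + b)) (JM : forall c a, J a -> J (c * a))
  (Jth : forall l f, J f -> J (ham_field (g := g) l f)) (IJ : forall f, I f -> J f).
Variables (m r q : {poly R}).
Hypothesis sm : separable_poly m.
Hypothesis mr : 'X - 'X ^+ 2 * r = m * q.
Hypothesis Im : forall i j,
  I (hmx (map_poly (@mpolyC N R) m) (adA (@mpolyC N R) (gen_elt g)) i j).

Let cst : {rmorphism R -> C} := (@mpolyC N S) \o (@mpolyC N R).
Let fst_pt : {rmorphism S -> C} := @mpolyC N S.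
Variable snd_pt : {rmorphism S -> C}.
Hypothesis snd_ptC : forall c, snd_pt (mpolyC N c) = cst c.
Hypothesis snd_ptX : forall i, snd_pt (mpolyX R (mnm1 i)) = mpolyX S (mnm1 i).

Let zx := map_mx fst_pt (gen_elt g).
Let zy := map_mx snd_pt (gen_elt g).
Let delta := zy - zx.
Local Notation Y := (adA cst zy).

Let mapE (A B : Type) (h : A -> B) k l (M : 'M[A]_(k, l)) i j : map_mx h M i j = h (M i j).
Proof. exact: mxE. Qed.

Let deltaE i : delta 0 i = snd_pt (gen_elt g 0 i) - fst_pt (gen_elt g 0 i).
Proof. by rewrite -(mapE snd_pt) -(mapE fst_pt) /delta mxE [X in _ + X]mxE. Qed.

Let map_snd_cst k l (M : 'M[R]_(k, l)) :
  map_mx snd_pt (map_mx (@mpolyC N R) M) = map_mx cst M.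
Proof. by apply/matrixP => i j; rewrite !mxE snd_ptC. Qed.

Let YE : map_mx snd_pt (adA (@mpolyC N R) (gen_elt g)) = Y.
Proof. by rewrite map_adA; apply: adA_eq => c; exact: snd_ptC. Qed.

(** Modulo [m(Y) = 0], [r(Y)] inverts [Y] on its image, so [hrow *m Y] is the projection of the
    displacement [delta] onto the image of [Y], along the orbit. [E] combines the Hamiltonian fields
    in the second point with coefficients [hrow]; it maps [delta] to this projection. *)
Let hrow := delta *m hmx (map_poly cst r) Y.
Let w := hrow *m Y *m map_mx cst kmx.
Let E := vfield w.

Let pM k := powM (fun i => delta 0 i) k.

Let pM_delta i : pM 1 (delta 0 i).
Proof. exact: (powM_delta (fun i => delta 0 i)). Qed.

Let pM_delta_mul k (P : 'M[C]_(N, k)) j : pM 1 ((delta *m P) 0 j).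
Proof.
rewrite mxE; apply: powM_sum => i _; rewrite mulrC; apply: powMM.
exact: (powM_delta (fun i => delta 0 i)).
Qed.

Let pM_w j : pM 1 (w 0 j).
Proof. by rewrite /w /hrow -!mulmxA; exact: pM_delta_mul. Qed.

Let pM_E p : pM 1 (E p).
Proof.
rewrite /E /vfield; apply: powM_sum => j _; rewrite mulrC; apply: powMM; exact: pM_w.
Qed.

Let E_snd f : E (snd_pt f) = \sum_l hrow 0 l * snd_pt (ham_field (g := g) l f).
Proof.
elim/mpoly_alg_ind: f => [c|i|f f' IHf IHf'|f f' IHf IHf'].
- rewrite snd_ptC [E _]vfieldC big1// => l _.
  by rewrite /ham_field vfieldC rmorph0 mulr0.
- rewrite snd_ptX [E _]vfieldX /w -YE -map_snd_cst -mulmxA -map_mxM -ham_mxE//.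
  by rewrite mxE; apply: eq_bigr => l _; rewrite /ham_field vfieldX !mxE.
- rewrite rmorphD /E vfieldD -/E IHf IHf' -big_split; apply: eq_bigr => l _ /=.
  by rewrite /ham_field vfieldD rmorphD mulrDr.
- rewrite rmorphM [E _]vfieldM -/E IHf IHf' mulr_suml mulr_sumr -big_split.
  apply: eq_bigr => l _ /=; rewrite /ham_field vfieldM rmorphD !rmorphM.
  by ring.
Qed.

Let E_delta : map_mx E delta = hrow *m Y.
Proof.
apply/rowP => i; rewrite mapE deltaE /E vfieldB [X in _ - X]vfieldC subr0 -/E E_snd [RHS]mxE.
apply: eq_bigr => l _; congr (_ * _); rewrite -YE mapE; congr (snd_pt _).
by have /rowP/(_ i) := ham_field_gen_elt ndg l; rewrite -rowE mapE [RHS]mxE.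
Qed.

(** Modulo [kk], the second point lies on the zeros of [I] and the first one on those of [J]. *)
Let kk : set C := ideal_gen [set c | (exists2 f, I f & c = snd_pt f) \/ (exists2 a, J a & c = fst_pt a)].

Let kk_snd f : I f -> kk (snd_pt f).
Proof. by move=> If; apply: ideal_gen_mem; left; exists f. Qed.

Let kk_fst a : J a -> kk (fst_pt a).
Proof. by move=> Ja; apply: ideal_gen_mem; right; exists a. Qed.

Let kk_E p : kk p -> kk (E p).
Proof.
elim=> [|c a b gen kkb IH]; first by rewrite /E vfield0; exact: ideal_gen0.
rewrite /E vfieldD vfieldM -/E -addrA; apply: ideal_genD; last first.
  apply: ideal_genD => //; case: gen => [[f If ->]|[a' Ja ->]].
    rewrite E_snd; apply: ideal_genM; apply: ideal_gen_sum => l _; apply: ideal_genM.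
    exact/kk_snd/Ith.
  by rewrite [E _]vfieldC mulr0; exact: ideal_gen0.
by apply: ideal_genM; exact: ideal_gen_mem.
Qed.

Let pK k p := exists2 q, pM k q & kk (p - q).

Let pK_of_kk k p : kk p -> pK k p.
Proof. by move=> kp; exists 0; [exact: powM0|rewrite subr0]. Qed.

Let pK_of_pM k p : pM k p -> pK k p.
Proof. by move=> Mp; exists p => //; rewrite subrr; exact: ideal_gen0. Qed.

Let pKD k p p' : pK k p -> pK k p' -> pK k (p + p').
Proof.
move=> [a Ma ka] [b Mb kb]; exists (a + b); first exact: powMD.
by rewrite opprD addrACA; exact: ideal_genD.
Qed.

Let pK_mul k l p p' : pM k p -> pK l p' -> pK (k + l) (p * p').
Proof.
move=> Mp [b Mb kb]; exists (p * b); first exact: powM_mul.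
by rewrite -mulrBr; exact: ideal_genM.
Qed.

Let pKM k c p : pK k p -> pK k (c * p).
Proof. exact: (@pK_mul 0 k). Qed.

Let pKB k p p' : pK k p -> pK k p' -> pK k (p - p').
Proof. by move=> Kp Kp'; apply: pKD => //; rewrite -mulN1r; exact: pKM. Qed.

Let pK_sum k (T : Type) (s : seq T) (P : pred T) (v : T -> C) :
  (forall i, P i -> pK k (v i)) -> pK k (\sum_(i <- s | P i) v i).
Proof.
move=> Kv; elim/big_ind: _ => //; [exact/pK_of_kk/ideal_gen0|exact: pKD].
Qed.

Let pKW k l p : (l <= k)%N -> pK k p -> pK l p.
Proof. by move=> lk [b Mb kb]; exists b => //; exact: powMW lk Mb. Qed.

Let eps := delta *m hmx (map_poly cst (1 - r * 'X)) Y.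

(** Modulo [kk] both points satisfy the equation [m(ad) = 0], the first one because [I] is contained
    in [J]. Modulo [pK 2] the products of coordinates of [delta] vanish as well, which is the
    setting of [newton_projection]. *)
Let pK_eps i : pK 2 (eps 0 i).
Proof.
have [pK1|npK1] := pselect (pK 2 1); first by rewrite -[eps 0 i]mulr1; exact: pKM.
have pK0 : pK 2 0 by apply: pK_of_kk; exact: ideal_gen0.
have [B [h hP]] := quotient_ring_exists pK0 (@pKD 2) (@pKM 2) npK1.
pose f : {rmorphism R -> B} := h \o cst.
have entry (p : {poly R}) (z : 'rV[C]_N) :
    map_mx h (hmx (map_poly cst p) (adA cst z)) = hmx (map_poly f p) (adA f (map_mx h z)).
  by rewrite map_hmx map_adA -map_poly_comp.
have mz : hmx (map_poly f m) (adA f (map_mx h zy)) = 0.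
  rewrite -entry; apply/matrixP => i' j'; rewrite mxE [RHS]mxE; apply/hP; apply: pK_of_kk.
  have -> : hmx (map_poly cst m) Y = map_mx snd_pt (hmx (map_poly (@mpolyC N R) m) (adA (@mpolyC N R) (gen_elt g))).
    rewrite map_hmx YE -map_poly_comp; congr hmx; apply: eq_map_poly => c.
    by apply: esym; exact: snd_ptC.
  by rewrite mxE; apply: kk_snd.
have mzd : hmx (map_poly f m) (adA f (map_mx h zy - map_mx h delta)) = 0.
  rewrite -map_mxB /delta opprB addrC subrK -entry.
  apply/matrixP => i' j'; rewrite mxE [RHS]mxE; apply/hP; apply: pK_of_kk.
  have -> : hmx (map_poly cst m) (adA cst zx) = map_mx fst_pt (hmx (map_poly (@mpolyC N R) m) (adA (@mpolyC N R) (gen_elt g))).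
    by rewrite map_hmx map_adA -map_poly_comp.
  by rewrite mxE; apply/kk_fst/IJ.
have dd i' j' : map_mx h delta 0 i' * map_mx h delta 0 j' = 0.
  rewrite !mapE -rmorphM; apply/hP; apply: pK_of_pM.
  by apply: (@powM_mul _ _ (fun i => delta 0 i) 1 1); exact: pM_delta.
have := newton_projection ndg sm mr mz mzd dd.
rewrite -entry -map_mxM => /rowP/(_ i); rewrite mxE [RHS]mxE => /hP.
exact.
Qed.

Let E_deltaE i : E (delta 0 i) = delta 0 i - eps 0 i.
Proof.
have hE : hrow *m Y = delta - eps.
  rewrite /eps rmorphB rmorphM rmorph1 /= map_polyX hmxD hmxN hmxM hmxX.
  have -> : hmx 1 Y = 1%:M by exact: (hmxC 1 Y).
  by rewrite mulmxBr mulmx1 mulmxA opprB addrC subrK.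
by rewrite -(mapE E) E_delta hE mxE [X in _ + X]mxE.
Qed.

(* [E] is the Euler operator of the formal neighbourhood of the diagonal. *)
Let E_euler k p : pM k p -> pK k.+1 (E p - k%:R * p).
Proof.
elim: k p => [|k IHk] p.
  by move=> _; rewrite mul0r subr0; apply/pK_of_pM/pM_E.
move=> [b bM ->]; rewrite /E vfield_sum mulr_sumr -sumrB; apply: pK_sum => i _.
rewrite vfieldM -/E E_deltaE.
have -> : (delta 0 i - eps 0 i) * b i + delta 0 i * E (b i) - k.+1%:R * (delta 0 i * b i) =
    delta 0 i * (E (b i) - k%:R * b i) - b i * eps 0 i.
  by rewrite -natr1; ring.
apply: pKB; first by apply: (@pK_mul 1 k.+1); [exact: pM_delta|exact: IHk (bM i)].
by apply: (@pKW (k + 2)); [rewrite addn2|apply: pK_mul; [exact: bM|exact: pK_eps]].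
Qed.

Let JC : set C := ideal_gen [set c | exists2 f, J f & c = snd_pt f].

Let diag_pM f : pM 1 (snd_pt f - fst_pt f).
Proof.
elim/mpoly_alg_ind: f => [c|i|f f' IHf IHf'|f f' IHf IHf'].
- by rewrite snd_ptC subrr; exact: powM0.
- have -> : snd_pt (mpolyX R (mnm1 i)) - fst_pt (mpolyX R (mnm1 i)) =
     (delta *m map_mx cst kmx) 0 i.
    have dK (h : {rmorphism S -> C}) : (forall c, h (mpolyC N c) = cst c) ->
       (map_mx h (gen_elt g) *m map_mx cst kmx) 0 i = h (mpolyX R (mnm1 i)).
      move=> hC; have -> : map_mx cst kmx = map_mx h (map_mx (@mpolyC N R) kmx).
        by apply/matrixP => k l; rewrite !mxE hC.
      by rewrite -map_mxM killing_row_invK// !mxE.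
    by rewrite mulmxBl mxE (dK snd_pt)// mxE (dK fst_pt).
  exact: pM_delta_mul.
- by rewrite !rmorphD opprD addrACA; exact: powMD.
- have -> : snd_pt (f * f') - fst_pt (f * f') =
    snd_pt f * (snd_pt f' - fst_pt f') + fst_pt f' * (snd_pt f - fst_pt f).
    by rewrite !rmorphM; ring.
  by apply: powMD; apply: powMM.
Qed.

(** If [JC] has order [k], then [E p] has order [k + 1]: the coefficients of [E] vanish on the
    diagonal and [J] is stable under Hamiltonian fields. But [E] multiplies by [k] in order [k], so
    [k * p] has order [k + 1] too. *)
Let JC_pK k p : JC p -> pK k p.
Proof.
elim: k p => [|k IHk] p Jp; first by apply: pK_of_pM.
have JE : pK k.+1 (E p).
  elim: Jp => [|c a b [f Jf ->] Jb IH].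
    by rewrite /E vfield0; exact/pK_of_kk/ideal_gen0.
  rewrite /E vfieldD vfieldM -/E; apply: pKD => //; apply: pKD.
    apply: (@pK_mul 1 k) => //; apply: IHk; apply: ideal_gen_mem; by exists f.
  rewrite E_snd; apply: pKM; apply: pK_sum => l _; apply: (@pK_mul 1 k).
    exact: pM_delta_mul.
  by apply: IHk; apply: ideal_gen_mem; exists (ham_field (g := g) l f) => //; exact: Jth.
(* In order 0 the factor [k] is zero. There [f] at the second point is compared with [f] at the
   first one, which lies in [kk]. *)
case: k IHk JE => [|k] IHk JE.
  elim: Jp {JE} => [|c a b [f Jf ->] Jb IH]; first exact/pK_of_kk/ideal_gen0.
  apply: pKD => //; apply: pKM; rewrite -(subrK (fst_pt f) (snd_pt f)).
  by apply: pKD; [exact/pK_of_pM/diag_pM|exact/pK_of_kk/kk_fst].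
have [b Mb kb] := IHk p Jp.
rewrite -(subrK b p); apply: pKD; first exact: pK_of_kk.
have : pK k.+2 (k.+1%:R * b).
  have -> : k.+1%:R * b = E p - E (p - b) - (E b - k.+1%:R * b).
    have -> : E (p - b) = E p - E b by exact: vfieldB.
    by move: (E p) (E b) => x y; ring.
  apply: pKB; last exact: (E_euler Mb).
  by apply: pKB; [exact: JE|exact: (pK_of_kk _ (kk_E kb))].
move=> /(pKM (cst (k.+1%:R^-1))); rewrite mulrA.
by rewrite -(rmorph_nat cst) -rmorphM mulVf ?pnatr_eq0// rmorph1 mul1r.
Qed.

(** Krull's theorem gives a [u] for each [f]; as [J] is finitely generated, the product of the
    [1 - u] over generators serves for all of [J]. The first clause says that [u] vanishes on the
    diagonal. *)
Lemma formal_neighbourhood : exists u : C, 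
  [/\ (forall h : {rmorphism C -> S}, (forall f, h (snd_pt f) = f) -> (forall f, h (mpolyC N f) = f) -> h u = 0)
    & forall f, J f -> ideal_gen [set c | (exists2 f, I f & c = snd_pt f) \/ (exists2 a, J a & c = mpolyC N a)]
        ((1 - u) * snd_pt f)].
Proof.
have noeS : noetherian S by apply: noetherian_mpoly; exact: noetherian_field.
have noeC : noetherian C by exact: noetherian_mpoly.
have [s sJ Js] := noetherian_fg noeS J.
have [u Mu us] : exists2 u, pM 1 u & forall f, f \in s -> kk ((1 - u) * snd_pt f).
  elim: s sJ {Js} => [|f s IHs] sJ; first by exists 0; [exact: powM0|].
  have [u Mu us] := IHs (fun f' f's => sJ f' (mem_behead (s := f :: s) f's)).
  have Jf : JC (snd_pt f).
    by apply: ideal_gen_mem; exists f => //; apply: sJ; exact: mem_head.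
  have [v Mv vf] := krull_intersection noeC (fun k => JC_pK k Jf).
  exists (u + v - u * v).
    apply: powMD; first exact: powMD.
    by rewrite -mulNr; exact: powMM.
  have -> : 1 - (u + v - u * v) = (1 - u) * (1 - v) by ring.
  move=> f'; rewrite inE => /orP[/eqP->|/us kf'].
    by rewrite -mulrA; exact: ideal_genM.
  by rewrite mulrAC mulrC; exact: ideal_genM.
exists u; split.
  move=> h hs hf; case: Mu => b _ ->; rewrite rmorph_sum big1// => i _.
  have hf' f : h (fst_pt f) = f by exact: hf.
  by rewrite rmorphM deltaE rmorphB hs hf' subrr mul0r.
move=> f /Js; elim=> [|c a b /= /us ka _ IH].
  by rewrite rmorph0 mulr0; exact: ideal_gen0.
rewrite rmorphD rmorphM mulrDr; apply: ideal_genD => //.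
by rewrite mulrCA; exact: ideal_genM.
Qed.
End FormalNeighbourhood.

(** * From generic points to points of the orbit *)

Section PoissonIdealOrbit.
Variables (R : rcfType) (g : lieAlgebra R).
Local Notation N := (\dim {:g}).
Local Notation e := (vbasis {:g}).
Local Notation S := (mpoly N R).
Local Notation C := (mpoly N S).
Hypothesis ndg : killing_mx g \in unitmx.
Variables (O : set (lie_dual g)) (J : set S).
Let I : set S := [set f | forall phi, O phi -> sym_eval f phi = 0].
Hypotheses (J0 : J 0) (JD : forall a b, J a -> J b -> J (a + b)) (JM : forall c a, J a -> J (c * a)).
Hypothesis IJ : forall f, I f -> J f.

Let val (phi : lie_dual g) : {rmorphism S -> R} := meval (fun i => phi e`_i).

(* By induction on the number of terms: subtracting multiples of the slice at a
   point where the second factor of a term does not vanish eliminates this term. *)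
Lemma diagonal_of_slices (l : seq (S * S)) :
  (forall phi, O phi -> J (\sum_(ab <- l) ab.1 * mpolyC N (val phi ab.2))) ->
  J (\sum_(ab <- l) ab.1 * ab.2).
Proof.
have [k] := ubnP (size l); elim: k l => [//|k IHk] [|[a b] l] /= lk Jl.
  by rewrite big_nil.
have [Ib|nIb] := pselect (I b).
  rewrite big_cons /=; apply: JD; first by apply: JM; exact: IJ.
  apply: IHk => // phi Ophi; have := Jl phi Ophi.
  by rewrite big_cons /= [val phi b]Ib// mpolyC0 mulr0 add0r.
have [phi0 Ophi0 b0] : exists2 phi0, O phi0 & val phi0 b <> 0.
  apply: contrapT => nphi; apply: nIb => phi Ophi; apply: contrapT => b0; apply: nphi.
  by exists phi.
set c := val phi0 b in b0; have c0 : c != 0 by apply/eqP.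
pose t (p : S) := val phi0 p / c.
have E0 : J (a * mpolyC N c + \sum_(ab <- l) ab.1 * mpolyC N (val phi0 ab.2)).
  by have := Jl phi0 Ophi0; rewrite big_cons.
have tE (p : S) : mpolyC N (t p) * mpolyC N c = mpolyC N (val phi0 p).
  by rewrite -mpolyCM mulfVK.
have cV : mpolyC N c^-1 * mpolyC N c = 1 :> S by rewrite -mpolyCM mulVf// mpolyC1.
have sumE (x : S) : \sum_(ab <- l) ab.1 * (mpolyC N (t ab.2) * x) =
    (x * mpolyC N c^-1) * \sum_(ab <- l) ab.1 * mpolyC N (val phi0 ab.2).
  rewrite mulr_sumr; apply: eq_bigr => ab _; rewrite -tE.
  by rewrite -[LHS]mulr1 -cV; ring.
pose l' := [seq (ab.1, ab.2 - mpolyC N (t ab.2) * b) | ab <- l].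
have Jl' : J (\sum_(ab <- l') ab.1 * ab.2).
  apply: IHk => [|phi Ophi]; first by rewrite size_map.
  have -> : \sum_(ab <- l') ab.1 * mpolyC N (val phi ab.2) =
     (a * mpolyC N (val phi b) + \sum_(ab <- l) ab.1 * mpolyC N (val phi ab.2)) -
     (mpolyC N (val phi b) * mpolyC N c^-1) *
     (a * mpolyC N c + \sum_(ab <- l) ab.1 * mpolyC N (val phi0 ab.2)).
    rewrite big_map /= mulrDr -sumE.
    have -> : mpolyC N (val phi b) * mpolyC N c^-1 * (a * mpolyC N c) = a * mpolyC N (val phi b).
      by rewrite -[RHS]mulr1 -cV; ring.
    rewrite opprD addrACA subrr add0r -sumrB; apply: eq_bigr => ab _.
    rewrite -mulrBr rmorphB rmorphM /= [val phi (mpolyC _ _)]mevalC.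
    by rewrite mpolyCB mpolyCM.
  apply: (JD); first by have := Jl phi Ophi; rewrite big_cons.
  by rewrite -mulNr; exact: JM.
have -> : \sum_(ab <- (a, b) :: l) ab.1 * ab.2 = \sum_(ab <- l') ab.1 * ab.2 +
    (b * mpolyC N c^-1) * (a * mpolyC N c + \sum_(ab <- l) ab.1 * mpolyC N (val phi0 ab.2)).
  rewrite big_cons big_map /= mulrDr -sumE.
  have -> : b * mpolyC N c^-1 * (a * mpolyC N c) = a * b by rewrite -[RHS]mulr1 -cV; ring.
  rewrite addrCA; congr (_ + _); rewrite -big_split; apply: eq_bigr => ab _ /=.
  by rewrite -mulrDr subrK.
by apply: JD => //; exact: JM.
Qed.

Hypotheses (Ith : forall l f, I f -> I (ham_field (g := g) l f))
  (Jth : forall l f, J f -> J (ham_field (g := g) l f)).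
Variables (m : {poly R}).
Hypotheses (sm : separable_poly m) (m0 : root m 0).
Hypothesis Im : forall i j,
  I (hmx (map_poly (@mpolyC N R) m) (adA (@mpolyC N R) (gen_elt g)) i j).

Lemma poisson_ideal_no_zero :
  (forall phi, O phi -> exists2 f, J f & sym_eval f phi <> 0) -> J 1.
Proof.
move=> Jnz; have [r /dvdpP[q]] := separable_idempotent sm m0; rewrite [q * m]mulrC => mr.
pose cst : {rmorphism R -> C} := (@mpolyC N S) \o (@mpolyC N R).
have [snd_pt [sC sX]] : exists snd_pt : {rmorphism S -> C},
   (forall c, snd_pt (mpolyC N c) = cst c) /\
   (forall i, snd_pt (mpolyX R (mnm1 i)) = mpolyX S (mnm1 i)).
  exists (mmap cst (fun i => mpolyX S (mnm1 i))); split=> [c|i] /=.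
    by rewrite mmapC.
  by rewrite mmapX mmap1U.
have [u [u0 uJ]] := formal_neighbourhood ndg Ith Jth IJ sm mr Im sC sX.
have [diag [dX dC dE]] : exists diag : {rmorphism C -> S},
    [/\ forall i, diag (mpolyX S (mnm1 i)) = mpolyX R (mnm1 i), forall f, diag (mpolyC N f) = f
      & forall p, diag p = \sum_(k <- msupp p) mcoeff k p * mpolyX R k].
  exists (meval (fun i => mpolyX R (mnm1 i) : S)); split=> [i|f|p] /=.
  - by rewrite mevalXU.
  - by rewrite mevalC.
  - by rewrite mevalE; apply: eq_bigr => k _; rewrite [in RHS]mpolyXE_id.
have ev_ex (phi : lie_dual g) : exists ev : {rmorphism C -> S},
    [/\ forall i, ev (mpolyX S (mnm1 i)) = mpolyC N (phi e`_i), forall f, ev (mpolyC N f) = f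
      & forall p, ev p = \sum_(k <- msupp p) mcoeff k p * mpolyC N (val phi (mpolyX R k))].
  exists (meval (fun i => mpolyC N (phi e`_i) : S)); split=> [i|f|p] /=.
  - by rewrite mevalXU.
  - by rewrite mevalC.
  - rewrite mevalE; apply: eq_bigr => k _; congr (_ * _).
    rewrite mevalX rmorph_prod /=; apply: eq_bigr => i _.
    by rewrite rmorphXn.
have diag_snd f : diag (snd_pt f) = f.
  elim/mpoly_alg_ind: f => [c|i|p p' IHp IHp'|p p' IHp IHp'].
  - by rewrite sC; exact: dC.
  - by rewrite sX.
  - by rewrite !rmorphD IHp IHp'.
  - by rewrite !rmorphM IHp IHp'.
have : J (diag (1 - u)); last first.
  by rewrite rmorphB rmorph1 (u0 diag diag_snd dC) subr0.
(* [1 - u] as a sum of products of a coefficient, in the first point, by a monomial in the second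
   one. The slice at [phi] evaluates the monomials at [phi]; the diagonal evaluates them at the
   first point. *)
pose l := [seq (mcoeff k (1 - u), mpolyX R k : S) | k <- msupp (1 - u)].
have -> : diag (1 - u) = \sum_(ab <- l) ab.1 * ab.2 by rewrite dE [RHS]big_map.
apply: diagonal_of_slices => phi Ophi; have [ev [eX eC eE]] := ev_ex phi.
have -> : \sum_(ab <- l) ab.1 * mpolyC N (val phi ab.2) = ev (1 - u) by rewrite eE [LHS]big_map.
have [f Jf fphi] := Jnz phi Ophi.
have ev_snd p : ev (snd_pt p) = mpolyC N (val phi p).
  elim/mpoly_alg_ind: p => [c|i|p p' IHp IHp'|p p' IHp IHp'].
  - by rewrite sC [val phi _]mevalC; exact: eC.
  - by rewrite sX eX [val phi _]mevalXU.
  - by rewrite !rmorphD IHp IHp'.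
  - by rewrite !rmorphM IHp IHp'.
(* With the second point at [phi] in [O], the generators from [I] vanish and those from [J] stay in
   [J]; [f] becomes a nonzero constant. *)
have Jev : J (ev ((1 - u) * snd_pt f)).
  elim: (uJ f Jf) => [|c a b [[p Ip ->]|[p Jp ->]] _ IH]; first by rewrite rmorph0.
    by rewrite rmorphD rmorphM ev_snd [val phi p]Ip// mpolyC0 mulr0 add0r.
  by rewrite rmorphD rmorphM eC; apply: JD => //; exact: JM.
have -> : ev (1 - u) = mpolyC N (val phi f)^-1 * ev ((1 - u) * snd_pt f).
  by rewrite rmorphM ev_snd mulrCA -mpolyCM mulVf ?mpolyC1 ?mulr1//; exact/eqP.
exact: JM.
Qed.
End PoissonIdealOrbit.

(** * The adjoint action of a Lie group in coordinates *)

Section NearDiff.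
Variables (R : realType) (V W : normedModType R).

Lemma near_eq_diff (f g : V -> W) (x : V) : differentiable f x ->
  (\forall y \near x, f y = g y) -> differentiable g x /\ 'd g x = 'd f x :> (V -> W).
Proof.
move=> df fg; have fgx : f x = g x by exact: nbhs_singleton fg.
have E : g \o shift x = cst (g x) + 'd f x +o_ 0 id.
  apply/eqaddoP => eps eps0; have /eqaddoP/(_ _ eps0) := diff_locally df.
  move: fg; rewrite (near_shift 0); apply: filterS2 => y /=; rewrite subr0 => fgy.
  suff -> : (g \o shift x - (cst (g x) + 'd f x)) y = (f \o shift x - (cst (f x) + 'd f x)) y by [].
  by rewrite !fctE /= fgy fgx.
have dE : 'd g x = 'd f x :> (V -> W).
  by apply: diff_unique => //; exact: diff_continuous.
split=> //; apply/diff_locallyP; rewrite dE; split=> //; exact: diff_continuous.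
Qed.
End NearDiff.

Section PairLinear.
Variables (R : pzRingType) (V W : lmodType R).

Lemma pair_linl a (x y : V) : (a *: x + y, 0 : W) = a *: (x, 0) + (y, 0).
Proof. by rewrite -[RHS]/(a *: x + y, a *: 0 + 0) scaler0 addr0. Qed.

Lemma pair_linr a (x y : W) : (0 : V, a *: x + y) = a *: (0, x) + (0, y).
Proof. by rewrite -[RHS]/(a *: 0 + 0, a *: x + y) scaler0 addr0. Qed.
End PairLinear.

Section LieGroupDiff.
Variables (R : realType) (n : nat) (G : lieGroup R n).
Local Notation tau := (chart_to (chart1 G)).
Local Notation sigma := (chart_from (chart1 G)).
Local Notation D := (chart_dom (chart1 G)).
Local Notation U := (chart_img (chart1 G)).
Local Notation u0 := (unit_coord G).
Local Notation rV := 'rV[R]_n.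

Definition mu (u : rV * rV) : rV := tau (sigma u.1 * sigma u.2)%g.
Definition iota_coord (u : rV) : rV := tau ((sigma u)^-1)%g.

Lemma D1 : D 1%g. Proof. exact: chart_at_dom. Qed.

Lemma sigmaK u : U u -> tau (sigma u) = u.
Proof. by move=> [x Dx <-]; rewrite chart_toK. Qed.

Lemma sigmaD u : U u -> D (sigma u).
Proof. by move=> [x Dx <-]; rewrite chart_toK. Qed.

Lemma tauU a : D a -> U (tau a). Proof. by move=> Da; exists a. Qed.

Lemma U_u0 : U u0. Proof. exact/tauU/D1. Qed.

Lemma sigma_u0 : sigma u0 = 1%g. Proof. by rewrite chart_toK//; exact: D1. Qed.

Lemma nbhs_U u : U u -> nbhs u U.
Proof. by move=> Uu; apply: open_nbhs_nbhs; split=> //; exact: chart_img_open. Qed.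

Lemma sigma_cont u : U u -> {for u, continuous sigma}.
Proof. exact: chart_from_continuous. Qed.

Lemma nbhs_D (a : G) : D a -> nbhs a D.
Proof. by move=> Da; apply: open_nbhs_nbhs; split=> //; exact: chart_dom_open. Qed.

Lemma mul_cont (T : topologicalType) (f h : T -> G) x :
  {for x, continuous f} -> {for x, continuous h} -> {for x, continuous (fun y => f y * h y)%g}.
Proof.
move=> cf ch; have := @mulg_continuous G (f x, h x).
move=> /(_ _)/= cm; apply: (@continuous_comp _ _ _ (fun y => (f y, h y)) (fun p : G * G => p.1 * p.2)%g).
  exact: cvg_pair.
exact: mulg_continuous.
Qed.

Lemma inv_cont (T : topologicalType) (f : T -> G) x :
  {for x, continuous f} -> {for x, continuous (fun y => (f y)^-1)%g}.
Proof. by move=> cf; apply: (continuous_comp cf); exact: invg_continuous. Qed.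

Lemma mu_diff u : U u.1 -> U u.2 -> D (sigma u.1 * sigma u.2)%g -> differentiable mu u.
Proof.
move=> U1 U2 D12; have [+ _] := @mulg_smooth _ _ G 1%g 1%g 1%g 1%N.
by apply; split.
Qed.

Lemma Dmu_diff v u : U u.1 -> U u.2 -> D (sigma u.1 * sigma u.2)%g -> differentiable (fun x => 'D_v mu x) u.
Proof.
move=> U1 U2 D12; have [_ +] := @mulg_smooth _ _ G 1%g 1%g 1%g 2%N.
by move=> /(_ v)[+ _]; apply; split.
Qed.

Lemma iota_diff u : U u -> D (sigma u)^-1%g -> differentiable iota_coord u.
Proof.
move=> Uu Du; have [+ _] := @invg_smooth _ _ G 1%g 1%g 1%N.
by apply; split.
Qed.

Definition conj_coord (a : G) (x : rV) : rV := tau (a * sigma x * a^-1)%g.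

Lemma conj_coord_u0 a : conj_coord a u0 = u0.
Proof. by rewrite /conj_coord sigma_u0 mulg1 mulgV. Qed.

Lemma conj_near a : \forall x \near u0, U x /\ D (a * sigma x * a^-1)%g.
Proof.
near=> x; split; near: x; first exact/nbhs_U/U_u0.
have : {for u0, continuous (fun x => a * sigma x * a^-1)%g}.
  apply: mul_cont; last exact: cst_continuous.
  by apply: mul_cont; [exact: cst_continuous|exact/sigma_cont/U_u0].
apply; rewrite /= sigma_u0 mulg1 mulgV; exact/nbhs_D/D1.
Unshelve. all: by end_near. Qed.

(** [a] may lie outside the chart at the unit, so the conjugation is factored through the charts at
    [a] and at its inverse. *)
Lemma conj_diff a : differentiable (conj_coord a) u0.
Proof.
pose ca := chart_at a; pose cb := chart_at (a^-1)%g.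
pose p (x : rV) := chart_to ca (a * sigma x)%g.
have [+ _] := @mulg_smooth _ _ G a 1%g a 1%N.
move=> /(_ (chart_to ca a, u0)) /= d1.
have aK : chart_from ca (chart_to ca a) = a by apply: chart_toK; exact: chart_at_dom.
have bK : chart_from cb (chart_to cb (a^-1)%g) = (a^-1)%g by apply: chart_toK; exact: chart_at_dom.
have dp : differentiable p u0.
  have -> : p = (chart_to ca \o (fun u : rV * rV => (chart_from ca u.1 * sigma u.2)%g)) \o (fun x => (chart_to ca a, x)).
    by apply/funext => x; rewrite /p /= aK.
  apply: differentiable_comp; first exact: differentiable_pair.
  apply: d1; split=> /=.
  - by exists a => //; exact: chart_at_dom.
  - exact: U_u0.
  - by rewrite aK sigma_u0 mulg1; exact: chart_at_dom.
have pu0 : p u0 = chart_to ca a by rewrite /p sigma_u0 mulg1.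
have [+ _] := @mulg_smooth _ _ G a (a^-1)%g 1%g 1%N.
move=> /(_ (chart_to ca a, chart_to cb (a^-1)%g)) /= d2.
pose m2 := (tau \o (fun u : rV * rV => (chart_from ca u.1 * chart_from cb u.2)%g)).
have dm2 : differentiable (m2 \o (fun x => (p x, chart_to cb (a^-1)%g))) u0.
  apply: differentiable_comp; first exact: differentiable_pair.
  rewrite pu0; apply: d2; split=> /=.
  - by exists a => //; exact: chart_at_dom.
  - by exists (a^-1)%g => //; exact: chart_at_dom.
  - by rewrite aK bK mulgV; exact: D1.
suff near_m2 : \forall x \near u0, (m2 \o (fun x => (p x, chart_to cb (a^-1)%g))) x = conj_coord a x.
  by have [] := near_eq_diff dm2 near_m2.
have cont : {for u0, continuous (fun x => a * sigma x)%g}.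
  by apply: mul_cont; [exact: cst_continuous|exact/sigma_cont/U_u0].
have near_ca : \forall x \near u0, chart_dom ca (a * sigma x)%g.
  apply: cont; rewrite /= sigma_u0 mulg1; apply: open_nbhs_nbhs; split.
    exact: chart_dom_open.
  exact: chart_at_dom.
apply: filterS near_ca => x Dx; rewrite /m2 /p /= bK /conj_coord.
by rewrite chart_toK.
Qed.

Definition gAd (a : G) (w : rV) : rV := 'd (conj_coord a) u0 w.

Lemma group_AdE a w : group_Ad (G := G) a w = gAd a w.
Proof. by rewrite /group_Ad lfunE. Qed.

Lemma gAdM a b w : gAd (a * b)%g w = gAd a (gAd b w).
Proof.
have db := conj_diff b; have da := conj_diff a.
have dab : differentiable (conj_coord a \o conj_coord b) u0.
  by apply: differentiable_comp; [exact: db|rewrite conj_coord_u0; exact: da].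
have near_ab : \forall x \near u0, (conj_coord a \o conj_coord b) x = conj_coord (a * b)%g x.
  apply: filterS (conj_near b) => x [Ux Dx].
  by rewrite /= /conj_coord chart_toK// invgM !mulgA.
have [_ E] := near_eq_diff dab near_ab.
apply: etrans (congr1 (fun h => h w) E) _.
have da' : differentiable (conj_coord a) (conj_coord b u0) by rewrite conj_coord_u0; exact: da.
apply: etrans (congr1 (fun h => h w) (diff_comp db da')) _.
exact: (congr1 (fun p => 'd (conj_coord a) p (gAd b w)) (conj_coord_u0 b)).
Qed.

Lemma gAd1 w : gAd 1%g w = w.
Proof.
have near1 : \forall x \near u0, id x = conj_coord 1%g x.
  apply: filterS (conj_near 1%g) => x [Ux Dx].
  by rewrite /conj_coord mul1g invg1 mulg1 sigmaK.
have did : differentiable (@id rV) u0 by [].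
have [_ E] := near_eq_diff did near1.
apply: etrans (congr1 (fun h => h w) E) _.
have Eid : 'd (@id rV) u0 = id :> (rV -> rV) by exact: diff_val.
exact: (congr1 (fun h => h w) Eid).
Qed.

Lemma inv_near : \forall u \near u0, U u /\ D ((sigma u)^-1)%g.
Proof.
near=> x; split; near: x; first exact/nbhs_U/U_u0.
have cont : {for u0, continuous (fun x => (sigma x)^-1)%g}.
  by apply: inv_cont; exact/sigma_cont/U_u0.
by apply: cont; rewrite /= sigma_u0 invg1; exact/nbhs_D/D1.
Unshelve. all: by end_near. Qed.

Lemma iota_U u : D ((sigma u)^-1)%g -> U (iota_coord u).
Proof. exact: tauU. Qed.

Lemma sigma_iota u : D ((sigma u)^-1)%g -> sigma (iota_coord u) = ((sigma u)^-1)%g.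
Proof. by move=> Du; rewrite /iota_coord chart_toK. Qed.

Lemma iota_u0 : iota_coord u0 = u0.
Proof. by rewrite /iota_coord sigma_u0 invg1. Qed.

Lemma mu_iota u : U u -> D ((sigma u)^-1)%g -> differentiable mu (u, iota_coord u).
Proof.
move=> Uu Du; apply: mu_diff => //=; first exact: iota_U.
by rewrite sigma_iota// mulgV; exact: D1.
Qed.

Lemma iota_mu u : U u -> D ((sigma u)^-1)%g -> differentiable mu (iota_coord u, u).
Proof.
move=> Uu Du; apply: mu_diff => //=; first exact: iota_U.
by rewrite sigma_iota// mulVg; exact: D1.
Qed.

Lemma mu_u0 u : U u -> differentiable mu (u, u0).
Proof.
move=> Uu; apply: mu_diff => //=; first exact: U_u0.
by rewrite sigma_u0 mulg1; exact: sigmaD.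
Qed.

Lemma diff_sum_coord (W : normedModType R) (h : {linear rV -> W}) (z : rV) :
  h z = \sum_j z 0 j *: h (delta_mx 0 j).
Proof.
rewrite {1}[z]row_sum_delta linear_sum; apply: eq_bigr => j _.
by rewrite linearZ.
Qed.

(** Near the unit, the conjugation by [sigma u] is [mu (mu (u, x), iota_coord u)]. Its differential
    is written with directional derivatives of [mu], since it is for these that smoothness yields
    differentiability in [u]. *)
Lemma gAd_coord w u : U u -> D ((sigma u)^-1)%g ->
  gAd (sigma u) w = \sum_j ('D_(0, w) mu (u, u0)) 0 j *: 'D_(delta_mx 0 j, 0) mu (u, iota_coord u).
Proof.
move=> Uu Du; pose f1 (x : rV) := (u, x).
have d1 : is_diff u0 f1 (fun w => (0, w)) by exact: is_diff_pair.
have d2 : is_diff u0 (mu \o f1) ('d mu (u, u0) \o (fun w => (0, w))).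
  by apply: is_diff_comp; apply: differentiableP; exact: mu_u0.
pose f3 x := ((mu \o f1) x, iota_coord u).
have d3 : is_diff u0 f3 (fun w => ('d mu (u, u0) (0, w), 0)) by exact: is_diff_pair.
have f3u0 : f3 u0 = (u, iota_coord u) by rewrite /f3 /f1 /= /mu /= sigma_u0 mulg1 sigmaK.
have d4 : is_diff u0 (mu \o f3) ('d mu (u, iota_coord u) \o (fun w => ('d mu (u, u0) (0, w), 0))).
  apply: is_diff_comp; rewrite f3u0; apply: differentiableP; exact: mu_iota.
have cont : {for u0, continuous (fun x => sigma u * sigma x)%g}.
  by apply: mul_cont; [exact: cst_continuous|exact/sigma_cont/U_u0].
have near_D : \forall x \near u0, D (sigma u * sigma x)%g.
  by apply: cont; rewrite /= sigma_u0 mulg1; exact/nbhs_D/sigmaD.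
have near4 : \forall x \near u0, (mu \o f3) x = conj_coord (sigma u) x.
  apply: filterS near_D => x Dx.
  by rewrite /= /mu /f3 /f1 /= /mu /= sigma_iota// chart_toK.
case: d4 => d4 d4v; have [_ E] := near_eq_diff d4 near4.
rewrite /gAd; apply: etrans (congr1 (fun h => h w) E) _.
apply: etrans (congr1 (fun h => h w) d4v) _ => /=.
pose L : rV -> rV := fun z => 'd mu (u, iota_coord u) (z, 0).
have linL : linear L.
  by move=> a x y; rewrite /L pair_linl linearP.
pose L' : {linear rV -> rV} := HB.pack L (GRing.isLinear.Build _ _ _ _ _ linL).
rewrite -[LHS]/(L' _) diff_sum_coord; apply: eq_bigr => j _.
have E1 := deriveE (0, w) (mu_u0 Uu).
have E2 := deriveE (delta_mx 0 j, 0) (mu_iota Uu Du).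
by apply: etrans (congr1 (fun z : rV => z 0 j *: _) (esym E1)) (congr1 ( *:%R _) (esym E2)).
Qed.

End LieGroupDiff.

Section LieGroupBracket.
Variables (R : realType) (n : nat) (G : lieGroup R n).
Local Notation tau := (chart_to (chart1 G)).
Local Notation sigma := (chart_from (chart1 G)).
Local Notation D := (chart_dom (chart1 G)).
Local Notation U := (chart_img (chart1 G)).
Local Notation u0 := (unit_coord G).
Local Notation rV := 'rV[R]_n.
Local Notation mu := (@mu R n G).
Local Notation iota_coord := (@iota_coord R n G).

Lemma iota_diff_u0 : differentiable iota_coord u0.
Proof.
apply: iota_diff; first exact: U_u0.
by rewrite sigma_u0 invg1; exact: D1.
Qed.

Lemma Dmu_diff_u0 v : differentiable (fun x => 'D_v mu x) (u0, u0).
Proof.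
apply: Dmu_diff => /=; [exact: U_u0|exact: U_u0|].
by rewrite sigma_u0 mulg1; exact: D1.
Qed.

Lemma coord_diff (V : normedModType R) (f : V -> rV) (x : V) k :
  differentiable f x -> differentiable (fun y => f y 0 k : R) x.
Proof.
move=> df; apply: (@differentiable_comp _ _ _ _ f (fun M : rV => M 0 k)) => //.
exact: differentiable_coord.
Qed.

Lemma gAd_coord_diff w k : differentiable (fun u => gAd (sigma u) w 0 k : R) u0.
Proof.
pose h u := \sum_j ('D_(0, w) mu (u, u0)) 0 j * ('D_(delta_mx 0 j, 0) mu (u, iota_coord u)) 0 k.
have dh : differentiable (h : rV -> R) u0.
  have -> : h = \sum_j (fun u => ('D_(0, w) mu (u, u0)) 0 j * ('D_(delta_mx 0 j, 0) mu (u, iota_coord u)) 0 k).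
    by apply/funext => u; rewrite fct_sumE.
  apply: differentiable_sum => j; apply: differentiableM; apply: coord_diff.
    apply: (@differentiable_comp _ _ _ _ (fun u => (u, u0)) (fun x => 'D_(0, w) mu x)).
      exact: differentiable_pair.
    exact: Dmu_diff_u0.
  apply: (@differentiable_comp _ _ _ _ (fun u => (u, iota_coord u)) (fun x => 'D_(delta_mx 0 j, 0) mu x)).
    by apply: differentiable_pair => //; exact: iota_diff_u0.
  by rewrite iota_u0; exact: Dmu_diff_u0.
have near_h : \forall u \near u0, h u = gAd (sigma u) w 0 k.
  apply: filterS (inv_near G) => u [Uu Du]; rewrite gAd_coord// summxE.
  by apply: eq_bigr => j _; rewrite mxE.
by have [] := near_eq_diff dh near_h.
Qed.

Lemma group_bracketE v w k : group_bracket G v w 0 k = 'D_v (fun u => gAd (sigma u) w 0 k : R) u0.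
Proof.
rewrite /group_bracket.
have -> : (fun u => group_Ad (sigma u) w) = (fun u => gAd (sigma u) w).
  by apply/funext => u; exact: group_AdE.
rewrite derive_mx ?mxE//; apply/derivable_mxP => i j; rewrite (ord1 i).
exact/diff_derivable/gAd_coord_diff.
Qed.

Lemma gAd_curve (gamma : R -> rV) t0 w k : differentiable gamma t0 -> gamma t0 = u0 ->
  is_derive t0 (1 : R) (fun t => gAd (sigma (gamma t)) w 0 k : R)
    (group_bracket G ('d gamma t0 1) w 0 k).
Proof.
move=> dg g0; have dA := gAd_coord_diff w k.
rewrite -g0 in dA; have dc := differentiable_comp dg dA.
apply: DeriveDef; first exact: diff_derivable.
rewrite deriveE//; apply: etrans (congr1 (fun h => h 1) (diff_comp dg dA)) _.
rewrite /= group_bracketE -g0; apply/esym; exact: deriveE.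
Qed.
End LieGroupBracket.

Section MevalDerive.
Variables (R : realType) (N : nat).

Lemma is_derive_meval (x : 'I_N -> R -> R) (dx : 'I_N -> R) (t : R) (f : mpoly N R) :
  (forall j, is_derive t (1 : R) (x j) (dx j)) ->
  is_derive t (1 : R) (fun s => meval (fun j => x j s) f : R)
    (\sum_j meval (fun j => x j t) (mderiv j f) * dx j).
Proof.
move=> dxP; elim/mpoly_alg_ind: f => [c|i|f f' IHf IHf'|f f' IHf IHf'].
- have -> : (fun s => meval (fun j => x j s) (mpolyC N c)) = cst c.
    by apply/funext => s; rewrite mevalC.
  rewrite big1 => [|j _]; last by rewrite mderivC meval0 mul0r.
  exact: is_derive_cst.
- have -> : (fun s => meval (fun j => x j s) (mpolyX R (mnm1 i))) = x i.
    by apply/funext => s; rewrite mevalXU.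
  rewrite (bigD1 i)//= mderivXU eqxx meval1 mul1r big1 ?addr0// => j /negPf ji.
  by rewrite mderivXU eq_sym ji meval0 mul0r.
- have -> : (fun s => meval (fun j => x j s) (f + f')) =
     (fun s => meval (fun j => x j s) f) + (fun s => meval (fun j => x j s) f').
    by apply/funext => s; rewrite mevalD.
  apply: (is_derive_eq (is_deriveD IHf IHf')); rewrite -big_split; apply: eq_bigr => j _ /=.
  by rewrite mderivD mevalD mulrDl.
- have -> : (fun s => meval (fun j => x j s) (f * f')) =
     (fun s => meval (fun j => x j s) f) * (fun s => meval (fun j => x j s) f').
    by apply/funext => s; rewrite mevalM.
  apply: (is_derive_eq (is_deriveM IHf IHf')); rewrite !scaler_sumr -big_split.
  apply: eq_bigr => j _ /=; rewrite mderivM mevalD !mevalM /GRing.scale /=.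
  by ring.
Qed.
End MevalDerive.

(** * Curves on coadjoint orbits and Hamiltonian vector fields *)

Section CoadjointCurves.
Variables (R : realType) (g : lieAlgebra R) (n : nat) (G : lieGroup R n).
Variable theta : lieGroupAlgebra g G.
Local Notation sigma := (chart_from (chart1 G)).
Local Notation u0 := (unit_coord G).
Local Notation rV := 'rV[R]_n.
Local Notation N := (\dim {:g}).
Local Notation e := (vbasis {:g}).
Local Notation T := (lie_tangent theta).
Local Notation Ad := (Ad theta).

Lemma tangentK (x : g) : (T^-1)%VF (T x) = x.
Proof. by apply: lker0_lfunK; rewrite lie_tangent_inj. Qed.

Lemma tangentVK v : T ((T^-1)%VF v) = v.
Proof. by apply: limg_lfunVK; rewrite lie_tangent_surj memvf. Qed.

Lemma AdE a x : Ad a x = (T^-1)%VF (gAd a (T x)).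
Proof. by rewrite /Ad !comp_lfunE group_AdE. Qed.

Lemma AdM a b x : Ad (a * b)%g x = Ad a (Ad b x).
Proof.
have TAd : T (Ad b x) = gAd b (T x) by exact: etrans (congr1 T (AdE b x)) (tangentVK _).
apply: etrans (AdE _ _) _; apply: etrans _ (esym (AdE _ _)).
by rewrite TAd gAdM.
Qed.

Lemma Ad1 x : Ad 1%g x = x.
Proof. by apply: etrans (AdE _ _) _; rewrite gAd1 tangentK. Qed.

Lemma sym_eval_ham_field l (f : mpoly N R) (psi : lie_dual g) :
  sym_eval (ham_field (g := g) l f) psi = \sum_j sym_eval (mderiv j f) psi * psi (lie e`_l e`_j).
Proof.
rewrite /ham_field /vfield [LHS](rmorph_sum (meval _)); apply: eq_bigr => j _.
rewrite [LHS](rmorphM (meval _)) mulrC; congr (_ * _).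
by rewrite !mxE -[LHS]/(sym_eval (sym_of _) psi) sym_eval_of.
Qed.

(** The link between the group and the Poisson structure: the differential of [Ad] at the unit is
    the bracket. As [gamma] is any curve through the unit, straight lines in the chart can replace
    one-parameter subgroups. *)
Lemma sym_eval_curve (gamma : R -> rV) t0 (psi : lie_dual g) (f : mpoly N R) h :
  differentiable gamma t0 -> gamma t0 = u0 -> T h = 'd gamma t0 1 ->
  is_derive t0 (1 : R) (fun t => sym_eval f (psi \o Ad (sigma (gamma t)))%VF : R)
    (\sum_l coord e l h * sym_eval (ham_field (g := g) l f) psi).
Proof.
move=> dg g0 Th.
pose c k := psi ((T^-1)%VF (delta_mx 0 k)).
have psiE v : psi ((T^-1)%VF v) = \sum_k v 0 k * c k.
  rewrite {1}[v]row_sum_delta !linear_sum; apply: eq_bigr => k _.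
  by rewrite !linearZ.
pose x j t := (psi \o Ad (sigma (gamma t)))%VF e`_j : R.
have xE j t : x j t = \sum_k gAd (sigma (gamma t)) (T e`_j) 0 k * c k.
  by rewrite /x comp_lfunE (AdE (sigma (gamma t)) e`_j) psiE.
have dx j : is_derive t0 (1 : R) (x j) (psi (lie h e`_j)).
  have -> : x j = \sum_k (fun t => gAd (sigma (gamma t)) (T e`_j) 0 k * c k).
    by apply/funext => t; rewrite fct_sumE xE.
  have dk k : is_derive t0 (1 : R) (fun t => gAd (sigma (gamma t)) (T e`_j) 0 k * c k)
      (group_bracket G (T h) (T e`_j) 0 k * c k).
    have := gAd_curve (T e`_j) k dg g0; rewrite -Th => dA.
    have -> : (fun t => gAd (sigma (gamma t)) (T e`_j) 0 k * c k) =
      c k *: (fun t => gAd (sigma (gamma t)) (T e`_j) 0 k).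
      by apply/funext => t; rewrite mulrC.
    by apply: (is_derive_eq (is_deriveZ (c k) dA)); rewrite mulrC.
  apply: (is_derive_eq (is_derive_sum dk)).
  by rewrite -psiE -lie_tangent_bracket tangentK.
have := is_derive_meval f dx.
have -> : (fun t => sym_eval f (psi \o Ad (sigma (gamma t)))%VF) =
  (fun s => meval (fun j => x j s) f) by [].
move=> d; apply: (is_derive_eq d).
have psi0 j : x j t0 = psi e`_j by rewrite /x comp_lfunE g0 sigma_u0 Ad1.
under eq_bigr => j _.
  rewrite (_ : meval _ _ = sym_eval (mderiv j f) psi); last first.
    by apply: meval_eq => i; rewrite psi0.
  rewrite [X in lie X _](coord_vbasis (memvf h)) lie_suml linear_sum mulr_sumr.
  over.
rewrite exchange_big; apply: eq_bigr => l _ /=.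
rewrite sym_eval_ham_field mulr_sumr; apply: eq_bigr => j _.
by rewrite lieZl linearZ mulrCA.
Qed.

Lemma coAdE a phi x : coAd theta a phi x = phi (Ad (a^-1)%g x).
Proof. exact: comp_lfunE. Qed.

Lemma coAd_comp a b phi : (coAd theta a phi \o Ad b)%VF = coAd theta (b^-1 * a)%g phi.
Proof.
apply/lfunP => x; apply: etrans (comp_lfunE _ _ _) _.
apply: etrans (coAdE _ _ _) _; apply: etrans _ (esym (coAdE _ _ _)).
congr (phi _); apply: etrans (esym (AdM _ _ _)) _.
by rewrite invgM invgK.
Qed.

(** [f] is zero along a curve of the orbit that leaves the point in the direction of the [l]-th
    basis vector, and its derivative there is the Hamiltonian one. *)
Lemma orbit_vanishing_ham_field (phi : lie_dual g) (f : mpoly N R) l :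
  (forall a, sym_eval f (coAd theta a phi) = 0) ->
  forall a, sym_eval (ham_field (g := g) l f) (coAd theta a phi) = 0.
Proof.
move=> f0 a; pose psi := coAd theta a phi.
have fb b : sym_eval f (psi \o Ad b)%VF = 0.
  have -> : (psi \o Ad b)%VF = coAd theta (b^-1 * a)%g phi by exact: coAd_comp.
  exact: f0.
pose gamma (t : R) : rV := u0 + t *: T e`_l.
have dgam : is_diff (0 : R) gamma (fun t => t *: T e`_l).
  apply: is_diff_eq.
  by apply/funext => t; rewrite /= add0r.
case: dgam => dg dgv.
have g0 : gamma 0 = u0 by rewrite /gamma scale0r addr0.
have Th : T e`_l = 'd gamma (0 : R) 1 by rewrite dgv scale1r.
have := sym_eval_curve psi f dg g0 Th.
have -> : (fun t => sym_eval f (psi \o Ad (sigma (gamma t)))%VF) = cst 0.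
  by apply/funext => t; rewrite fb.
move=> d; have := @derive_val _ _ _ _ _ _ _ d; rewrite derive_cst => /esym.
rewrite (bigD1 l)//= coord_free ?eqxx ?mul1r ?(basis_free (vbasisP _))//.
rewrite big1 ?addr0// => k /negPf kl.
by rewrite coord_free ?(basis_free (vbasisP _))// eq_sym kl mul0r.
Qed.
End CoadjointCurves.

(** * Propagation of zeros along an orbit *)

Lemma amgm2 (R : realType) (x y : R) : x * y <= (x * x + y * y) / 2.
Proof. by have := sqr_ge0 (x - y); nra. Qed.

Section LinearODE.
Variables (R : realType) (r : nat) (F : 'I_r -> R -> R) (M : R -> 'I_r -> 'I_r -> R) (B : R).

(* Gronwall's argument: the energy [sum_i F_i ^ 2] grows at most exponentially. *)
Lemma linear_ode_zero :
  (forall t : R, 0 <= t <= 1 -> forall i, is_derive t (1 : R) (F i) (\sum_k M t i k * F k t)) ->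
  (forall t : R, 0 <= t <= 1 -> forall i k, `|M t i k| <= B) ->
  (forall i, F i 0 = 0) -> forall i, F i 1 = 0.
Proof.
move=> dF MB F0; pose E : R -> R := \sum_i (fun t => F i t * F i t).
(* From [2 F_i F_k <= F_i ^ 2 + F_k ^ 2], summed over the pairs of indices, for both halves of the
   derivative of the energy. *)
pose K : R := 2 * r%:R * B.
pose dE t : R := \sum_i (F i t * (\sum_k M t i k * F k t) + F i t * (\sum_k M t i k * F k t)).
have EE t : E t = \sum_i F i t * F i t by rewrite /E fct_sumE.
have E_der (t : R) : 0 <= t <= 1 -> is_derive t (1 : R) E (dE t).
  by move=> t01; apply: is_derive_sum => i; apply: is_deriveM; exact: dF.
have B0 (i : 'I_r) : 0 <= B.
  by apply: le_trans (normr_ge0 _) (MB 0 _ i i); rewrite lexx ler01.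
have dbl (a : 'I_r -> R) : \sum_(i < r) \sum_(k < r) B * (a i + a k) / 2 = r%:R * B * \sum_i a i.
  transitivity (\sum_(i < r) (r%:R * (B / 2 * a i) + B / 2 * \sum_k a k)).
    apply: eq_bigr => i _; rewrite mulr_sumr mulr_natl.
    rewrite (eq_bigr (fun k => B / 2 * a i + B / 2 * a k)) => [|k _]; last by field.
    by rewrite big_split /= sumr_const card_ord.
  rewrite big_split /= -!mulr_sumr sumr_const card_ord -mulr_natl.
  by field.
have dE_le (t : R) : 0 <= t <= 1 -> dE t <= K * E t.
  move=> t01; rewrite EE /dE.
  have le_i i : F i t * (\sum_k M t i k * F k t) <= \sum_k B * (F i t * F i t + F k t * F k t) / 2.
    rewrite mulr_sumr; apply: ler_sum => k _.
    apply: le_trans (ler_norm _) _; rewrite !normrM mulrCA.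
    have sq x : x * x = `|x| * `|x| :> R by rewrite -normrM ger0_norm// -expr2 sqr_ge0.
    rewrite (sq (F i t)) (sq (F k t)) -mulrA; have := MB t t01 i k.
    move: (normr_ge0 (F i t)) (normr_ge0 (F k t)) => x0 y0 mB.
    apply: (@le_trans _ _ (B * (`|F i t| * `|F k t|))).
      by apply: ler_wpM2r => //; exact: mulr_ge0.
    apply: ler_wpM2l; first exact: B0 i.
    exact: amgm2.
  have -> : K * \sum_i F i t * F i t = \sum_(i < r) (\sum_(k < r) B * (F i t * F i t + F k t * F k t) / 2 + \sum_(k < r) B * (F i t * F i t + F k t * F k t) / 2).
    by rewrite big_split /= (dbl (fun i => F i t * F i t)) /K; ring.
  by apply: ler_sum => i _; apply: lerD.
pose phi : R -> R := E * (fun t => expR (- K * t)).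
have phi_der (t : R) : 0 <= t <= 1 -> is_derive t (1 : R) phi ((dE t - K * E t) * expR (- K * t)).
  move=> t01; have dexp : is_derive t (1 : R) (fun t => expR (- K * t)) (expR (- K * t) * - K).
    have dlin : is_derive t (1 : R) (fun t : R => - K * t) (- K).
      by apply: (is_derive_eq (is_deriveZ (- K) (is_derive_id t 1))); rewrite /GRing.scale /= mulr1.
    exact: (is_derive1_comp (is_derive_expR _) dlin).
  apply: (is_derive_eq (is_deriveM (E_der t t01) dexp)); rewrite /GRing.scale /=.
  by ring.
have phi_le : phi 1 <= phi 0.
  have phi_drv (t : R) : t \in `]0, 1[ -> derivable phi t 1.
    rewrite in_itv /= => /andP[t0 t1]; have t01 : 0 <= t <= 1 by rewrite !ltW.
    by have [] := phi_der t t01.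
  apply: (@ler0_derive1_le_cc _ phi 0 1) => //; [|..].
  - move=> t; rewrite in_itv /= => /andP[t0 t1]; have t01 : 0 <= t <= 1 by rewrite !ltW.
    rewrite derive1E (@derive_val _ _ _ _ _ _ _ (phi_der t t01)).
    by rewrite pmulr_lle0 ?expR_gt0// subr_le0 dE_le.
  - apply: derivable_within_continuous => t; rewrite in_itv /= => t01.
    by have [] := phi_der t t01.
  - by rewrite in_itv /= lexx ler01.
  - by rewrite in_itv /= lexx ler01.
have E1 : E 1 <= 0.
  move: phi_le; rewrite /phi !fctE EE EE.
  under [X in _ <= X * _]eq_bigr => i _ do rewrite F0 mul0r.
  rewrite big1_eq mul0r pmulr_lle0 ?expR_gt0//.
move=> i; have := E1; rewrite EE => E1'.
have ge0 j : true -> 0 <= F j 1 * F j 1 by rewrite -expr2 sqr_ge0.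
have E10 : \sum_j F j 1 * F j 1 = 0 by apply/eqP; rewrite eq_le E1' sumr_ge0.
have /eqP : F i 1 * F i 1 = 0 by exact: (psumr_eq0P ge0 E10).
by rewrite mulf_eq0 orbb => /eqP.
Qed.
End LinearODE.

(** A matrix of largest rank with row space inside [P]. It gives a spanning family to a subspace
    known only by a predicate. *)
Lemma max_subspace (F : fieldType) r (P : 'rV[F]_r -> Prop) :
  P 0 -> (forall c u v, P u -> P v -> P (c *: u + v)) ->
  exists A : 'M[F]_r, forall v, P v <-> (v <= A)%MS.
Proof.
move=> P0 PL; pose Q k := `[< exists2 A : 'M[F]_r, \rank A = k & forall v, (v <= A)%MS -> P v >].
have exQ : exists k, Q k.
  exists 0%N; apply/asboolP; exists 0; first by rewrite mxrank0.
  by move=> v; rewrite submx0 => /eqP ->.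
have Qle k : Q k -> (k <= r)%N by move=> /asboolP[A <- _]; exact: rank_leq_row.
case: (ex_maxnP exQ Qle) => _ /asboolP[A <- PA] Amax.
exists A => v; split=> [Pv|]; last exact: PA.
suff : (\rank (A + v)%MS <= \rank A)%N.
  rewrite (geq_leqif (mxrank_leqif_sup (addsmxSl A v))) => AvA.
  exact: submx_trans (addsmxSr A v) AvA.
apply: Amax; apply/asboolP; exists (A + v)%MS => // u /sub_addsmxP[[a b] /= ->].
rewrite addrC [b]mx11_scalar mul_scalar_mx; apply: PL => //; apply: PA.
exact: submxMl.
Qed.

(** * Finite-dimensional spaces stable under Hamiltonian fields *)

Section LocallyFinite.
Variables (F : fieldType) (g : lieAlgebra F).
Local Notation N := (\dim {:g}).
Local Notation S := (mpoly N F).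
Local Notation ham_field := (ham_field (g := g)).

Lemma ham_fieldZ l c (p : S) : ham_field l (c *: p) = c *: ham_field l p.
Proof. by rewrite -!mul_mpolyC /ham_field vfieldM vfieldC mul0r add0r. Qed.

Lemma ham_field_comb l (I : finType) (c : I -> F) (s : I -> S) :
  ham_field l (\sum_i c i *: s i) = \sum_i c i *: ham_field l (s i).
Proof. by rewrite /ham_field vfield_sum; apply: eq_bigr => i _; exact: ham_fieldZ. Qed.

(* The Hamiltonian vector fields of linear functions do not increase degrees. *)
Lemma ham_field_locally_finite (f : S) : exists (I : finType) (s : I -> S) (c : I -> F)
    (A : 'I_N -> I -> I -> F),
  f = \sum_i c i *: s i /\ forall l i, ham_field l (s i) = \sum_j A l i j *: s j.
Proof.
elim/mpoly_alg_ind: f => [c|i|_ _ [I [s [c [A [-> sA]]]]] [I' [s' [c' [A' [-> sA']]]]]|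
    _ _ [I [s [c [A [-> sA]]]]] [I' [s' [c' [A' [-> sA']]]]]].
- exists 'I_1, (fun=> 1), (fun=> c), (fun _ _ _ => 0).
  rewrite big_ord1; split=> [|l i]; first by rewrite -mul_mpolyC mulr1.
  by rewrite big_ord1 scale0r /ham_field -mpolyC1 vfieldC.
- exists 'I_N, (fun i => mpolyX F (mnm1 i)), (fun j => (i == j)%:R),
    (fun l i j : 'I_N => coord (vbasis {:g}) j (lie (vbasis {:g})`_l (vbasis {:g})`_i)).
  split=> [|l k].
    by rewrite (bigD1 i)//= eqxx scale1r big1 ?addr0// => k /negPf ki; rewrite eq_sym ki scale0r.
  by rewrite /ham_field vfieldX !mxE.
- exists (I + I')%type, (fun k => match k with inl i => s i | inr i => s' i end),
    (fun k => match k with inl i => c i | inr i => c' i end),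
    (fun l k k' => match k, k' with inl i, inl j => A l i j | inr i, inr j => A' l i j | _, _ => 0 end).
  split=> [|l [i|i]]; rewrite big_sumType //= ?sA ?sA'.
    by rewrite [X in _ + X]big1 ?addr0// => j _; rewrite scale0r.
  by rewrite [X in X + _]big1 ?add0r// => j _; rewrite scale0r.
- exists (I * I')%type, (fun k => s k.1 * s' k.2), (fun k => c k.1 * c' k.2),
    (fun l k k' => A l k.1 k'.1 * (k.2 == k'.2)%:R + (k.1 == k'.1)%:R * A' l k.2 k'.2).
  have pairE (a : I -> F) (a' : I' -> F) :
      (\sum_i a i *: s i) * (\sum_i a' i *: s' i) = \sum_k (a k.1 * a' k.2) *: (s k.1 * s' k.2).
    rewrite mulr_suml -(pair_bigA _ (fun i j => (a i * a' j) *: (s i * s' j))); apply: eq_bigr => i _ /=.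
    rewrite mulr_sumr; apply: eq_bigr => j _.
    by rewrite -scalerAr -scalerAl scalerA mulrC.
  have oneE (K : finType) (t : K -> S) i : t i = \sum_j (i == j)%:R *: t j.
    by rewrite (bigD1 i)//= eqxx scale1r big1 ?addr0// => k /negPf ki; rewrite eq_sym ki scale0r.
  split=> [|l [i i'] /=]; first exact: pairE.
  rewrite {1}/ham_field vfieldM -/(ham_field l _) -/(ham_field l _) sA sA' [s i]oneE [s' i']oneE !pairE.
  by rewrite -big_split; apply: eq_bigr => k _ /=; rewrite scalerDl.
Qed.

(** Provides the closed linear system for the differential equation, inside [W]. The [s i] may be
    linearly dependent, so the subspace is taken among the coefficient vectors [v] with [comb v] in
    [W]. *)
Lemma ham_field_stable_finite (W : S -> Prop) f :
  W 0 -> (forall c p q, W p -> W q -> W (c *: p + q)) -> (forall l p, W p -> W (ham_field l p)) -> W f ->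
  exists r (w : 'I_r -> S) (c : 'I_r -> F) (D : 'I_N -> 'I_r -> 'I_r -> F),
  [/\ forall k, W (w k), f = \sum_k c k *: w k & forall l k, ham_field l (w k) = \sum_j D l k j *: w j].
Proof.
move=> W0 WL Wth Wf; have [I [s [c [A [fE sA]]]]] := ham_field_locally_finite f.
pose r := #|I|; pose t (i : 'I_r) := s (enum_val i).
pose comb (v : 'rV[F]_r) := \sum_i v 0 i *: t i.
have enumE (a : I -> F) : \sum_i a i *: s i = comb (\row_i a (enum_val i)).
  rewrite (reindex (enum_val (A := I))) /=; last exact/onW_bij/enum_val_bij.
  by apply: eq_bigr => i _; rewrite mxE.
have combL a u v : comb (a *: u + v) = a *: comb u + comb v.
  by rewrite scaler_sumr -big_split; apply: eq_bigr => i _; rewrite !mxE scalerDl scalerA.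
have [|a u v Wu Wv|B BP] := @max_subspace F r (fun v => W (comb v)).
- by rewrite /comb big1// => i _; rewrite mxE scale0r.
- by rewrite combL; exact: WL.
have combM (v : 'rV_r) : comb (v *m B) = \sum_k v 0 k *: comb (row k B).
  rewrite /comb; under [RHS]eq_bigr do rewrite scaler_sumr.
  rewrite exchange_big; apply: eq_bigr => i _ /=.
  by rewrite mxE scaler_suml; apply: eq_bigr => k _; rewrite scalerA mxE.
have inB p : W p -> (exists v, p = comb v) -> exists v : 'rV[F]_r, p = \sum_k v 0 k *: comb (row k B).
  by move=> Wp [v pE]; move: Wp; rewrite pE => /BP/submxP[u ->]; exists u; rewrite combM.
have Ww k : W (comb (row k B)) by apply/BP; exact: row_sub.
have [|u fu] := inB f Wf; first by exists (\row_i c (enum_val i)); rewrite fE enumE.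
have thE l k : exists v : 'rV_r, ham_field l (comb (row k B)) = \sum_k v 0 k *: comb (row k B).
  apply: inB; first exact/Wth/Ww.
  exists (row k B *m \matrix_(i, j) A l (enum_val i) (enum_val j)).
  rewrite /comb ham_field_comb; under eq_bigr do rewrite sA enumE /comb scaler_sumr.
  rewrite exchange_big; apply: eq_bigr => j _ /=.
  rewrite mxE scaler_suml; apply: eq_bigr => i _.
  by rewrite scalerA !mxE.
have /choice[D DE] : forall lk : 'I_N * 'I_r, exists v : 'rV_r,
  ham_field lk.1 (comb (row lk.2 B)) = \sum_k v 0 k *: comb (row k B) by move=> [l k]; exact: thE.
exists r, (fun k => comb (row k B)), (fun k => u 0 k), (fun l k j => D (l, k) 0 j).
by split=> // l k; exact: (DE (l, k)).
Qed.
End LocallyFinite.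

Lemma ler_sum_term (R : numDomainType) (I : finType) (F : I -> R) i :
  (forall j, 0 <= F j) -> F i <= \sum_j F j.
Proof. by move=> F0; rewrite (bigD1 i)//= lerDl sumr_ge0. Qed.

Lemma connected_locally_constant (T : topologicalType) (Z : set T) :
  connected [set: T] -> Z !=set0 ->
  (forall a, \forall a' \near a, (Z a -> Z a') /\ (Z a' -> Z a)) -> Z = [set: T].
Proof.
move=> conn Z0 nearZ; apply: conn => //.
- exists Z; last by rewrite setTI.
  by rewrite openE => a Za; apply: filterS (nearZ a) => a' [+ _]; exact.
- exists Z; last by rewrite setTI.
  by move=> a clZ; have [a' [Za' [_ ]]] := clZ _ (nearZ a); exact.
Qed.

(** * Vanishing spreads from a point to its orbit *)

Section OrbitPropagation.
Variables (R : realType) (g : lieAlgebra R) (n : nat) (G : lieGroup R n).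
Variable theta : lieGroupAlgebra g G.
Local Notation tau := (chart_to (chart1 G)).
Local Notation sigma := (chart_from (chart1 G)).
Local Notation D := (chart_dom (chart1 G)).
Local Notation U := (chart_img (chart1 G)).
Local Notation u0 := (unit_coord G).
Local Notation rV := 'rV[R]_n.
Local Notation N := (\dim {:g}).
Local Notation e := (vbasis {:g}).
Local Notation T := (lie_tangent theta).
Local Notation Ad := (Ad theta).
Local Notation mu := (@mu R n G).
Local Notation iota_coord := (@iota_coord R n G).

Lemma Ad_comp (psi : lie_dual g) a b : ((psi \o Ad a) \o Ad b)%VF = (psi \o Ad (a * b)%g)%VF.
Proof.
have comp (A B C : 'End(g)) : (forall x, C x = A (B x)) -> ((psi \o A) \o B)%VF = (psi \o C)%VF.
  by move=> CE; apply/lfunP => y; rewrite !comp_lfunE CE.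
exact/comp/AdM.
Qed.

(** Translation by the inverse of [sigma (x t)] turns the line into a curve [kappa] that is at the
    unit at time [t], with velocity [T h]; there [sym_eval_curve] applies. *)
Lemma sigma_line_derive (v : rV) (x := fun t : R => u0 + t *: v) t (psi : lie_dual g)
    (f : mpoly N R) h :
  U (x t) -> D (sigma (x t))^-1%g -> T h = 'D_(0, v) mu (iota_coord (x t), x t) ->
  is_derive t (1 : R) (fun s => sym_eval f (psi \o Ad (sigma (x s)))%VF : R)
    (\sum_l coord e l h * sym_eval (ham_field (g := g) l f) (psi \o Ad (sigma (x t)))%VF).
Proof.
move=> Ux Dx Th.
pose kappa (s : R) : rV := mu (iota_coord (x t), x s).
have dx : is_diff t x (fun s => s *: v).
  by apply: is_diff_eq; apply/funext => s /=; rewrite add0r.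
have dp : is_diff t (fun s => (iota_coord (x t), x s)) (fun s => (0, s *: v)).
  exact: is_diff_pair.
have dm : is_diff (iota_coord (x t), x t) mu ('d mu (iota_coord (x t), x t)).
  exact/differentiableP/iota_mu.
have [dk dkv] : is_diff t kappa ('d mu (iota_coord (x t), x t) \o (fun s => (0, s *: v))).
  exact: (is_diff_comp dp dm).
have k0 : kappa t = u0.
  by rewrite /kappa /mu /= sigma_iota// mulVg.
have dk1 : T h = 'd kappa t 1.
  by rewrite dkv /= scale1r Th deriveE//; exact: iota_mu.
have := sym_eval_curve (psi \o Ad (sigma (x t)))%VF f dk k0 dk1.
apply: near_eq_is_derive.
have cx : {for t, continuous x} by apply: differentiable_continuous; case: dx.
have cont : {for t, continuous (fun s => (sigma (x t))^-1 * sigma (x s))%g}.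
  apply: mul_cont; first exact: cst_continuous.
  by apply: (continuous_comp cx); exact: sigma_cont.
have nearD : \forall s \near t, D ((sigma (x t))^-1 * sigma (x s))%g.
  by apply: cont; rewrite /= mulVg; exact/nbhs_D/D1.
apply: filterS nearD => s Ds.
have -> : sigma (kappa s) = ((sigma (x t))^-1 * sigma (x s))%g.
  by rewrite /kappa /mu /= sigma_iota// chart_toK.
by rewrite Ad_comp mulVKg.
Qed.

Lemma near_coord_bound : exists C : R, \forall x \near u0,
  [/\ U x, D (sigma x)^-1%g & forall j k, `|('D_(0, delta_mx 0 j) mu (iota_coord x, x)) 0 k| <= C].
Proof.
pose d j k (x : rV) := ('D_(0, delta_mx 0 j) mu (iota_coord x, x)) 0 k : R.
exists (\sum_(jk : 'I_n * 'I_n) (`|d jk.1 jk.2 u0| + 1)).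
have cd j k : {for u0, continuous (d j k)}.
  apply: differentiable_continuous; apply: coord_diff.
  apply: (@differentiable_comp _ _ _ _ (fun u => (iota_coord u, u)) (fun x => 'D_(0, delta_mx 0 j) mu x)).
    by apply: differentiable_pair => //; exact: iota_diff_u0.
  by rewrite iota_u0; exact: Dmu_diff_u0.
have nd j k : \forall x \near u0, `|d j k x| <= `|d j k u0| + 1.
  have cdu : d j k x @[x --> u0] --> d j k u0 by exact: cd.
  have /cvgr_dist_le/(_ _ ltr01) := cdu; apply: filterS => x.
  by have := ler_normB (d j k u0) (d j k u0 - d j k x); rewrite subKr => h1 h2; apply: le_trans h1 _; rewrite lerD2l.
have nd' : \forall x \near u0, forall jk : 'I_n * 'I_n, `|d jk.1 jk.2 x| <= `|d jk.1 jk.2 u0| + 1.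
  by apply: (@filter_forall _ _ _ (nbhs u0)) => -[j k]; exact: nd.
have niv := inv_near G.
apply: filterS2 niv nd' => x [Ux Dx] bx; split=> // j k.
apply: le_trans (bx (j, k)) _.
by apply: (ler_sum_term (F := fun jk => `|d jk.1 jk.2 u0| + 1)) => jk; exact: addr_ge0.
Qed.

Lemma near_translate (P : set G) a : nbhs (1%g : G) P ->
  (\forall a' \near a, P (a * a'^-1)%g) /\ (\forall a' \near a, P (a' * a^-1)%g).
Proof.
move=> P1.
have c1 : {for a, continuous (fun a' : G => a * a'^-1)%g}.
  by apply: mul_cont; [exact: cst_continuous|apply: inv_cont => ?].
have c2 : {for a, continuous (fun a' : G => a' * a^-1)%g}.
  by apply: mul_cont; [move=> ?|exact: cst_continuous].
by split; [apply: c1|apply: c2]; rewrite /= mulgV.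
Qed.

Section Stable.
Variable W : mpoly N R -> Prop.
Hypotheses (W0 : W 0) (WL : forall c p q, W p -> W q -> W (c *: p + q)).
Hypothesis Wth : forall l p, W p -> W (ham_field (g := g) l p).
Let zero (psi : lie_dual g) := forall f, W f -> sym_eval f psi = 0.

(** The neighbourhood is the same for every [psi]; this uniformity makes the set of zeros both open
    and closed. On the segment from [u0] to [u], finitely many elements of [W] satisfy a linear
    system with bounded coefficients and vanish at the start. *)
Lemma near_u0_vanishing : \forall u \near u0, forall psi, zero psi -> zero (psi \o Ad (sigma u))%VF.
Proof.
have [C nC] := near_coord_bound.
have /nbhs_normP[rho rho0 ballC] := nC.
apply/nbhs_normP; exists rho => // u; rewrite /ball_/= => u_rho psi zpsi f Wf.
pose v := u - u0; pose x (t : R) := u0 + t *: v.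
have x1 : x 1 = u by rewrite /x scale1r addrC subrK.
have x0 : x 0 = u0 by rewrite /x scale0r addr0.
have good t : 0 <= t <= 1 -> [/\ U (x t), D (sigma (x t))^-1%g &
    forall j k, `|('D_(0, delta_mx 0 j) mu (iota_coord (x t), x t)) 0 k| <= C].
  move=> /andP[t0 t1]; apply: ballC; rewrite /ball_ /= /x opprD addrA subrr add0r normrN normrZ ger0_norm//.
  apply: le_lt_trans u_rho; rewrite -normrN opprB -/v.
  by rewrite ler_piMl.
pose dm t : rV := 'D_(0, v) mu (iota_coord (x t), x t).
pose h t : g := (T^-1)%VF (dm t).
pose c l k : R := coord e l ((T^-1)%VF (delta_mx 0 k)).
have cE l w : coord e l ((T^-1)%VF w) = \sum_k w 0 k * c l k.
  rewrite {1}[w]row_sum_delta !linear_sum; apply: eq_bigr => k _.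
  by rewrite !linearZ.
pose b l : R := \sum_j \sum_k `|v 0 j| * C * `|c l k|.
have hb t l : 0 <= t <= 1 -> `|coord e l (h t)| <= b l.
  move=> t01; have [Ux Dx bx] := good t t01.
  have dmE : dm t = \sum_j v 0 j *: 'D_(0, delta_mx 0 j) mu (iota_coord (x t), x t).
    have dmu := iota_mu Ux Dx.
    pose L : rV -> rV := fun z => 'd mu (iota_coord (x t), x t) (0, z).
    have linL : linear L by move=> a y z; rewrite /L pair_linr linearP.
    pose L' : {linear rV -> rV} := HB.pack L (GRing.isLinear.Build _ _ _ _ _ linL).
    rewrite /dm deriveE// -[LHS]/(L' _) diff_sum_coord; apply: eq_bigr => j _.
    by rewrite deriveE.
  have -> : coord e l (h t) = \sum_j \sum_k v 0 j * ('D_(0, delta_mx 0 j) mu (iota_coord (x t), x t)) 0 k * c l k.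
    rewrite /h dmE !linear_sum; apply: eq_bigr => j _.
    by rewrite !linearZ /= cE mulr_sumr; apply: eq_bigr => k _; rewrite mulrA.
  apply: le_trans (ler_norm_sum _ _ _) _; apply: ler_sum => j _.
  apply: le_trans (ler_norm_sum _ _ _) _; apply: ler_sum => k _.
  by rewrite !normrM ler_wpM2r// ler_wpM2l.
have [r [w [a [E [Ww fE thw]]]]] := ham_field_stable_finite W0 WL Wth Wf.
pose F k t : R := sym_eval (w k) (psi \o Ad (sigma (x t)))%VF.
pose M t k k' : R := \sum_l coord e l (h t) * E l k k'.
have F1 k : F k 1 = 0.
  apply: (@linear_ode_zero _ _ F M (\sum_l \sum_(ij : 'I_r * 'I_r) b l * `|E l ij.1 ij.2|)) => [t t01 i|t t01 i j|i].
  - have [Ux Dx _] := good t t01.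
    have := @sigma_line_derive v t psi (w i) (h t) Ux Dx (tangentVK _ _).
    move=> d; apply: (is_derive_eq d).
    under [RHS]eq_bigr do rewrite mulr_suml.
    rewrite exchange_big; apply: eq_bigr => l _ /=.
    rewrite thw /F {1}/sym_eval raddf_sum mulr_sumr; apply: eq_bigr => j _ /=.
    by rewrite mevalZ mulrA.
  - apply: le_trans (ler_norm_sum _ _ _) _; apply: ler_sum => l _.
    have b0 : 0 <= b l by apply: le_trans (hb t l t01).
    rewrite normrM; apply: (@le_trans _ _ (b l * `|E l i j|)); first by rewrite ler_wpM2r// hb.
    by apply: (ler_sum_term (F := fun ij => b l * `|E l ij.1 ij.2|) (i, j)) => ij; exact: mulr_ge0.
  - rewrite /F x0 sigma_u0.
    have -> : (psi \o Ad 1%g)%VF = psi.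
      by apply/lfunP => y; apply: etrans (comp_lfunE _ _ _) _; congr (psi _); exact: Ad1.
    exact: zpsi.
rewrite fE -x1 /sym_eval raddf_sum big1// => k _ /=.
by rewrite mevalZ [X in _ * X]F1 mulr0.
Qed.

Let good : set G := [set b | forall psi, zero psi -> zero (psi \o Ad b)%VF].

Lemma near1_vanishing : nbhs (1%g : G) good.
Proof.
have ct : {for (1%g : G), continuous tau} by apply: chart_to_continuous; exact: D1.
have n1 : \forall b \near (1%g : G), D b by exact/nbhs_D/D1.
have n2 : \forall b \near (1%g : G), forall psi, zero psi -> zero (psi \o Ad (sigma (tau b)))%VF.
  exact: (ct _ near_u0_vanishing).
apply: filterS2 n1 n2 => b Db zb psi.
by have := zb psi; rewrite (chart_toK Db).
Qed.

(* The set of [a] with [zero (coAd theta a phi)] is open and closed. *)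
Lemma orbit_vanishing (phi : lie_dual g) : connected [set: G] -> zero phi ->
  forall a, zero (coAd theta a phi).
Proof.
move=> conn z0; pose Z : set G := [set a | zero (coAd theta a phi)].
have coAdE' a a' : coAd theta a' phi = (coAd theta a phi \o Ad (a * a'^-1)%g)%VF.
  by rewrite coAd_comp invgM invgK mulgVK.
have nearZ a : \forall a' \near a, (Z a -> Z a') /\ (Z a' -> Z a).
  have [n1 n2] := near_translate a near1_vanishing.
  apply: filterS2 n1 n2 => a' h1 h2; split=> Za; rewrite /Z /=.
    by rewrite (coAdE' a); exact: h1.
  by rewrite (coAdE' a'); exact: h2.
have ZT : Z = [set: G].
  apply: connected_locally_constant conn _ nearZ; exists 1%g => f Wf.
  have -> : coAd theta 1%g phi = phi; last exact: z0.
  by apply/lfunP => y; apply: etrans (coAdE _ _ _ _) _; rewrite invg1; congr (phi _); exact: Ad1.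
by move=> a; have : Z a by rewrite ZT.
Qed.
End Stable.
End OrbitPropagation.

(** * Poisson ideals of semisimple orbits *)

(* An Euler operator has the eigenvalue [d] on ['X^d], so subtracting it from
   [d] removes the leading term. *)
Lemma euler_stable_horner0 (R : rcfType) (E : set {poly R}) :
  (forall a p q, E p -> E q -> E (a *: p + q)) -> (forall p, E p -> E ('X * p^`())) ->
  (forall p, E p -> p.[1] = 0) -> forall p, E p -> p.[0] = 0.
Proof.
move=> EL Eeuler E1 p; have [d] : exists d, (size p <= d.+1)%N by exists (size p).
elim: d p => [|d IHd] p sp Ep.
  by have := E1 p Ep; move/size1_polyC: sp => ->; rewrite !hornerC.
have E0 : E 0 by rewrite -(addNr p) -scaleN1r; exact: (EL).
pose q := - 1 *: ('X * p^`()) + (d.+1%:R *: p + 0).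
have qE i : q`_i = (d.+1%:R - i%:R) * p`_i.
  rewrite /q addr0 scaleN1r coefD coefN coefZ coefXM coef_deriv; case: i => [|i] /=; first by ring.
  by rewrite -mulr_natl; ring.
have q0 : q.[0] = 0.
  apply: IHd; last by apply: (EL); [exact: Eeuler|exact: (EL)].
  apply/leq_sizeP => i; rewrite leq_eqVlt qE => /predU1P[<-|di]; first by rewrite subrr mul0r.
  by rewrite nth_default ?mulr0// (leq_trans sp).
move: q0; rewrite !horner_coef0 qE subr0 => /eqP.
by rewrite mulf_eq0 pnatr_eq0 /= => /eqP.
Qed.

Section PoissonIdeals.
Variables (R : rcfType) (g : lieAlgebra R).
Local Notation N := (\dim {:g}).
Local Notation e := (vbasis {:g}).
Local Notation S := (mpoly N R).
Local Notation ham_field := (ham_field (g := g)).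

Implicit Types P : 'M[S]_N.

(** The ideal generated by the entries of [P]. In the form of traces, cyclicity moves a commutator
    from [P] to the coefficients. *)
Definition entry_ideal P : set S := [set f | exists C, f = \tr (C *m P)].

Lemma entry_idealD P a b : entry_ideal P a -> entry_ideal P b -> entry_ideal P (a + b).
Proof. by move=> [C ->] [C' ->]; exists (C + C'); rewrite mulmxDl mxtraceD. Qed.

Lemma entry_ideal0 P : entry_ideal P 0.
Proof. by exists 0; rewrite mul0mx mxtrace0. Qed.

Lemma entry_idealM P c a : entry_ideal P a -> entry_ideal P (c * a).
Proof. by move=> [C ->]; exists (c *: C); rewrite -scalemxAl mxtraceZ. Qed.

Lemma entry_ideal_entry P i j : entry_ideal P (P i j).
Proof.
exists (delta_mx j i); rewrite /mxtrace (bigD1 j)//= big1 ?addr0 => [|k /negPf kj].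
  rewrite mxE (bigD1 i)//= big1 ?addr0 => [|k /negPf ki]; first by rewrite mxE !eqxx mul1r.
  by rewrite mxE ki andbF mul0r.
by rewrite mxE big1// => l _; rewrite mxE kj mul0r.
Qed.

Lemma entry_ideal_eval P f (phi : lie_dual g) : (forall i j, sym_eval (P i j) phi = 0) ->
  entry_ideal P f -> sym_eval f phi = 0.
Proof.
move=> P0 [C ->]; rewrite /mxtrace [LHS](rmorph_sum (meval _)) big1// => i _.
rewrite mxE [LHS](rmorph_sum (meval _)) big1// => j _.
by rewrite rmorphM /= [X in _ * X]P0 mulr0.
Qed.

Hypothesis ndg : killing_mx g \in unitmx.
Local Notation Ag := (adA (@mpolyC N R) (gen_elt g)).

Lemma entry_ideal_ham_field m l f (P := hmx (map_poly (@mpolyC N R) m) Ag) :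
  entry_ideal P f -> entry_ideal P (ham_field l f).
Proof.
move=> [C ->]; pose Al := map_mx (@mpolyC N R) (ad_mx e`_l).
have -> : ham_field l (\tr (C *m P)) = \tr (map_mx (ham_field l) (C *m P)).
  by rewrite /mxtrace [LHS]vfield_sum; apply: eq_bigr => i _; rewrite [RHS]mxE.
rewrite vfield_mx (ham_field_hmx ndg l m) -/P -/Al mulmxBr mxtraceD raddfB /=.
exists (map_mx (ham_field l) C + C *m Al - Al *m C).
rewrite mulmxBl mulmxDl !raddfB !raddfD /= !mulmxA -addrA; congr (_ + (_ - _)).
by rewrite [in RHS]mxtrace_mulC mulmxA mxtrace_mulC -mulmxA mxtrace_mulC.
Qed.

Lemma killing_representative (phi : lie_dual g) : exists x, forall y, phi y = killing x y.
Proof.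
exists (vecof e ((\row_i phi e`_i) *m invmx (killing_mx g))) => y.
rewrite killingE vecofK ?vbasisP// mulmxKV// {1}(coord_vbasis (memvf y)) linear_sum mxE.
by apply: eq_bigr => i _; rewrite linearZ !mxE /= mulrC; congr (_ * _).
Qed.

Section SemisimplePart.
Variables (I : set S) (x s h : g) (phi psi : lie_dual g).
Hypotheses (I0 : I 0) (ID : forall a b, I a -> I b -> I (a + b)) (IM : forall c a, I a -> I (c * a)).
Hypothesis Ith : forall l f, I f -> I (ham_field l f).
Hypotheses (hs : lie h s = 0) (hx : lie h x = x - s).
Hypotheses (phiE : forall y, phi y = killing x y) (psiE : forall y, psi y = killing s y).

(* The flow of [h] moves [x] along the line through [s] and [x]. *)
Lemma ideal_vanish_semisimple_part : (forall f, I f -> sym_eval f phi = 0) ->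
  forall f, I f -> sym_eval f psi = 0.
Proof.
move=> Iphi; pose chi : lie_dual g := phi - psi.
(* [ev] restricts polynomials to the line [psi + t chi], which passes through [psi] at [t = 0] and
   through [phi] at [t = 1]. *)
pose z (i : 'I_N) : {poly R} := (psi e`_i)%:P + chi e`_i *: 'X.
have [ev [evC evX]] : exists ev : {rmorphism S -> {poly R}},
    (forall c, ev (mpolyC N c) = c%:P) /\ (forall i, ev (mpolyX R (mnm1 i)) = z i).
  exists (meval z \o map_mpoly polyC); split=> [c|i] /=; first by rewrite map_mpolyC mevalC.
  by rewrite map_mpolyX mevalXU.
have ev_horner a f : (ev f).[a] = meval (fun i => (z i).[a]) f.
  elim/mpoly_alg_ind: f => [c|i|p q IHp IHq|p q IHp IHq].
  - by rewrite evC hornerC mevalC.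
  - by rewrite evX mevalXU.
  - by rewrite rmorphD hornerD IHp IHq mevalD.
  - by rewrite rmorphM hornerM IHp IHq mevalM.
have z0 i : (z i).[0] = psi e`_i by rewrite /z hornerD hornerC hornerZ hornerX mulr0 addr0.
have z1 i : (z i).[1] = phi e`_i.
  by rewrite /z hornerD hornerC hornerZ hornerX mulr1 addrC -add_lfunE subrK.
pose Dh (f : S) : S := \sum_l coord e l h *: ham_field l f.
have DhM p q : Dh (p * q) = Dh p * q + p * Dh q.
  rewrite mulr_suml mulr_sumr -big_split; apply: eq_bigr => l _ /=.
  by rewrite /ham_field vfieldM scalerDr -scalerAl -scalerAr.
have DhX i : Dh (mpolyX R (mnm1 i)) = sym_of (lie h e`_i).
  rewrite /sym_of [X in lie X _](coord_vbasis (memvf h)) lie_suml.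
  under [RHS]eq_bigr do rewrite linear_sum scaler_suml.
  rewrite exchange_big; apply: eq_bigr => l _ /=.
  rewrite /ham_field vfieldX !mxE scaler_sumr; apply: eq_bigr => k _.
  by rewrite lieZl [in RHS]linearZ; exact: scalerA.
have lfZ (f : lie_dual g) c v : f (c *: v) = c * f v by rewrite linearZ.
have ev_of y : ev (sym_of y) = (psi y)%:P + chi y *: 'X.
  rewrite /sym_of rmorph_sum /= {2 3}(coord_vbasis (memvf y)) !linear_sum scaler_suml rmorph_sum /=.
  rewrite -big_split; apply: eq_bigr => i _ /=.
  rewrite -mul_mpolyC -/(ev _) rmorphM evC evX /z !lfZ polyCM mulrDr -scalerA.
  by rewrite !mul_polyC.
have killingNl a y : killing (- a) y = - killing a y.
  by rewrite -(scaleN1r a) killingZl mulN1r.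
have chiE y : chi y = killing (x - s) y.
  by rewrite add_lfunE opp_lfunE phiE psiE killingDl killingNl.
(* As [[h, s] = 0] and [[h, x - s] = x - s], the Hamiltonian field of [h] restricts to minus the
   Euler operator of the line; stability under it takes the place of a limit along the flow. *)
have evD f : ev (Dh f) = - ('X * (ev f)^`()).
  elim/mpoly_alg_ind: f => [c|i|p q IHp IHq|p q IHp IHq].
  - rewrite evC derivC mulr0 oppr0 /Dh big1 ?rmorph0// => l _.
    by rewrite /ham_field vfieldC scaler0.
  - rewrite DhX ev_of evX /z derivD derivC derivZ derivX add0r.
    have -> : psi (lie h e`_i) = 0.
      by rewrite psiE -killing_invar lieC hs oppr0 -(scale0r 0) killingZl mul0r.
    have -> : chi (lie h e`_i) = - chi e`_i.
      rewrite !chiE -killing_invar lieC linearB /= hx hs subr0.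
      by rewrite killingNl.
    by rewrite add0r scaleNr -scalerAr mulr1.
  - have -> : Dh (p + q) = Dh p + Dh q.
      by rewrite -big_split; apply: eq_bigr => l _ /=; rewrite /ham_field vfieldD scalerDr.
    by rewrite !rmorphD /= IHp IHq derivD mulrDr opprD.
  - rewrite DhM rmorphD !rmorphM IHp IHq derivM; ring.
move=> f If; have -> : sym_eval f psi = (ev f).[0].
  by rewrite ev_horner; apply: meval_eq => i; rewrite z0.
apply: (euler_stable_horner0 (E := [set p | exists2 f, I f & p = ev f])); last by exists f.
- move=> a _ _ [p Ip ->] [q Iq ->]; exists (mpolyC N a * p + q); first by apply: ID => //; exact: IM.
  by rewrite rmorphD rmorphM evC mul_polyC.
- move=> _ [p Ip ->]; exists (- Dh p); last by rewrite rmorphN evD opprK.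
  rewrite -mulN1r; apply: IM; rewrite /Dh; elim/big_ind: _ => //= l _.
  by rewrite -mul_mpolyC; exact/IM/Ith.
- move=> _ [p Ip ->]; rewrite ev_horner -(Iphi p Ip).
  by apply: meval_eq => i; rewrite z1.
Qed.
End SemisimplePart.
End PoissonIdeals.

(** * Poisson ideals of the algebra of the orbit *)

Section OrbitAlgebra.
Variables (R : realType) (g : lieAlgebra R) (n : nat) (G : lieGroup R n).
Variables (theta : lieGroupAlgebra g G) (O : coadjointOrbit theta).
Local Notation N := (\dim {:g}).
Local Notation e := (vbasis {:g}).
Local Notation S := (mpoly N R).
Local Notation ham_field := (ham_field (g := g)).
Local Notation P := (orbit_alg O).
Local Notation proj := (\pi_P)%qT.
Let I : set S := [set f | forall phi, orbit_set O phi -> sym_eval f phi = 0].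

Lemma coAdM a b phi : coAd theta a (coAd theta b phi) = coAd theta (a * b)%g phi.
Proof. by apply: etrans (coAd_comp theta b (a^-1)%g phi) _; rewrite invgK. Qed.

Lemma orbit_transitive phi psi : orbit_set O phi -> orbit_set O psi ->
  exists a, psi = coAd theta a phi.
Proof.
have [phi0 ->] := orbitP O; move=> [b _ <-] [a _ <-]; exists (a * b^-1)%g.
by rewrite coAdM mulgVK.
Qed.

Lemma orbit_stable phi a : orbit_set O phi -> orbit_set O (coAd theta a phi).
Proof.
have [phi0 ->] := orbitP O; move=> [b _ <-]; rewrite coAdM.
by apply: (@imageP _ _ (coAd theta ^~ phi0)).
Qed.

Lemma vanishing_ham_field l f : I f -> I (ham_field l f).
Proof.
move=> If phi Ophi; have -> : phi = coAd theta 1%g phi.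
  by apply/lfunP => y; apply: etrans _ (esym (coAdE _ _ _ _)); rewrite invg1; congr (phi _); exact/esym/Ad1.
by apply: orbit_vanishing_ham_field => a; exact/If/orbit_stable.
Qed.

Lemma vanishingM c f : I f -> I (c * f).
Proof. by move=> If phi Ophi; rewrite /sym_eval mevalM [X in _ * X]If// mulr0. Qed.

Lemma vanishingD f f' : I f -> I f' -> I (f + f').
Proof. by move=> If If' phi Ophi; rewrite /sym_eval mevalD [X in X + _]If// [X in _ + X]If'// addr0. Qed.

Lemma vanishing0 : I 0.
Proof. by move=> phi _; rewrite /sym_eval meval0. Qed.

Lemma projE (f f' : S) : proj (f : lie_sym g) = proj f' <-> I (f - f').
Proof.
have -> : (proj (f : lie_sym g) = proj f') <-> ((f : lie_sym g) - f' \in orbit_ideal O).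
  rewrite Quotient.idealrBE; split=> [E|/eqP//].
  by apply/eqP.
by split=> [/asboolP|?]; last exact/asboolP.
Qed.

Lemma sym_bracket_vanishing (a f f' : S) : I (f - f') -> I (sym_bracket a f - sym_bracket a f').
Proof.
move=> Iff'; rewrite !sym_bracketE -sumrB; elim/big_ind: _ => [||l _].
- exact: vanishing0.
- exact: vanishingD.
by rewrite -mulrBr -vfieldB; exact/vanishingM/vanishing_ham_field.
Qed.

(** Stability of [I] under Hamiltonian fields settles the second argument, antisymmetry the
    first. *)
Lemma orbit_bracketE (a f : lie_sym g) : orbit_bracket (proj a) (proj f) = proj (sym_bracket a f).
Proof.
rewrite /orbit_bracket; apply/projE.
have rI (p : lie_sym g) : I (repr (proj p) - p) by apply/projE; rewrite reprK.
have Br := sym_bracket_vanishing (repr (proj a)) (rI f).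
have Bl := sym_bracket_vanishing f (rI a).
have -> : sym_bracket (repr (proj a)) (repr (proj f)) - sym_bracket a f =
    (sym_bracket (repr (proj a)) (repr (proj f)) - sym_bracket (repr (proj a)) f) +
    - 1 * (sym_bracket f (repr (proj a)) - sym_bracket f a).
  by rewrite (sym_bracketN f (repr _)) (sym_bracketN f a); ring.
by apply: vanishingD => //; exact: vanishingM.
Qed.

Definition lifted (K : set P) : set S := [set f | K (proj (f : lie_sym g))].

(** Poisson ideals of the quotient correspond to the ideals of polynomials that contain [I] and are
    stable under the Hamiltonian fields of the coordinates, since every bracket is a combination of
    these. This takes the quotient out of the rest of the proof. *)
Lemma simple_lifted : poisson_simple (@orbit_bracket R g n G theta O) <->
  forall J : set S, J 0 -> (forall a b, J a -> J b -> J (a + b)) -> (forall c a, J a -> J (c * a)) ->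
    (forall l f, J f -> J (ham_field l f)) -> I `<=` J -> J 1 \/ J `<=` I.
Proof.
split=> [simp J J0 JD JM Jth IJ|simp K [K0 KD KM Kbr]].
  pose K : set P := [set u | J (repr u)].
  have KJ (f : S) : K (proj (f : lie_sym g)) <-> J f.
    have : I (repr (proj (f : lie_sym g)) - f) by apply/projE; rewrite reprK.
    rewrite -[K _]/(J (repr (proj (f : lie_sym g)))).
    move: (repr _ : S) => f' If; split=> Jf.
      rewrite -[f](subKr f'); apply: JD => //; rewrite -mulN1r.
      exact/JM/IJ.
    by rewrite -[f'](subrK f); apply: JD => //; exact: IJ.
  have [||KE] := simp K; last first.
  - right=> f /KJ; rewrite KE => E; have /projE : proj (f : lie_sym g) = proj 0 by rewrite rmorph0.
    by rewrite subr0.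
  - move=> KE; left; apply/KJ; by rewrite KE.
  split.
  - rewrite -(rmorph0 proj); exact/KJ.
  - move=> u v; rewrite -(reprK u) -(reprK v) => /KJ Ju /KJ Jv.
    rewrite -rmorphD; apply/KJ; exact: JD.
  - move=> u v; rewrite -(reprK u) -(reprK v) => /KJ Jv.
    rewrite -rmorphM; apply/KJ; exact: JM.
  - move=> u v; rewrite -(reprK u) -(reprK v) => /KJ Jv.
    rewrite orbit_bracketE; apply/KJ; rewrite sym_bracketE.
    elim/big_ind: _ => // l _; exact/JM/Jth.
have [||||f If|K1|KI] := simp (lifted K).
- by rewrite /lifted /= rmorph0.
- by move=> a b; rewrite /lifted /= rmorphD; exact: KD.
- by move=> c a; rewrite /lifted /= rmorphM; exact: KM.
- move=> l f Kf; rewrite /lifted /= ham_field_bracket -orbit_bracketE; exact: Kbr.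
- have E : proj (f : lie_sym g) = proj 0 by apply/projE; rewrite subr0.
  by rewrite /lifted /= E rmorph0.
- left; apply/seteqP; split=> // u _; rewrite -(mulr1 u); apply: KM.
  by rewrite -(rmorph1 proj).
- right; apply/seteqP; split=> [u Ku|_ ->//].
  have /KI Iu : lifted K (repr u) by rewrite /lifted /= reprK.
  have : proj (repr u) = proj 0 by apply/projE; rewrite subr0.
  by rewrite reprK rmorph0.
Qed.
End OrbitAlgebra.

(** * The two implications *)

Section OrbitSimplicity.
Variables (R : realType) (g : lieAlgebra R) (n : nat) (G : lieGroup R n).
Variables (theta : lieGroupAlgebra g G) (O : coadjointOrbit theta).
Local Notation N := (\dim {:g}).
Local Notation e := (vbasis {:g}).
Local Notation S := (mpoly N R).
Local Notation ham_field := (ham_field (g := g)).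
Local Notation Ag := (adA (@mpolyC N R) (gen_elt g)).
Let I : set S := [set f | forall phi, orbit_set O phi -> sym_eval f phi = 0].
Hypotheses (ndg : killing_mx g \in unitmx) (conn : connected [set: G]).

Lemma stable_vanishing (W : set S) phi : W 0 -> (forall a b, W a -> W b -> W (a + b)) ->
  (forall c a, W a -> W (c * a)) -> (forall l f, W f -> W (ham_field l f)) ->
  orbit_set O phi -> (forall f, W f -> sym_eval f phi = 0) -> W `<=` I.
Proof.
move=> W0 WD WM Wth Ophi Wphi f Wf psi Opsi.
have [a ->] := orbit_transitive Ophi Opsi.
apply: (@orbit_vanishing _ _ _ _ _ W) => // c p q Wp Wq.
by apply: WD => //; rewrite -mul_mpolyC; exact: WM.
Qed.

Lemma semisimple_orbit_simple : semisimple_orbit (orbit_set O) ->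
  poisson_simple (@orbit_bracket R g n G theta O).
Proof.
move=> ss; apply/simple_lifted => J J0 JD JM Jth IJ.
have [nz|] := pselect (forall phi, orbit_set O phi -> exists2 f, J f & sym_eval f phi <> 0).
  have [phi0 Ophi0] : exists phi, orbit_set O phi.
    by have [phi OE] := orbitP O; exists (coAd theta 1%g phi); rewrite OE; exact: imageP.
  have [x [phi0E ssx]] := ss phi0 Ophi0.
  (* [m] comes from a single point, where diagonalizability makes the nilpotent [m(ad x)] zero.
     Propagation of zeros, applied to the ideal of the entries, extends the equation to the whole
     orbit. *)
  have [m [p [sm m0 _ [k mk] _]]] := ad_jordan x.
  have mx0 : hmx m (ad_mx x) = 0.
    apply: (map_mx_inj (f := real_complex R)); rewrite map_hmx map_mx0.
    apply: (diagonalizable_nilp (k := k)) => //.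
    by rewrite -map_hmx -rmorphXn /= mk map_mx0.
  left; apply: (@poisson_ideal_no_zero _ _ ndg (orbit_set O) J _ _ _ IJ _ Jth m) => //.
    by move=> l f; exact: vanishing_ham_field.
  move=> i j; set P := hmx _ _.
  apply: (@stable_vanishing (entry_ideal P) phi0) => //.
  - exact: entry_ideal0.
  - exact: entry_idealD.
  - exact: entry_idealM.
  - by move=> l f; exact: entry_ideal_ham_field.
  - move=> f; apply: entry_ideal_eval => k1 k2.
    by rewrite (sym_eval_hmx ndg _ _ _ phi0E) mx0 mxE.
  - exact: entry_ideal_entry.
move=> /existsNP[phi /not_implyP[Ophi nz]]; right.
apply: (@stable_vanishing J phi) => // f Jf; apply: contrapT => fphi.
by apply: nz; exists f.
Qed.

Lemma simple_semisimple_orbit : poisson_simple (@orbit_bracket R g n G theta O) ->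
  semisimple_orbit (orbit_set O).
Proof.
move=> /simple_lifted simp phi Ophi.
have [x phiE] := killing_representative ndg phi; exists x; split=> //.
have [m [s [h [sm [k mk] ms hs hx]]]] := jordan_point ndg x.
pose P := hmx (map_poly (@mpolyC N R) m) Ag.
have [|||||[f1 [f2 [If1 Pf2 one]]]|KI] :=
    simp [set f | exists f1 f2, [/\ I f1, entry_ideal P f2 & f = f1 + f2]].
- exists 0, 0; split; [exact: vanishing0|exact: entry_ideal0|by rewrite addr0].
- move=> _ _ [a [b [Ia Pb ->]]] [a' [b' [Ia' Pb' ->]]]; exists (a + a'), (b + b').
  by split; [exact: vanishingD|exact: entry_idealD|rewrite addrACA].
- move=> c _ [a [b [Ia Pb ->]]]; exists (c * a), (c * b).
  by split; [exact: vanishingM|exact: entry_idealM|rewrite mulrDr].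
- move=> l _ [a [b [Ia Pb ->]]]; exists (ham_field l a), (ham_field l b).
  by split; [exact: vanishing_ham_field|exact: entry_ideal_ham_field|exact: vfieldD].
- move=> f If; exists f, 0; split=> //; first exact: entry_ideal0.
  by rewrite addr0.
- pose psi : lie_dual g := linfun (tr_ad (ad_mx s)).
  have psiE y : psi y = killing s y by rewrite lfunE killingC.
  have := ideal_vanish_semisimple_part (I := I) (@vanishing0 _ _ _ _ _ O) (@vanishingD _ _ _ _ _ O)
    (@vanishingM _ _ _ _ _ O) (@vanishing_ham_field _ _ _ _ _ O) hs hx phiE psiE.
  move=> /(_ (fun f If => If phi Ophi) f1 If1) f1s.
  have f2s : sym_eval f2 psi = 0.
    apply: entry_ideal_eval Pf2 => i j.
    by rewrite (sym_eval_hmx ndg _ _ _ psiE) ms mxE.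
  have : sym_eval (1 : S) psi = 0 by rewrite one /sym_eval mevalD [X in X + _]f1s [X in _ + X]f2s addr0.
  by rewrite /sym_eval meval1 => /eqP; rewrite oner_eq0.
apply: (@diagonalizable_separable _ _ _ (map_poly (real_complex R) m)).
  by rewrite separable_map.
rewrite -map_hmx; apply/eqP; rewrite map_mx_eq0; apply/eqP/matrixP => i j.
rewrite -(sym_eval_hmx ndg m i j phiE) [RHS]mxE; apply: KI => //.
exists 0, (P i j); split; [exact: vanishing0|exact: entry_ideal_entry|by rewrite add0r].
Qed.
End OrbitSimplicity.

Theorem mainTheorem3 (R : realType) (g : lieAlgebra R) (n : nat)
    (G : lieGroup R n) (theta : lieGroupAlgebra g G)
    (O : coadjointOrbit theta) :
  lie_semisimple g -> one_connected G ->
  (poisson_simple (@orbit_bracket R g n G theta O) <->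
   semisimple_orbit (orbit_set O)).
Proof.
move=> /killing_nondegenerate ndg [conn _]; split.
- exact: simple_semisimple_orbit.
- exact: semisimple_orbit_simple.
Qed.
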